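(* For every $\rho\in L^2(\gamma)$ there exists a unique solution $(\mathbf{u},\boldsymbol\lambda)\in\mathbf{V}\times\mathbf{Q}$ to the problem $$\begin{cases}\mathbf{a}(\mathbf{u},\mathbf{v})-\mathbf{b}(\boldsymbol\lambda,\mathbf{v})=\int_\gamma\rho\,v_\gamma\,dx, & \forall\,\mathbf{v}=(v_1,v_2,v_\gamma)\in\mathbf{V},\\ \mathbf{b}(\boldsymbol\mu,\mathbf{u})+\alpha\,\mathbf{c}(\boldsymbol\lambda,\boldsymbol\mu)=0, & \forall\,\boldsymbol\mu\in\mathbf{Q}.\end{cases}$$ Moreover, the following bound holds, with a constant $C>0$ independent of $\rho$ and of $\alpha$ (for fixed forms $\mathbf{a}$, $\mathbf{b}$): $$\|\mathbf{u}\|_{\mathbf{V}}^2+\|\boldsymbol\lambda\|_{\boldsymbol\Lambda}^2+\alpha\|\boldsymbol\lambda\|_{\mathbf{Q}}^2\le C\|\rho\|_{0,\gamma}^2.$$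
   Context: Geometry. Let $L,l>0$, $\Omega=\,]0,L[\times]-\frac l2,\frac l2[$, $\Omega_1=\,]0,L[\times]0,\frac l2[$, $\Omega_2=\,]0,L[\times]-\frac l2,0[$, and let $\gamma=\,]0,L[$, identified with the segment $]0,L[\times\{0\}$ (the interface). The boundary splits as $\partial\Omega=\Gamma_D\cup\Gamma_N$ with $\Gamma_D\cap\Gamma_N=\emptyset$; put $\Gamma_D^i=\partial\Omega_i\cap\Gamma_D$, $\Gamma_N^i=\partial\Omega_i\cap\Gamma_N$. The set $\Gamma_D$ contains the endpoints $(0,0),(L,0)$ of $\gamma$, and $\overline{\Gamma_N^i}\cap\overline\gamma=\emptyset$ for $i=1,2$. The numbers $d,\epsilon_{ox},\epsilon_{//},\epsilon_\perp$ are positive constants, and $\alpha=\frac{d}{2\epsilon_\perp}$ (the parameter $\epsilon_\perp$ enters only through $\alpha$). Notation. $\|\cdot\|_{m,D}$ is the $H^m(D)$ norm. For $\Gamma'\subset\partial\Omega_i$, $H^1_{0,\Gamma'}(\Omega_i)=\{v\in H^1(\Omega_i): v=0\text{ on }\Gamma'\}$. $H^{1/2}_{00}(\gamma)$ is the space of traces on $\gamma$ of functions in $H^1_{0,\partial\Omega_i\setminus\gamma}(\Omega_i)$, with norm $\|\sigma\|_{1/2,\gamma}=\inf\{\|v\|_{1,\Omega_i}: v\in H^1_{0,\partial\Omega_i\setminus\gamma}(\Omega_i),\ v|_\gamma=\sigma\}$ (the same space and norm for $i=1,2$ by reflection). $\langle\cdot,\cdot\rangle_\gamma$ is the duality between $(H^{1/2}_{00}(\gamma))'$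 and $H^{1/2}_{00}(\gamma)$; when the first argument is in $L^2(\gamma)$ it is the $L^2(\gamma)$ integral. Spaces. $V^i=H^1_{0,\Gamma_D^i}(\Omega_i)$ ($i=1,2$), $V^\gamma=H^1_0(\gamma)$, $\mathbf{V}=V^1\times V^2\times V^\gamma$ with norm $\|\mathbf{u}\|_{\mathbf{V}}=\big(\sum_{i=1}^2\|u_i\|_{1,\Omega_i}^2+\|u_\gamma\|_{1,\gamma}^2\big)^{1/2}$ for $\mathbf{u}=(u_1,u_2,u_\gamma)$. $\Lambda^i=(H^{1/2}_{00}(\gamma))'$ and $\boldsymbol\Lambda=\Lambda^1\times\Lambda^2$ with norm $\|\boldsymbol\lambda\|_{\boldsymbol\Lambda}=\big(\sum_{i=1}^2\|\lambda_i\|_{-1/2,\gamma}^2\big)^{1/2}$, where $\|\lambda_i\|_{-1/2,\gamma}=\sup_{v\in H^1_{0,\partial\Omega_i\setminus\gamma}(\Omega_i)}\frac{\langle\lambda_i,v\rangle_\gamma}{\|v\|_{1,\Omega_i}}$. $\mathbf{Q}=(L^2(\gamma))^2\subset\boldsymbol\Lambda$ with norm $\|\boldsymbol\lambda\|_{\mathbf{Q}}=\big(\sum_{i=1}^2\|\lambda_i\|_{0,\gamma}^2\big)^{1/2}$. For $u_i\in V^i$ one has $u_i|_\gamma\in H^{1/2}_{00}(\gamma)$, and $V^\gamma\subset H^{1/2}_{00}(\gamma)$. Bilinear forms. $$\mathbf{a}(\mathbf{u},\mathbf{v})=\sum_{i=1}^2\int_{\Omega_i}\epsilon_{ox}\nabla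 u_i\cdot\nabla v_i\,dx\,dy+d\int_\gamma\epsilon_{//}u_\gamma'v_\gamma'\,dx,\qquad \mathbf{b}(\boldsymbol\mu,\mathbf{u})=\sum_{i=1}^2\langle\mu_i,u_i|_\gamma-u_\gamma\rangle_\gamma,\qquad \mathbf{c}(\boldsymbol\lambda,\boldsymbol\mu)=\sum_{i=1}^2\int_\gamma\lambda_i\mu_i\,dx .$$ *)

(* Defs.v *)
From HB Require Import structures.
From mathcomp Require Import all_boot all_order all_algebra.
From mathcomp Require Import all_classical all_reals all_analysis.

Set Implicit Arguments.
Unset Strict Implicit.
Unset Printing Implicit Defensive.

Import Order.TTheory GRing.Theory Num.Theory.
Import numFieldNormedType.Exports.

Local Open Scope classical_set_scope.
Local Open Scope ring_scope.

(* Elements of L^2, H^1, ... are represented by measurable functions on the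
   whole line or plane; a measure [mu] restricted to the domain is used
   throughout, so values outside of the domain are irrelevant, and equality in
   these spaces is equality [mu]-almost everywhere. *)

Section lebesgue2.
Context d (T : measurableType d) (R : realType).
Variable mu : {measure set T -> \bar R}.

Definition L2 : set (T -> R) := [set f | f \in Lfun mu 2%:E].

Definition L2norm (f : T -> R) : R := fine 'N[mu]_2%:E[EFin \o f].

End lebesgue2.

Definition boundary (T : topologicalType) (A : set T) : set T :=
  closure A `\` interior A.

Section line.
Context (R : realType).
Variables a b : R.
Implicit Types (u v f g : R -> R).

Definition segment_measure : {measure set (measurableTypeR R) -> \bar R} :=
  mrestr (@lebesgue_measure R) (measurable_itv `]a, b[).

Definition smooth1 f := forall (n : nat) (x : R), derivable (derive1n n f) x 1.

Definition test1 f :=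
  [/\ smooth1 f,
      compact (closure [set x | f x != 0]) &
      closure [set x | f x != 0] `<=` [set` `]a, b[] ].

Definition is_weak_deriv u g :=
  L2 segment_measure g /\
  forall phi, test1 phi ->
    \int[segment_measure]_x (u x * derive1 phi x) =
    - \int[segment_measure]_x (g x * phi x).

(* The choice of a representative; it is unique almost everywhere. *)
Definition weak_deriv u : R -> R := xget (cst 0) (is_weak_deriv u).

Definition H1_seg u := L2 segment_measure u /\ exists g, is_weak_deriv u g.

Definition H1norm_seg u : R :=
  Num.sqrt (L2norm segment_measure u ^+ 2 +
            L2norm segment_measure (weak_deriv u) ^+ 2).

(* H^1_0 is the closure in H^1 of the smooth functions of compact support. *)
Definition H10_seg u :=
  H1_seg u /\
  exists phi : nat -> R -> R,
    (forall n, test1 (phi n)) /\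
    H1norm_seg (phi n \- u) @[n --> \oo] --> 0.

End line.

Record rectangle (R : realType) := Rectangle {
  x_lo : R ; x_hi : R ; y_lo : R ; y_hi : R }.

Section plane.
Context (R : realType).
Implicit Types (D : rectangle R) (u v f g : R * R -> R).

Definition open_rect D : set (R * R) :=
  [set` `]x_lo D, x_hi D[ ] `*` [set` `]y_lo D, y_hi D[ ].

Definition closed_rect D : set (R * R) :=
  [set` `[x_lo D, x_hi D] ] `*` [set` `[y_lo D, y_hi D] ].

Lemma measurable_open_rect D :
  measurable (open_rect D : set (measurableTypeR R * measurableTypeR R)).
Proof. by apply: measurableX; exact: measurable_itv. Qed.

Lemma measurable_closed_rect D :
  measurable (closed_rect D : set (measurableTypeR R * measurableTypeR R)).
Proof. by apply: measurableX; exact: measurable_itv. Qed.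

Local Notation leb := (@lebesgue_measure R).
Local Notation plane := (measurableTypeR R * measurableTypeR R)%type.

Definition area D : {measure set plane -> \bar R} :=
  mrestr (leb \x leb)%E (measurable_open_rect D).

Local Notation pointmass a := (dirac (a : measurableTypeR R)).

(* Arc length on the boundary of the rectangle, as a measure on the plane: the
   one-dimensional Lebesgue measure on the four lines carrying the sides,
   restricted to the closed rectangle. *)
Definition arclen D : {measure set plane -> \bar R} :=
  mrestr
    (measure_add
      (measure_add (leb \x pointmass (y_lo D)) (leb \x pointmass (y_hi D)))
      (measure_add (pointmass (x_lo D) \x leb) (pointmass (x_hi D) \x leb)))%E
    (measurable_closed_rect D).

Definition axis (i : 'I_2) : R * R := if i == 0 then (1, 0) else (0, 1).

Definition partial (i : 'I_2) f : R * R -> R := fun p => 'D_(axis i) f p.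

Definition smooth2 f :=
  forall s : seq 'I_2, let g := foldr partial f s in
    continuous g /\ forall i p, derivable g p (axis i).

Definition test2 D f :=
  [/\ smooth2 f,
      compact (closure [set p | f p != 0]) &
      closure [set p | f p != 0] `<=` open_rect D ].

Definition is_weak_partial D (i : 'I_2) u g :=
  L2 (area D) g /\
  forall phi, test2 D phi ->
    \int[area D]_p (u p * partial i phi p) =
    - \int[area D]_p (g p * phi p).

(* The choice of a representative; it is unique almost everywhere. *)
Definition weak_partial D (i : 'I_2) u : R * R -> R :=
  xget (cst 0) (is_weak_partial D i u).

Definition H1 D u := L2 (area D) u /\ forall i, exists g, is_weak_partial D i u g.

Definition H1norm D u : R :=
  Num.sqrt (L2norm (area D) u ^+ 2 +
            \sum_(i < 2) L2norm (area D) (weak_partial D i u) ^+ 2).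

(* The trace map is the continuous extension to H^1 of the restriction to the
   boundary of the functions that are smooth up to the boundary. *)
Definition is_trace D u g :=
  L2 (arclen D) g /\
  exists phi : nat -> R * R -> R,
    [/\ forall n, smooth2 (phi n),
        H1norm D (phi n \- u) @[n --> \oo] --> 0 &
        L2norm (arclen D) (phi n \- g) @[n --> \oo] --> 0].

(* The choice of a representative; it is unique almost everywhere. *)
Definition trace D u : R * R -> R := xget (cst 0) (is_trace D u).

Definition H10 D (Gam : set (R * R)) u :=
  H1 D u /\
  exists g, is_trace D u g /\ {ae arclen D, forall p, Gam p -> g p = 0}.

End plane.

Section problem.
Context (R : realType).
Variables (L l : R) (GammaD : set (R * R)) (d eps_ox eps_par : R).

Definition Omega : set (R * R) := open_rect (Rectangle 0 L (- (l / 2)) (l / 2)).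

(* Index 0 stands for Omega_1 and index 1 for Omega_2. *)
Definition sub_rect (i : 'I_2) : rectangle R :=
  if i == 0 then Rectangle 0 L 0 (l / 2) else Rectangle 0 L (- (l / 2)) 0.

Definition Omega_ (i : 'I_2) : set (R * R) := open_rect (sub_rect i).

Definition gamma2 : set (R * R) := [set` `]0, L[ ] `*` [set 0].

Local Notation mu_gamma := (segment_measure 0 L).

Definition trace_gamma (i : 'I_2) (v : R * R -> R) : R -> R :=
  fun x => trace (sub_rect i) v (x, 0).

Definition space_V_ (i : 'I_2) : set (R * R -> R) :=
  H10 (sub_rect i) (boundary (Omega_ i) `&` GammaD).

(* (u_1, u_2, u_gamma), the first two being gathered in a family *)
Definition triple : Type := (('I_2 -> R * R -> R) * (R -> R))%type.

Definition space_V : set triple :=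
  [set u | (forall i, space_V_ i (u.1 i)) /\ H10_seg 0 L u.2].

Definition eq_V (u v : triple) :=
  (forall i, u.1 i = v.1 i %[ae area (sub_rect i)]) /\
  u.2 = v.2 %[ae mu_gamma].

Definition norm_V (u : triple) : R :=
  Num.sqrt (\sum_(i < 2) H1norm (sub_rect i) (u.1 i) ^+ 2 +
            H1norm_seg 0 L u.2 ^+ 2).

Definition space_Q : set ('I_2 -> R -> R) :=
  [set lam | forall i, L2 mu_gamma (lam i)].

Definition eq_Q (lam mu : 'I_2 -> R -> R) :=
  forall i, lam i = mu i %[ae mu_gamma].

Definition norm_Q (lam : 'I_2 -> R -> R) : R :=
  Num.sqrt (\sum_(i < 2) L2norm mu_gamma (lam i) ^+ 2).

(* The duality between the dual of H^{1/2}_{00} and H^{1/2}_{00}, for a first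
   argument in L^2, which acts by integration. *)
Definition duality (lam s : R -> R) : R := \int[mu_gamma]_x (lam x * s x).

(* For v = 0 the quotient is 0 / 0 = 0, which does not change the supremum
   since the set of quotients is symmetric. *)
Definition dual_norm (i : 'I_2) (lam : R -> R) : \bar R :=
  ereal_sup [set (duality lam (trace_gamma i v) / H1norm (sub_rect i) v)%:E |
             v in H10 (sub_rect i) (boundary (Omega_ i) `\` gamma2)].

Definition norm_Lambda (lam : 'I_2 -> R -> R) : \bar R :=
  sqrte (\sum_(i < 2) dual_norm i (lam i) ^+ 2)%E.

Definition form_a (u v : triple) : R :=
  \sum_(i < 2) \int[area (sub_rect i)]_p
     (eps_ox * \sum_(j < 2) weak_partial (sub_rect i) j (u.1 i) p *
                            weak_partial (sub_rect i) j (v.1 i) p) +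
  d * \int[mu_gamma]_x (eps_par * (weak_deriv 0 L u.2 x * weak_deriv 0 L v.2 x)).

Definition form_b (mu : 'I_2 -> R -> R) (u : triple) : R :=
  \sum_(i < 2) duality (mu i) (trace_gamma i (u.1 i) \- u.2).

Definition form_c (lam mu : 'I_2 -> R -> R) : R :=
  \sum_(i < 2) \int[mu_gamma]_x (lam i x * mu i x).

Definition is_solution (alpha : R) (rho : R -> R)
    (u : triple) (lam : 'I_2 -> R -> R) :=
  [/\ space_V u, space_Q lam,
      forall v, space_V v ->
        form_a u v - form_b lam v = \int[mu_gamma]_x (rho x * v.2 x) &
      forall mu, space_Q mu -> form_b mu u + alpha * form_c lam mu = 0].

End problem.

(* Main.v *)
(* The second equation gives [lam_i = - alpha^-1 (u_i|gamma - u_gamma)].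
   Substituting it into the first one leaves a variational problem on [V] for
   the symmetric form [a + alpha^-1 j], where [j] is the [L^2] form of the
   jumps.  Near the interface the lateral sides belong to [GammaD], so the
   Poincare inequality makes [a] coercive, and the Riesz theorem applies.

   Testing with [u] and [lam] gives [a(u, u) + alpha |lam|^2 = int rho u_gamma],
   which by the coercivity of [a] alone bounds the norms of [u] and
   [sqrt alpha lam] uniformly in [alpha], and yields uniqueness.  The dual norm
   of [lam_i] is bounded by testing the first equation with a function that
   lives on the [i]-th subdomain only.

   Weak derivatives and traces are chosen representatives.  They are unique
   almost everywhere by the du Bois-Reymond lemma and by the trace inequality
   for smooth functions; as the elements of [V] come with smooth approximations,
   every inequality needs to be proved for smooth functions only. *)

Require Import Defs.
From HB Require Import structures.
From mathcomp Require Import all_boot all_order all_algebra.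
From mathcomp Require Import all_classical all_reals all_analysis.
From mathcomp Require Import measurable_realfun ring lra.

Set Implicit Arguments.
Unset Strict Implicit.
Unset Printing Implicit Defensive.

Import Order.TTheory GRing.Theory Num.Theory.
Import numFieldNormedType.Exports.

Local Open Scope classical_set_scope.
Local Open Scope ring_scope.

(** * Minimization in semi-inner product spaces *)

(** The obstacle is that nothing here is a quotient space: elements are plain functions, [norm_V] is
    only a seminorm on them, and the derivatives and traces picked by [xget] are linear only almost
    everywhere. So no Hilbert space is formed. The variational problem is solved for a possibly
    degenerate form on a subset of a vector space, and uniqueness is recovered at the end as
    equality almost everywhere. Gradients and traces are carried as explicit data next to the
    function and meet the chosen ones only under integrals. Completeness of [V] is then assembled by
    hand: Riesz-Fischer for values, derivatives and traces, closedness of weak differentiation, and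
    a diagonal choice of smooth approximants. On a rectangle these approximants need not satisfy the
    Dirichlet condition, so the Poincare inequality is proved with a boundary term, which the
    convergence of traces sends to 0. The du Bois-Reymond lemma is obtained without mollifiers: test
    functions converge to indicators of intervals, and Dynkin's lemma reaches all Borel sets. *)

Lemma cvg0_le (R : realType) (a b : nat -> R) :
  (forall n, 0 <= a n <= b n) -> b n @[n --> \oo] --> 0 ->
  a n @[n --> \oo] --> 0.
Proof.
by move=> ab b0; apply: (squeeze_cvgr _ (cvg_cst 0) b0); near=> n.
Unshelve. all: by end_near. Qed.

Lemma cvg0_eventually (R : realType) (a : nat -> R) (e : R) :
  a n @[n --> \oo] --> 0 -> 0 < e -> exists N, forall n, (N <= n)%N -> a n < e.
Proof.
move=> /cvgrPdist_lt/(_ e) + e0 => /(_ e0)[N _ HN].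
exists N => n /HN /=; rewrite sub0r normrN => /ltr_normlW//.
Qed.

Lemma cvg0_squares (R : realType) (a : nat -> R) :
  a n ^+ 2 @[n --> \oo] --> 0 <-> a n @[n --> \oo] --> 0.
Proof.
split => [a2|a1]; last first.
  by rewrite -[0](expr0n _ 2) exprS expr1; under eq_fun do rewrite expr2; exact: cvgM.
apply/cvgrPdist_lt => e e0.
have /cvg0_eventually /(_ (exprn_gt0 2 e0))[N HN] := a2.
exists N => //= n /HN; rewrite sub0r normrN => ltae.
by rewrite -(@ltr_pXn2r _ 2)// ?nnegrE ?(ltW e0)// real_normK ?num_real.
Qed.

Lemma harmonic_cvg0 (R : realType) (K : R) :
  K * n.+1%:R^-1 @[n --> \oo] --> 0.
Proof. by rewrite -[0](mulr0 K); apply: cvgMr; exact: cvg_harmonic. Qed.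

(** The discriminant of a nonnegative quadratic polynomial. The leading coefficient may be 0, since
    the forms below may vanish on nonzero vectors; the polynomial is then affine and bounded below,
    hence constant. *)
Lemma sqr_le_discr (R : realType) (b c e : R) : 0 <= b -> 0 <= e ->
  (forall t, 0 <= t ^+ 2 * b + 2 * t * c + e) -> c ^+ 2 <= b * e.
Proof.
move=> b0 e0 H; have [b_eq0|b_neq0] := eqVneq b 0.
  rewrite b_eq0 mul0r; have [->|c0] := eqVneq c 0; first by rewrite expr0n.
  have := H (- (e + 1) / c); rewrite b_eq0.
  have -> : (- (e + 1) / c) ^+ 2 * 0 + 2 * (- (e + 1) / c) * c + e = - e - 2.
    by field.
  by move=> ?; exfalso; lra.
have b_gt0 : 0 < b by rewrite lt_neqAle eq_sym b_neq0.
have := H (- c / b).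
have -> : (- c / b) ^+ 2 * b + 2 * (- c / b) * c + e = (b * e - c ^+ 2) / b.
  by field.
by rewrite pmulr_lge0 ?invr_gt0// subr_ge0.
Qed.

Section semi_inner_product.
Context (R : realType) (V : lmodType R).
Variables (S : set V) (B : V -> V -> R).
Hypothesis SZD : forall (t : R) u v, S u -> S v -> S (t *: u + v).
Hypothesis S0 : S 0.
Hypothesis BC : forall u v, S u -> S v -> B u v = B v u.
Hypothesis BZD : forall t u v w, S u -> S v -> S w ->
  B (t *: u + v) w = t * B u w + B v w.
Hypothesis B_ge0 : forall u, S u -> 0 <= B u u.

Let SB u v : S u -> S v -> S (u - v).
Proof.
by move=> Su Sv; rewrite addrC -scaleN1r; exact: SZD.
Qed.

Lemma semi_ip_expand t u v : S u -> S v ->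
  B (t *: u + v) (t *: u + v) = t ^+ 2 * B u u + 2 * t * B u v + B v v.
Proof.
move=> Su Sv; have Sw := SZD t Su Sv.
rewrite BZD// [B u _]BC// [B v _]BC// !BZD// [B v u]BC//; ring.
Qed.

Lemma semi_cauchy_schwarz u v : S u -> S v -> B u v ^+ 2 <= B u u * B v v.
Proof.
move=> Su Sv; apply: sqr_le_discr => [||t]; rewrite ?B_ge0//.
by rewrite -semi_ip_expand// B_ge0//; exact: SZD.
Qed.

Variables (F : V -> R) (K : R).
Hypothesis FZD : forall t u v, S u -> S v -> F (t *: u + v) = t * F u + F v.
Hypothesis K_ge0 : 0 <= K.
Hypothesis F_bounded : forall u, S u -> F u ^+ 2 <= K * B u u.
Hypothesis B_complete : forall u : nat -> V, (forall n, S (u n)) ->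
  (forall e : R, 0 < e -> exists N, forall n k, (N <= n)%N -> (N <= k)%N ->
     B (u n - u k) (u n - u k) < e) ->
  exists2 v, S v & B (u n - v) (u n - v) @[n --> \oo] --> 0.

(* A minimizing sequence of [B v v - 2 F v] is Cauchy by the parallelogram law,
   and its limit satisfies the Euler-Lagrange equation.  [B] may be degenerate,
   so uniqueness only holds up to the kernel of [B]. *)
Lemma semi_riesz : exists2 u, S u & forall v, S v -> B u v = F v.
Proof.
pose J v := B v v - 2 * F v.
have JZD t u v : S u -> S v ->
    J (t *: u + v) = t ^+ 2 * B u u + 2 * t * (B v u - F u) + J v.
  by move=> Su Sv; rewrite /J semi_ip_expand// FZD// [B u v]BC//; ring.
(* [F u ^+ 2 <= K * B u u <= ((K + B u u) / 2) ^+ 2] gives [2 * F u <= K + B u u]. *)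
have J_lb u : S u -> - K <= J u.
  move=> Su; have := F_bounded Su; have := B_ge0 Su; rewrite /J => B0 FK.
  rewrite leNgt; apply/negP => H.
  have : 0 < (2 * F u - (K + B u u)) * (2 * F u + (K + B u u)).
    by rewrite mulr_gt0//; move: K_ge0; lra.
  by have := sqr_ge0 (K - B u u); lra.
pose E := [set J v | v in S].
have E_inf : has_inf E.
  split; first by exists (J 0), 0.
  by exists (- K) => _ [v Sv <-]; exact: J_lb.
have infJ v : S v -> inf E <= J v.
  by move=> Sv; apply: ge_inf; [case: E_inf|exists v].
have /choice[u u_min] (n : nat) : exists u, S u /\ J u < inf E + n.+1%:R^-1.
  have [_ [u Su <-] uE] := @inf_adherent _ E n.+1%:R^-1 ltac:(by rewrite invr_gt0) E_inf.
  by exists u.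
have Su n : S (u n) by have [] := u_min n.
have [e e0|v Sv uv] := B_complete Su.
  (* With [m] the midpoint of [u n] and [u k], [B (u n - u k) (u n - u k)] equals
     [2 * J (u n) + 2 * J (u k) - 4 * J m]. As [J m] is at least [inf E], this is at most
     [2 / n.+1 + 2 / k.+1], whence the constant 4. *)
  have [N HN] := @cvg0_eventually _ _ e (@harmonic_cvg0 R 4) e0.
  exists N => n k Nn Nk.
  have S0' : S (u n - u k) by exact: SB.
  have := infJ _ (SZD 2^-1 S0' (Su k)).
  rewrite JZD// => mid.
  have := JZD 1 (u n - u k) (u k) S0' (Su k).
  rewrite scale1r subrK => JN.
  have := HN _ Nn; have := HN _ Nk; move: mid JN.
  have [_] := u_min n; have [_] := u_min k.
  move: (_.+1%:R^-1) (_.+1%:R^-1) => a b.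
  set Bw := B _ _; set c := _ - F _; set Jn := J (u n); set Jk := J (u k).
  by lra.
exists v => // w Sw; apply/eqP; rewrite -subr_eq0 -sqrf_eq0; apply/eqP.
(* The residual at [v] is the residual at [u n] minus [B (u n - v) w]. The latter is bounded by
   Cauchy-Schwarz; the former because [J (t *: w + u n)] never drops more than [1 / n.+1] below
   [J (u n)], which bounds a discriminant. *)
have dist n : (B v w - F w) ^+ 2 <=
    2 * B w w * (B (u n - v) (u n - v) + n.+1%:R^-1).
  have Sd := SB (Su n) Sv.
  have B1 : (B (u n) w - F w) ^+ 2 <= B w w * n.+1%:R^-1.
    apply: sqr_le_discr => [||t]; rewrite ?B_ge0//.
    have := infJ _ (SZD t Sw (Su n)); rewrite JZD//.
    have [_] := u_min n; set a := _^-1; set j := J _; set q := _ + _ * _.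
    by move=> *; lra.
  have := semi_cauchy_schwarz Sd Sw.
  have -> : B (u n - v) w = B (u n) w - B v w.
    by rewrite [u n - v]addrC -scaleN1r BZD//; ring.
  move: B1; set b := B (u n) w; set c := B v w; set f := F w.
  have := sqr_ge0 ((b - f) + (b - c)); set h := _^-1; set g := B (_ - _) _.
  by lra.
apply/eqP; rewrite eq_le sqr_ge0 andbT.
have lim0 : 2 * B w w * (B (u n - v) (u n - v) + n.+1%:R^-1) @[n --> \oo] --> 0.
  rewrite -[0](mulr0 (2 * B w w)); apply: cvgMr; rewrite -[0]addr0.
  by apply: cvgD => //; exact: cvg_harmonic.
apply: (@cvgr_to_ge _ _ _ _ _ _ _ lim0); exact: nearW.
Qed.

End semi_inner_product.

(** * The space L^2 *)

Section L2_theory.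
Context d (T : measurableType d) (R : realType).
Variable mu : {measure set T -> \bar R}.
Implicit Types (f g h : T -> R) (t : R).

Definition ip f g : R := \int[mu]_x (f x * g x).

Lemma integrable_EFinZ t f : mu.-integrable setT (EFin \o f) ->
  mu.-integrable setT (EFin \o (fun x => t * f x)).
Proof. exact: integrableZl. Qed.

(** Membership in [L2] is not assumed: if the integral is infinite, both sides are 0 by the default
    value of [fine]. *)
Lemma L2norm_sqrt f : L2norm mu f = Num.sqrt (ip f f).
Proof.
have I0 : (0 <= \int[mu]_x (f x * f x)%:E)%E.
  by apply: integral_ge0 => x _; rewrite lee_fin -expr2 sqr_ge0.
have -> : L2norm mu f = fine ((\int[mu]_x (f x * f x)%:E) `^ 2^-1)%E.
  rewrite /L2norm unlock; congr (fine (_ `^ _))%E.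
  apply: eq_integral => x _ /=.
  by rewrite powR_mulrn// real_normK ?num_real.
rewrite /ip /Rintegral; move: I0; case: integral => [r||//] /= I0.
  by rewrite powR12_sqrt.
by rewrite invr_eq0 pnatr_eq0/= sqrtr0.
Qed.

Lemma L2P f : L2 mu f <->
  measurable_fun setT f /\ (\int[mu]_x (f x * f x)%:E < +oo)%E.
Proof.
have NE : ('N[mu]_2%:E[EFin \o f] = (\int[mu]_x (f x * f x)%:E) `^ 2^-1)%E.
  rewrite unlock; congr (_ `^ _)%E; apply: eq_integral => x _ /=.
  by rewrite powR_mulrn// real_normK ?num_real.
rewrite /L2 /= inE; split => [/andP[]|[mf ffin]].
  rewrite !inE/= /finite_norm NE => mf H; split => //.
  exact: (lty_poweRy _ H).
by apply/andP; rewrite !inE/= /finite_norm NE; split => //; exact: poweR_lty.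
Qed.

Lemma L2_measurable f : L2 mu f -> measurable_fun setT f.
Proof. by move=> /L2P[]. Qed.

Lemma L2_mul_integrable f g : L2 mu f -> L2 mu g ->
  mu.-integrable setT (EFin \o (fun x => f x * g x)).
Proof.
by move=> Lf Lg; apply/Lfun1_integrable; exact: Lfun2_mul_Lfun1.
Qed.

Lemma L2_sqr f : measurable_fun setT f ->
  mu.-integrable setT (EFin \o (fun x => f x * f x)) -> L2 mu f.
Proof.
move=> mf /integrableP[_ fi]; apply/L2P; split => //.
apply: le_lt_trans fi; rewrite le_eqVlt; apply/orP; left; apply/eqP.
by apply: eq_integral => x _ /=; rewrite ger0_norm// -expr2 sqr_ge0.
Qed.

Lemma L2_lin t f g : L2 mu f -> L2 mu g -> L2 mu (fun x => t * f x + g x).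
Proof.
move=> Lf Lg; have mf := L2_measurable Lf; have mg := L2_measurable Lg.
apply: L2_sqr; first by apply: measurable_funD => //; exact: measurable_funM.
have -> : EFin \o (fun x => (t * f x + g x) * (t * f x + g x)) =
    (fun x => (t ^+ 2)%:E * (EFin \o (fun x => f x * f x)%R) x +
     ((2 * t)%:E * (EFin \o (fun x => f x * g x)%R) x +
     (EFin \o (fun x => g x * g x)%R) x))%E.
  by apply/funext => x /=; rewrite -!EFinM -!EFinD; congr EFin; ring.
by apply: integrableD => //; [|apply: integrableD => //];
  try apply: integrableZl => //; exact: L2_mul_integrable.
Qed.

Lemma L2_0 : L2 mu (cst 0).
Proof.
apply/L2P; split => //.
under eq_integral do rewrite /= mulr0.
by rewrite integral0.
Qed.

Lemma L2_Z t f : L2 mu f -> L2 mu (fun x => t * f x).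
Proof.
move=> /(L2_lin t)/(_ L2_0); rewrite /cst/=.
by under eq_fun do rewrite addr0.
Qed.

Lemma L2_B f g : L2 mu f -> L2 mu g -> L2 mu (f \- g).
Proof.
move=> + Lg => /(L2_lin (-1) Lg); congr (L2 mu _).
by apply/funext => x /=; ring.
Qed.

Lemma ipC f g : ip f g = ip g f.
Proof. by apply: eq_Rintegral => x _; exact: mulrC. Qed.

Lemma ip_lin t f g h : L2 mu f -> L2 mu g -> L2 mu h ->
  ip (fun x => t * f x + g x) h = t * ip f h + ip g h.
Proof.
move=> Lf Lg Lh; rewrite /ip.
under eq_Rintegral do rewrite mulrDl -mulrA.
rewrite RintegralD//; [|by apply: integrable_EFinZ; exact: L2_mul_integrable|].
  by rewrite RintegralZl//; exact: L2_mul_integrable.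
exact: L2_mul_integrable.
Qed.

Lemma ipB f g h : L2 mu f -> L2 mu g -> L2 mu h ->
  ip (f \- g) h = ip f h - ip g h.
Proof.
move=> Lf Lg Lh; rewrite -[RHS]addrC -mulN1r -ip_lin//.
by congr ip; apply/funext => x /=; ring.
Qed.

Lemma ipZ t f h : L2 mu f -> L2 mu h -> ip (fun x => t * f x) h = t * ip f h.
Proof.
by move=> Lf Lh; rewrite /ip -RintegralZl//;
  [apply: eq_Rintegral => x _; exact/esym/mulrA|exact: L2_mul_integrable].
Qed.

Lemma ip_ge0 f : 0 <= ip f f.
Proof. by apply: Rintegral_ge0 => x _; rewrite -expr2 sqr_ge0. Qed.

Lemma ip0l f : ip (cst 0) f = 0.
Proof.
by rewrite /ip /cst/=; under eq_Rintegral do rewrite mul0r; rewrite Rintegral_cst// mul0r.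
Qed.

Lemma L2norm_sqr f : L2norm mu f ^+ 2 = ip f f.
Proof. by rewrite L2norm_sqrt sqr_sqrtr// ip_ge0. Qed.

Lemma ip_EFin f : L2 mu f -> ((ip f f)%:E = \int[mu]_x (f x * f x)%:E)%E.
Proof.
move=> Lf; rewrite /ip /Rintegral fineK//.
exact: (integrable_fin_num _ (L2_mul_integrable Lf Lf)).
Qed.

Lemma cauchy_schwarz f g : L2 mu f -> L2 mu g ->
  ip f g ^+ 2 <= ip f f * ip g g.
Proof.
move=> Lf Lg.
apply: (@semi_cauchy_schwarz R (T -> R) (L2 mu) ip) => //.
- by move=> t u v Lu Lv; exact: L2_lin.
- by move=> u v _ _; exact: ipC.
- by move=> t u v w Lu Lv Lw; exact: ip_lin.
- by move=> u _; exact: ip_ge0.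
Qed.

Lemma ip_expand t f g : L2 mu f -> L2 mu g ->
  ip (fun x => t * f x + g x) (fun x => t * f x + g x) =
  t ^+ 2 * ip f f + 2 * t * ip f g + ip g g.
Proof.
move=> Lf Lg; have Lfg := L2_lin t Lf Lg.
rewrite ip_lin// [ip f _]ipC [ip g _]ipC !ip_lin// [ip g f]ipC; ring.
Qed.

(** The difference of the two sides is [|f - 2 g|^2]. This weak triangle inequality is used
    throughout because it keeps squared norms and avoids square roots. *)
Lemma ip_le2 f g : L2 mu f -> L2 mu g ->
  ip f f <= 2 * ip (f \- g) (f \- g) + 2 * ip g g.
Proof.
move=> Lf Lg; have Lh := L2_B Lf Lg.
have -> : ip f f = ip (fun x => 1 * (f \- g) x + g x) (fun x => 1 * (f \- g) x + g x).
  by congr ip; apply/funext => x /=; ring.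
have := ip_ge0 (fun x => -1 * (f \- g) x + g x).
by rewrite !ip_expand//; lra.
Qed.

Lemma ip_triangle f g h : L2 mu f -> L2 mu g -> L2 mu h ->
  ip (f \- h) (f \- h) <= 2 * ip (f \- g) (f \- g) + 2 * ip (h \- g) (h \- g).
Proof.
move=> Lf Lg Lh.
have := ip_le2 (L2_B Lf Lh) (L2_B Lg Lh).
have -> : (f \- h) \- (g \- h) = f \- g by apply/funext => x /=; ring.
have -> : ip (g \- h) (g \- h) = ip (h \- g) (h \- g); last by [].
by apply: eq_Rintegral => x _ /=; ring.
Qed.

Lemma ip_eq0 f : L2 mu f -> ip f f = 0 -> ae_eq mu setT f (cst 0).
Proof.
move=> Lf f0.
have /ae_eq_integral_abs : (\int[mu]_x `|(f x * f x)%:E|)%E = 0%E.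
  rewrite -[RHS]/(0%:E) -f0 ip_EFin//; apply: eq_integral => x _ /=.
  by rewrite ger0_norm// -expr2 sqr_ge0.
move=> /(_ measurableT).
have mff : measurable_fun setT (fun x => (f x * f x)%:E).
  by apply/measurable_EFinP; apply: measurable_funM; exact: L2_measurable.
move=> /(_ mff); apply: filterS => x /(_ I) [/eqP] + _.
by rewrite mulf_eq0 orbb => /eqP.
Qed.

Lemma ae_eq_ip f f' g g' : L2 mu f -> L2 mu f' -> L2 mu g -> L2 mu g' ->
  ae_eq mu setT f f' -> ae_eq mu setT g g' -> ip f g = ip f' g'.
Proof.
move=> Lf Lf' Lg Lg' ff' gg'; rewrite /ip /Rintegral; congr fine.
apply: ae_eq_integral => //.
- by apply/measurable_EFinP; apply: measurable_funM; exact: L2_measurable.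
- by apply/measurable_EFinP; apply: measurable_funM; exact: L2_measurable.
- by apply: filterS2 ff' gg' => x f0 g0 xT; rewrite f0// g0.
Qed.

End L2_theory.

(** * Riesz-Fischer: completeness of [L^2] *)

Section L2_complete.
Context d (T : measurableType d) (R : realType).
Variable mu : {measure set T -> \bar R}.

(** By monotone convergence the sum of the series has finite integral, so it is finite almost
    everywhere. *)
Lemma ae_summable (h : nat -> T -> R) :
  (forall k, measurable_fun setT (h k)) -> (forall k x, 0 <= h k x) ->
  (forall k, (\int[mu]_x (h k x)%:E <= ((1 / 2) ^+ k)%:E)%E) ->
  {ae mu, forall x, cvgn (series (h ^~ x))}.
Proof.
move=> mh h0 hk.
pose s x := (\sum_(k <oo) (h k x)%:E)%E.
have ms : measurable_fun setT s.
  apply: ge0_emeasurable_sum => [k x _ _|k _]; first by rewrite lee_fin.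
  exact/measurable_EFinP.
have si : mu.-integrable setT s.
  apply/integrableP; split => //.
  have -> : (\int[mu]_x `|s x| = \int[mu]_x s x)%E.
    apply: eq_integral => x _; rewrite gee0_abs//.
    by apply: nneseries_ge0 => k _ _; rewrite lee_fin.
  rewrite integral_nneseries//; last first.
  - by move=> k x _; rewrite lee_fin.
  - by move=> k; exact/measurable_EFinP.
  apply: (@le_lt_trans _ _ (\sum_(k <oo) ((2 / (2 ^ (k + 1))%:R)%:E : \bar R))%E).
    apply: lee_nneseries => [k _ _|k _].
      by apply: integral_ge0 => x _; rewrite lee_fin.
    by apply: le_trans (hk k) _; rewrite lee_fin expr_div_n expr1n natrX exprD expr1 invfM mulrCA divff// mulr1 div1r.
  have /cvg_lim -> // := @cvg_geometric_eseries_half R 2 0.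
  by rewrite ltry.
have := integrable_ae measurableT si; apply: filterS => x /(_ I) sx.
apply: nondecreasing_is_cvgn.
  by apply: nondecreasing_series => k _ _; exact: h0.
exists (fine (s x)) => _ [n _ <-].
rewrite -lee_fin fineK// /series/= -sumEFin /s.
by apply: nneseries_lim_ge => k _ _; rewrite lee_fin.
Qed.

Lemma limn_einf_le (v : nat -> \bar R) (e : \bar R) (N : nat) :
  (forall n, (N <= n)%N -> v n <= e)%E -> (limn_einf v <= e)%E.
Proof.
move=> ve; rewrite limn_einf_lim; apply: lime_le; first exact: is_cvg_einfs.
apply: nearW => n; apply: le_trans (ve (maxn n N) (leq_maxr _ _)).
by apply: ereal_inf_lbound; exists (maxn n N) => //=; exact: leq_maxl.
Qed.

(** A rapidly Cauchy subsequence converges almost everywhere; Fatou's lemma along it then bounds the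
    distance from every late [u n] to the limit, so the whole sequence converges. *)
Lemma L2_complete (u : nat -> T -> R) : (forall n, L2 mu (u n)) ->
  (forall e : R, 0 < e -> exists N, forall n k, (N <= n)%N -> (N <= k)%N ->
    ip mu (u n \- u k) (u n \- u k) < e) ->
  exists2 f, L2 mu f & ip mu (u n \- f) (u n \- f) @[n --> \oo] --> 0.
Proof.
move=> Lu cu.
have /choice[N HN] (k : nat) : exists N, forall n m, (N <= n)%N -> (N <= m)%N ->
    ip mu (u n \- u m) (u n \- u m) < (1 / 4) ^+ k.
  by apply: cu; rewrite exprn_gt0// divr_gt0.
(* The maximum puts [phi k] beyond every [N j] with [j <= k]; the summand [k] gives [k <= phi k],
   which is used with Fatou's lemma. *)
pose phi k := (k + \max_(j < k.+1) N j)%N.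
have Nphi j k : (j <= k)%N -> (N j <= phi k)%N.
  by move=> jk; apply: leq_trans (leq_addl _ _); exact: (leq_bigmax (F := fun j : 'I_k.+1 => N j) (Ordinal (jk : (j < k.+1)%N))).
pose dif k x := u (phi k.+1) x - u (phi k) x.
have Ldif k : L2 mu (dif k) by exact: L2_B.
(* The weight spends part of the decay [(1 / 4) ^+ k]: the integral of [h k] is still at most
   [(1 / 2) ^+ k], and pointwise [|dif k x| <= (1 / 2) ^+ k + h k x], so summability of [h] gives
   absolute summability of [dif]. *)
pose h k x := 2 ^+ k * (dif k x * dif k x).
have h_ge0 k x : 0 <= h k x by rewrite /h mulr_ge0 ?exprn_ge0// -expr2 sqr_ge0.
have hae : {ae mu, forall x, cvgn (series (h ^~ x))}.
  apply: ae_summable => // k.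
    apply: measurable_funM => //.
    by apply: measurable_funM => //; exact: L2_measurable.
  under eq_integral do rewrite /h EFinM.
  rewrite ge0_integralZl//; last 2 first.
  - by apply/measurable_EFinP; apply: measurable_funM; exact: L2_measurable.
  - by move=> x _; rewrite lee_fin -expr2 sqr_ge0.
  rewrite -ip_EFin// -EFinM lee_fin.
  have /ltW := HN k (phi k.+1) (phi k) (Nphi _ _ (leqnSn k)) (Nphi _ _ (leqnn k)).
  move=> /(ler_wpM2l (exprn_ge0 k (ler0n R 2))) /le_trans; apply.
  by rewrite -exprMn le_eqVlt; apply/orP; left; apply/eqP; congr (_ ^+ _); field.
have uae : {ae mu, forall x, cvgn (fun k => u (phi k) x)}.
  apply: filterS hae => x hx.
  have dx : cvgn (series (dif ^~ x)).
    apply: normed_cvg; rewrite /=.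
    apply: (@series_le_cvg _ _ (fun k => geometric 1 (1 / 2) k + h k x)) => [k|k|k|].
    - exact: normr_ge0.
    - by rewrite addr_ge0//= mul1r exprn_ge0// divr_ge0.
    - rewrite /h /= mul1r -[X in 2 ^+ k * X]expr2 -[dif k x ^+ 2]real_normK ?num_real//.
      move: (normr_ge0 (dif k x)); move: `|dif k x| => a a0.
      have -> : (1 / 2 : R) ^+ k = (2 ^+ k)^-1 by rewrite expr_div_n expr1n div1r.
      have p0 : 0 < (2 : R) ^+ k by rewrite exprn_gt0.
      rewrite -(@ler_pM2l _ (2 ^+ k))//.
      rewrite mulrDr divff ?gt_eqF//.
      have := sqr_ge0 (2 ^+ k * a - 1).
      have : 0 <= 2 ^+ k * a by rewrite mulr_ge0// ltW.
      move: (2 ^+ k) => p; nra.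
    - have -> : series (fun k => geometric 1 (1 / 2) k + h k x) =
          series (geometric 1 (1 / 2)) \+ series (h ^~ x).
        by apply/funext => n; rewrite /series /= big_split.
      apply: is_cvgD => //; apply: is_cvg_geometric_series.
      by rewrite ger0_norm ?divr_ge0// ltr_pdivrMr// mul1r ltr1n.
  have -> : (fun k => u (phi k) x) = (fun k => series (dif ^~ x) k + u (phi 0) x).
    apply/funext => k; rewrite /series/= /dif.
    by rewrite (@telescope_sumr _ 0 k (fun k => u (phi k) x))// subrK.
  by apply: is_cvgD => //; exact: is_cvg_cst.
(* A limit superior is measurable on all of [T], also on the null set where the subsequence
   diverges. *)
pose f x := fine (limn_esup (fun k => (u (phi k) x)%:E)).
have mf : measurable_fun setT f.
  apply: (measurableT_comp (@fine_measurable R setT measurableT)).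
  apply: (@measurable_fun_limn_esup _ _ _ _ (fun k x => (u (phi k) x)%:E)) => k.
  by apply/measurable_EFinP; exact: L2_measurable.
have fae : {ae mu, forall x, u (phi k) x @[k --> \oo] --> f x}.
  apply: filterS uae => x ux.
  rewrite /f (_ : limn_esup _ = (limn (fun k => u (phi k) x))%:E)//=.
  apply: (cvg_limn_einf_sup _).2.
  by apply: cvg_EFin => //; exact: nearW.
have fatou_bound n e M :
    (forall k, (M <= k)%N -> ip mu (u n \- u k) (u n \- u k) <= e) ->
    (\int[mu]_x ((u n x - f x) * (u n x - f x))%:E <= e%:E)%E.
  move=> He.
  pose g k x := ((u n x - u (phi k) x) * (u n x - u (phi k) x))%:E.
  have mg k : measurable_fun setT (g k).
    apply/measurable_EFinP; apply: measurable_funM;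
    by apply: measurable_funB; exact: L2_measurable.
  have g0 k x : [set: T] x -> (0 <= g k x)%E by rewrite lee_fin -expr2 sqr_ge0.
  have -> : (\int[mu]_x ((u n x - f x) * (u n x - f x))%:E =
      \int[mu]_x limn_einf (g ^~ x))%E.
    apply: ae_eq_integral => //.
    - apply/measurable_EFinP; apply: measurable_funM;
      by apply: measurable_funB => //; exact: L2_measurable.
    - have -> : (fun x => limn_einf (g ^~ x)) =
          (fun x => (- limn_esup ((fun k x => - g k x) ^~ x))%E).
        by apply/funext => x; rewrite -limn_einfN; congr limn_einf; apply/funext => k; rewrite /comp oppeK.
      apply: measurableT_comp => //; apply: measurable_fun_limn_esup => k.
      exact: measurableT_comp.
    - apply: filterS fae => x fx _; apply/esym.
      apply: (cvg_limn_einf_sup _).1.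
      apply: cvg_EFin; first exact: nearW.
      by apply: cvgM; apply: cvgB => //; exact: cvg_cst.
  apply: le_trans (fatou mu measurableT mg g0) _.
  apply: (@limn_einf_le _ _ M) => k Mk.
  by rewrite /g -(@ip_EFin _ _ _ _ (u n \- u (phi k))) ?lee_fin; [apply: He; exact: leq_trans Mk (leq_addr _ _)|exact: L2_B].
have Lf : L2 mu f.
    have [M HM] := cu 1 ltr01.
    have : L2 mu (u M \- f).
      apply/L2P; split; first by apply: measurable_funB => //; exact: L2_measurable.
      apply: le_lt_trans (fatou_bound M 1 M _) _; last exact: ltry.
      by move=> k Mk; exact/ltW/HM.
    move=> /(L2_B (Lu M)); congr (L2 mu _).
    by apply/funext => x /=; ring.
  exists f => //; apply/cvgrPdist_lt => e e0.
  have [M HM] := cu (e / 2) ltac:(by rewrite divr_gt0).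
  exists M => //= n Mn; rewrite sub0r normrN ger0_norm ?ip_ge0//.
  apply: (@le_lt_trans _ _ (e / 2)); last by lra.
  rewrite -lee_fin ip_EFin; last exact: L2_B.
  by apply: (fatou_bound n (e / 2) M _) => k Mk; exact/ltW/HM.
Qed.

(** This is what lets the vanishing of a trace on part of the boundary survive an [L^2] limit. *)
Lemma L2_cvg_ae (u : nat -> T -> R) f : (forall n, L2 mu (u n)) -> L2 mu f ->
  ip mu (u n \- f) (u n \- f) @[n --> \oo] --> 0 ->
  exists phi : nat -> nat,
    {ae mu, forall x, u (phi k) x @[k --> \oo] --> f x}.
Proof.
move=> Lu Lf uf.
have /choice[phi Hphi] (k : nat) : exists n,
    ip mu (u n \- f) (u n \- f) < (1 / 2) ^+ k.
  have e0 : 0 < (1 / 2 : R) ^+ k by rewrite exprn_gt0.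
  have [N HN] := cvg0_eventually uf e0.
  by exists N; exact: HN.
exists phi.
pose h k x := (u (phi k) x - f x) * (u (phi k) x - f x).
have hae : {ae mu, forall x, cvgn (series (h ^~ x))}.
  apply: ae_summable => k.
  - have mh : measurable_fun setT (fun x => u (phi k) x - f x).
      by apply: measurable_funB; exact: (@L2_measurable _ _ _ mu).
    exact: measurable_funM.
  - by move=> x; rewrite /h -expr2 sqr_ge0.
  - have := @ip_EFin _ _ _ mu (u (phi k) \- f) (L2_B (Lu (phi k)) Lf).
    by rewrite /h => <-; rewrite lee_fin ltW.
apply: filterS hae => x /cvg_series_cvg_0 h0.
have : u (phi k) x - f x @[k --> \oo] --> 0.
  by apply/cvg0_squares; under eq_fun do rewrite expr2.
by move/subr_cvg0.
Qed.

End L2_complete.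

(** * Test functions and the du Bois-Reymond lemma *)

Lemma scaleRE (R : realType) (a b : R) : a *: (b : R^o) = a * b.
Proof. by []. Qed.

Section bump.
Context (R : realType).
Implicit Types (p q : {poly R}) (a b k x : R).

(** The iterated derivatives never leave [S], so no formula for the [n]-th one is required. *)
Lemma smooth1_coind (S : set (R -> R)) :
  (forall f, S f -> exists2 f', S f' & forall x, is_derive x 1 f (f' x)) ->
  forall f, S f -> smooth1 f.
Proof.
move=> HS f Sf n.
suff : S (derive1n n f) by move=> /HS[f' _ ff'] x; have [] := ff' x.
elim: n => // n /HS[f' Sf' ff']; rewrite derive1nS.
suff -> : (derive1n n f)^`()%classic = f' by [].
by apply/funext => x; rewrite derive1E; have [_ ->] := ff' x.
Qed.

(* Smooth because these functions are stable under differentiation. *)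
Definition flat p x : R := if 0 < x then p.[x^-1] * expR (- x^-1) else 0.

(** The chain rule for [y = 1 / x], whose derivative is [- y ^+ 2], applied to [p.[y] * expR (-
    y)]. *)
Definition flat_step p : {poly R} := 'X^2 * (p - p^`()).

(** [t ^+ n] over the factorial of [n] is one term of the exponential series of [t]. *)
Lemma powM_expRN_le n (t : R) : 0 <= t -> t ^+ n * expR (- t) <= n`!%:R.
Proof.
move=> t0; case: n => [|n]; first by rewrite expr0 mul1r fact0 expR_le1 oppr_le0.
rewrite expRN ler_pdivrMr ?expR_gt0//.
have := expR_ge1Dxn n t0; have := fact_gt0 n.+1; rewrite -(ltr0n R).
move: (_`!%:R) => F F0 H; rewrite mulrC -ler_pdivrMr//.
by apply: le_trans H; rewrite lerDr.
Qed.

(** A quadratic bound sends the difference quotient at 0 to 0. The exponential absorbs two powers of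
    [x^-1] more than [p] contains, hence the factorials of [i + 2]. *)
Lemma flat_le_sqr p : exists2 C, 0 <= C & forall x, `|flat p x| <= C * x ^+ 2.
Proof.
exists (\sum_(i < size p) `|p`_i| * (i + 2)`!%:R).
  by apply: sumr_ge0 => i _; rewrite mulr_ge0.
move=> x; rewrite /flat; case: ifPn => x0; last first.
  rewrite normr0 mulr_ge0 ?sqr_ge0//.
  by apply: sumr_ge0 => i _; rewrite mulr_ge0.
rewrite -ler_pdivrMr ?exprn_gt0// -exprVn.
set y := x^-1; have y0 : 0 <= y by rewrite invr_ge0 ltW.
rewrite normrM. rewrite (ger0_norm (expR_ge0 _)) -mulrA mulrC.
apply: (@le_trans _ _ (expR (- y) * y ^+ 2 * \sum_(i < size p) `|p`_i| * y ^+ i)).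
  rewrite ler_wpM2l ?mulr_ge0 ?expR_ge0 ?exprn_ge0//.
  rewrite horner_coef; apply: le_trans (ler_norm_sum _ _ _) _.
  by apply: ler_sum => i _; rewrite normrM normrX (ger0_norm y0).
rewrite mulr_sumr; apply: ler_sum => i _.
apply: le_trans (ler_wpM2l (normr_ge0 _) (powM_expRN_le (i + 2) y0)).
by rewrite le_eqVlt exprD; apply/orP; left; apply/eqP; ring.
Qed.

Lemma is_derive_flat p x : is_derive x 1 (flat p) (flat (flat_step p) x).
Proof.
have [x0|x0|->] := ltgtP x 0.
- rewrite /flat ltNge (ltW x0)/=.
  apply: (@near_eq_is_derive R R R (cst 0)).
  near=> y; rewrite /cst; case: ifPn => // y0.
  suff : y < 0 by rewrite ltNge ltW.
  by near: y; exact: lt_nbhsl.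
- have -> : flat (flat_step p) x = (flat_step p).[x^-1] * expR (- x^-1).
    by rewrite /flat x0.
  apply: (@near_eq_is_derive R R R (fun y : R => p.[y^-1] * expR (- y^-1))).
    near=> y; rewrite /flat ifT//; near: y; exact: lt_nbhsr.
  have xn0 : x != 0 by rewrite gt_eqF.
  have Hv : is_derive x 1 (fun y : R => y^-1) (- x ^- 2).
    have := is_deriveV (f := id) xn0 (is_derive_id x 1).
    by rewrite /= [_ *: 1]mulr1.
  have H1 : is_derive x 1 (fun y => p.[y^-1]) (- x ^- 2 * p^`().[x^-1]).
    by rewrite mulrC; exact: (is_derive1_comp (f := horner p) (g := fun y => y^-1) (is_derive_poly p _) Hv).
  have H2 : is_derive x 1 (fun y => expR (- y^-1)) (x ^- 2 * expR (- x^-1)).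
    have := is_derive1_comp (f := @expR R) (g := fun y => - y^-1)
      (is_derive_expR _) (is_deriveN Hv).
    by rewrite opprK mulrC.
  apply: is_derive_eq (is_deriveM H1 H2) _.
  have -> : (flat_step p).[x^-1] = x^-1 ^+ 2 * (p.[x^-1] - p^`().[x^-1]).
    by rewrite /flat_step hornerM hornerXn hornerD hornerN.
  by rewrite !scaleRE; field.
- have [C C0 HC] := flat_le_sqr p.
  have flat0 q : flat q 0 = 0 by rewrite /flat ltxx.
  have lim0 : (fun h : R => h^-1 *: ((flat p \o shift 0) (h *: 1) - flat p 0)) @ 0^' --> 0.
    have C1 : 0 < C + 1 by rewrite ltr_wpDl.
    apply/cvgrPdist_lt => e e0; near=> h.
    have hn0 : h != 0 by near: h; exact: nbhs_dnbhs_neq.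
    rewrite /= flat0 subr0 addr0 sub0r normrN normrZ normfV [h *: 1]mulr1.
    rewrite ltr_pdivrMl ?normr_gt0//; apply: le_lt_trans (HC h) _.
    rewrite -real_normK ?num_real// expr2 mulrA mulrC ltr_pM2l ?normr_gt0//.
    have : `|h| < e / (C + 1).
      near: h; apply: dnbhs0_lt; exact: divr_gt0.
    rewrite ltr_pdivlMr// => hh.
    by have := normr_ge0 h; lra.
  have -> : flat (flat_step p) 0 = 0 by exact: flat0.
  apply: DeriveDef; first by apply/cvg_ex; exists 0.
  exact: cvg_lim lim0.
Unshelve. all: by end_near. Qed.

(** The product rule turns one product into two, so a class stable under differentiation has to be
    closed under sums. *)
Inductive bump_span k a b : (R -> R) -> Prop :=
| bump_term p q : bump_span k a b
    (fun x => flat p (k * (x - a)) * flat q (k * (b - x)))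
| bump_add f g : bump_span k a b f -> bump_span k a b g ->
    bump_span k a b (f \+ g).

Lemma flatZ k p x : flat (k *: p) x = k * flat p x.
Proof. by rewrite /flat hornerZ; case: ifP; rewrite ?mulr0// mulrA. Qed.

Lemma bump_span_smooth k a b f : bump_span k a b f -> smooth1 f.
Proof.
apply: smooth1_coind => {}f; elim => [p q|{}f g _ [f' Sf' ff'] _ [g' Sg' gg']].
  exists ((fun x => flat (k *: flat_step p) (k * (x - a)) * flat q (k * (b - x))) \+
          (fun x => flat p (k * (x - a)) * flat (- k *: flat_step q) (k * (b - x)))).
    by apply: bump_add; exact: bump_term.
  move=> x.
  have H1 : is_derive x 1 (fun x => flat p (k * (x - a)))
      (k * flat (flat_step p) (k * (x - a))).
    have H := is_derive_flat p (k * (x - a)).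
    have H' : is_derive x 1 (fun x => k * (x - a)) k.
      by apply: is_derive_eq; rewrite scaleRE subr0 mulr1.
    by rewrite mulrC; exact: (is_derive1_comp (f := flat p) (g := fun x => k * (x - a)) H H').
  have H2 : is_derive x 1 (fun x => flat q (k * (b - x)))
      (- k * flat (flat_step q) (k * (b - x))).
    have H := is_derive_flat q (k * (b - x)).
    have H' : is_derive x 1 (fun x => k * (b - x)) (- k).
      by apply: is_derive_eq; rewrite !scaleRE; ring.
    by rewrite mulrC; exact: (is_derive1_comp (f := flat q) (g := fun x => k * (b - x)) H H').
  apply: is_derive_eq (is_deriveM H1 H2) _.
  by rewrite /= !flatZ !scaleRE; ring.
exists (f' \+ g'); first exact: bump_add.
by move=> x; apply: is_deriveD.
Qed.

(** [k] is a steepness: at a fixed point of []a, b[] the value tends to 1 as [k] grows. *)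
Definition bump k a b x := flat 1 (k * (x - a)) * flat 1 (k * (b - x)).

Lemma bump_smooth k a b : smooth1 (bump k a b).
Proof. by apply: (@bump_span_smooth k a b); exact: bump_term. Qed.

Lemma flat1_itv x : 0 <= flat 1 x <= 1.
Proof.
rewrite /flat; case: ifPn => x0; last by rewrite lexx ler01.
by rewrite hornerC mul1r expR_ge0 expR_le1 oppr_le0 invr_ge0 ltW.
Qed.

Lemma bump_itv k a b x : 0 <= bump k a b x <= 1.
Proof.
have /andP[? ?] := flat1_itv (k * (x - a)).
have /andP[? ?] := flat1_itv (k * (b - x)).
by rewrite /bump mulr_ge0//= mulr_ile1.
Qed.

Lemma bump_out k a b x : 0 < k -> x \notin `]a, b[ -> bump k a b x = 0.
Proof.
move=> k0; rewrite in_itv/= negb_and -!leNgt => /orP[xa|xb]; rewrite /bump.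
  by rewrite {1}/flat ifF ?mul0r// pmulr_rgt0// subr_gt0 ltNge xa.
by rewrite [flat _ (k * (b - x))]/flat ifF ?mulr0// pmulr_rgt0// subr_gt0 ltNge xb.
Qed.

End bump.

(** * Functions whose integrals vanish on a generating family *)

Section integral_pi_system.
Context d (T : measurableType d) (R : realType).
Variable mu : {measure set T -> \bar R}.

(** Dynkin's lemma: the sets over which [h] integrates to 0 are stable under complement, because the
    total integral vanishes, and under countable disjoint union. Taking for [X] a coordinate
    projection passes from intervals to Borel sets in one factor at a time. *)
Lemma pi_integral_eq0 d' (T' : measurableType d') (X : T -> T')
    (G : set (set T')) (h : T -> R) :
  measurable_fun setT X -> mu.-integrable setT (EFin \o h) ->
  @measurable _ T' = <<s G >> -> setI_closed G ->
  (\int[mu]_x (h x)%:E = 0)%E ->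
  (forall A, G A -> \int[mu]_(x in X @^-1` A) (h x)%:E = 0)%E ->
  forall A, measurable A -> (\int[mu]_(x in X @^-1` A) (h x)%:E = 0)%E.
Proof.
move=> mX ih GE GI h0 GA0 A; rewrite GE.
have mXA B : measurable B -> measurable (X @^-1` B).
  by move=> mB; rewrite -[X @^-1` B]setTI; exact: mX.
apply: (@dynkin_induction _ _ G (fun A => \int[mu]_(x in X @^-1` A) (h x)%:E = 0)%E GE GI) => // [S mS S0|F mF tF F0].
  rewrite preimage_setC.
  have := integral_setU mu (mXA _ mS) (measurableC (mXA _ mS)) (f := EFin \o h).
  rewrite setUv => /(_ (measurable_int _ ih)).
  rewrite h0 S0 add0e => -> //.
  by apply/disj_setPS; rewrite setICr.
rewrite preimage_bigcup integral_bigcup//.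
- by rewrite eseries0// => k _ _; exact: F0.
- apply/trivIsetP => i j _ _ ij; rewrite -preimage_setI.
  by move/trivIsetP : tF => /(_ i j I I ij) ->; rewrite preimage_set0.
- by move=> k; exact: mXA.
- apply: integrableS ih => //.
  by apply: bigcupT_measurable => k; exact: mXA.
Qed.

(** Dominated convergence, [|g|] being a majorant since the [phi n] are bounded by 1. *)
Lemma limit_integral_eq0 (g : T -> R) (phi : nat -> T -> R) (A : set T) :
  measurable A -> mu.-integrable setT (EFin \o g) ->
  (forall n, measurable_fun setT (phi n)) -> (forall n x, `|phi n x| <= 1) ->
  (forall x, phi n x @[n --> \oo] --> (\1_A x : R)) ->
  (forall n, \int[mu]_x (g x * phi n x) = 0) ->
  (\int[mu]_(x in A) (g x)%:E = 0)%E.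
Proof.
move=> mA ig mphi phi1 phiA g0.
have mg : measurable_fun setT g by apply/measurable_EFinP; exact: measurable_int ig.
have igphi n : mu.-integrable setT (EFin \o (fun x => g x * phi n x)).
  apply: le_integrable ig => //; first by apply/measurable_EFinP; exact: measurable_funM.
  by move=> x _ /=; rewrite lee_fin normrM ler_piMr.
have [_ _] := @dominated_convergence _ _ _ mu setT measurableT
  (fun n x => (g x * phi n x)%:E) (fun x => (g x * \1_A x)%:E) (fun x => `|g x|%:E)
  (fun n => measurable_int _ (igphi n))
  ltac:(by apply/measurable_EFinP; apply: measurable_funM)
  ltac:(by apply: nearW => x _; apply: cvg_EFin; [exact: nearW|apply: cvgMr])
  ltac:(by apply: (integrable_abse ig))
  ltac:(by apply: nearW => x n _; rewrite lee_fin normrM ler_piMr).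
have -> : [sequence (\int[mu]_x (g x * phi n x)%:E)%E]_n = cst 0%E.
  apply/funext => n /=; rewrite -[LHS]fineK; last exact: integrable_fin_num (igphi n).
  by rewrite -/(Rintegral _ _ _) g0.
move=> /(cvg_unique _ (cvg_cst 0%E)) => /(_ (@ereal_hausdorff R)).
move=> E0; rewrite integral_mkcond [RHS]E0; apply: eq_integral => x _.
by rewrite patchE indicE; case: ifPn; rewrite ?mulr1 ?mulr0.
Qed.

Lemma mrestr_integral (D : set T) (mD : measurable D) (f : T -> \bar R) E :
  measurable E -> (mrestr mu mD).-integrable E f ->
  (\int[mrestr mu mD]_(x in E) f x = \int[mrestr mu mD]_(x in E `&` D) f x)%E.
Proof.
move=> mE fi; rewrite (@negligible_integral _ _ _ _ _ (~` D))//.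
- by rewrite setDE setCK.
- exact: measurableC.
- by rewrite /= /mrestr setICl.
Qed.

End integral_pi_system.

Section test_functions.
Context (R : realType).
Implicit Types (a b k x : R) (f g : R -> R).

Lemma segment_subset_compact a b (A : set R) : A `<=` [set` `[a, b]] ->
  compact (closure A) /\ closure A `<=` [set` `[a, b]].
Proof.
move=> Aab; have cab : closure A `<=` [set` `[a, b]].
  have /closure_id -> := @interval_closed R (BLeft a) (BRight b) isT isT.
  exact: closureS.
split => //; apply: subclosed_compact cab; first exact: closed_closure.
exact: segment_compact.
Qed.

Lemma bump_support k a b : 0 < k -> [set x | bump k a b x != 0] `<=` [set` `[a, b]].
Proof.
move=> k0 x /=; apply: contraR => xab; rewrite bump_out//.
by apply: contra xab; exact: subset_itv_oo_cc.
Qed.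

Lemma bump_test1 k a b a' b' : 0 < k -> a < a' -> b' < b ->
  test1 a b (bump k a' b').
Proof.
move=> k0 aa' bb'.
have [cK Kab] := segment_subset_compact (@bump_support k a' b' k0).
split => //; first exact: bump_smooth.
apply: subset_trans Kab _ => x /=; rewrite !in_itv/= => /andP[ax xb].
by rewrite (lt_le_trans aa')// (le_lt_trans xb).
Qed.

(** The closed support must lie in the open interval, hence the inset [1 / n.+1]. With steepness
    [n.+1] this inset costs only a shift by 1 in the argument of [flat], and the values still tend
    to 1 inside. *)
Definition shrunk_bump a b n : R -> R :=
  bump n.+1%:R (a + n.+1%:R^-1) (b - n.+1%:R^-1).

Lemma shrunk_bump_test1 a b n a' b' : a' <= a -> b <= b' ->
  test1 a' b' (shrunk_bump a b n).
Proof.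
move=> aa' bb'; apply: bump_test1; rewrite ?ltr0n//.
  by apply: le_lt_trans aa' _; rewrite ltrDl invr_gt0.
by apply: lt_le_trans bb'; rewrite gtrDl oppr_lt0 invr_gt0.
Qed.

Lemma shrunk_bump_norm a b n x : `|shrunk_bump a b n x| <= 1.
Proof. by rewrite ger0_norm; have /andP[] := bump_itv n.+1%:R (a + n.+1%:R^-1) (b - n.+1%:R^-1) x. Qed.

Lemma flat_shift_cvg (y : R) : 0 < y ->
  flat 1 (n.+1%:R * y - 1) @[n --> \oo] --> (1 : R).
Proof.
move=> y0.
have E n : (n.+1%:R * y - 1)^-1 = n.+1%:R^-1 * (y - n.+1%:R^-1)^-1.
  rewrite -invfM; congr (_^-1); rewrite mulrBr divff ?pnatr_eq0//.
have H : expR (- (n.+1%:R * y - 1)^-1) @[n --> \oo] --> (1 : R).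
  rewrite -[X in _ --> X](@expR0 R) -[X in expR X]oppr0.
  apply: (@cvg_comp _ _ _ (fun n : nat => - (n.+1%:R * y - 1)^-1) (@expR R)); last exact: continuous_expR.
  apply: cvgN; rewrite (funext E) -(mul0r (y - 0)^-1).
  apply: cvgM; first exact: cvg_harmonic.
  apply: cvgV; first by rewrite subr0 gt_eqF.
  by apply: cvgB; [exact: cvg_cst|exact: cvg_harmonic].
apply: cvg_trans H; apply: near_eq_cvg; near=> n.
rewrite /flat ifT ?hornerC ?mul1r// subr_gt0 -ltr_pdivrMr// mul1r.
have : y^-1 < n%:R by near: n; exact: nbhs_infty_gtr.
by move=> /lt_trans; apply; rewrite ltr_nat.
Unshelve. all: by end_near. Qed.

Lemma shrunk_bump_cvg a b x :
  shrunk_bump a b n x @[n --> \oo] --> (\1_`]a, b[ x : R).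
Proof.
rewrite indicE; have [xab|xab] := boolP (x \in `]a, b[).
  rewrite mem_set//= -[1%:R](mulr1 (1 : R)); move: xab; rewrite in_itv/= => /andP[ax xb].
  have E1 n : n.+1%:R * (x - (a + n.+1%:R^-1)) = n.+1%:R * (x - a) - 1 :> R.
    by rewrite opprD addrA mulrBr divff ?pnatr_eq0.
  have E2 n : n.+1%:R * (b - n.+1%:R^-1 - x) = n.+1%:R * (b - x) - 1 :> R.
    by rewrite addrAC mulrBr divff ?pnatr_eq0.
  rewrite /shrunk_bump /bump; under eq_fun do rewrite E1 E2.
  by apply: cvgM; apply: flat_shift_cvg; rewrite subr_gt0.
rewrite memNset//=; last by apply/negP.
rewrite (_ : (fun n => shrunk_bump a b n x) = cst 0); first exact: cvg_cst.
apply/funext => n; rewrite /shrunk_bump bump_out//.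
apply: contra xab; rewrite !in_itv/= => /andP[ax xb].
rewrite (lt_trans _ ax) ?(lt_trans xb)//.
  by rewrite gtrDl oppr_lt0 invr_gt0.
by rewrite ltrDl invr_gt0.
Qed.

Lemma smooth1_continuous f : smooth1 f -> continuous f.
Proof.
move=> sf x; apply: differentiable_continuous; apply/derivable1_diffP.
exact: (sf 0).
Qed.

Lemma smooth1_derive1n f n : smooth1 f -> smooth1 (derive1n n f).
Proof.
move=> sf m x; have := sf (m + n)%N x.
by rewrite /derive1n iterD.
Qed.

Lemma derive_fst_tensor f g (p : R * R) : smooth1 f ->
  is_derive p (1, 0) (fun p => f p.1 * g p.2) (f^`()%classic p.1 * g p.2).
Proof.
move=> sf.
have := sf 0 p.1; rewrite derive1n0 /derivable => df.
have E : (fun h : R => h^-1 *: (((fun p => f p.1 * g p.2) \o shift p) (h *: (1, 0)) - f p.1 * g p.2)) =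
   (fun h : R => (h^-1 *: ((f \o shift p.1) (h *: 1) - f p.1)) * g p.2).
  apply/funext => h /=.
  by rewrite scaler0 add0r -mulrBl -scalerAl.
have H : (fun h : R => h^-1 *: (((fun p => f p.1 * g p.2) \o shift p) (h *: (1, 0)) - f p.1 * g p.2)) @ 0^' --> f^`()%classic p.1 * g p.2.
  by rewrite E; apply: cvgMl; rewrite derive1E; exact: df.
apply: DeriveDef; first by apply/cvg_ex; exists (f^`()%classic p.1 * g p.2).
exact: cvg_lim H.
Qed.

Lemma derive_snd_tensor f g (p : R * R) : smooth1 g ->
  is_derive p (0, 1) (fun p => f p.1 * g p.2) (f p.1 * g^`()%classic p.2).
Proof.
move=> sg.
have := sg 0 p.2; rewrite derive1n0 /derivable => dg.
have E : (fun h : R => h^-1 *: (((fun p => f p.1 * g p.2) \o shift p) (h *: (0, 1)) - f p.1 * g p.2)) =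
   (fun h : R => f p.1 * (h^-1 *: ((g \o shift p.2) (h *: 1) - g p.2))).
  apply/funext => h /=.
  by rewrite scaler0 add0r -mulrBr -scalerAr.
have H : (fun h : R => h^-1 *: (((fun p => f p.1 * g p.2) \o shift p) (h *: (0, 1)) - f p.1 * g p.2)) @ 0^' --> f p.1 * g^`()%classic p.2.
  by rewrite E; apply: cvgMr; rewrite derive1E; exact: dg.
apply: DeriveDef; first by apply/cvg_ex; exists (f p.1 * g^`()%classic p.2).
exact: cvg_lim H.
Qed.

(** Every iterated partial derivative is again a product of a derivative of [f] and a derivative of
    [g]. *)
Lemma tensor_smooth2 f g : smooth1 f -> smooth1 g ->
  smooth2 (fun p : R * R => f p.1 * g p.2).
Proof.
move=> sf sg s h.
have [m [n hE]] : exists m n, h = fun p => derive1n m f p.1 * derive1n n g p.2.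
  rewrite /h; elim: s {h} => [|i s [m [n IH]]]; first by exists 0%N, 0%N.
  rewrite /= IH; have [->|i1] := eqVneq i 0.
    exists m.+1, n; apply/funext => p.
    by have [_] := derive_fst_tensor (derive1n n g) p (smooth1_derive1n (n := m) sf).
  exists m, n.+1; apply/funext => p; rewrite /partial /axis (negbTE i1).
  by have [_] := derive_snd_tensor (derive1n m f) p (smooth1_derive1n (n := n) sg).
have sm := smooth1_derive1n (n := m) sf; have sn := smooth1_derive1n (n := n) sg.
rewrite hE; split.
  move=> p; apply: cvgM.
    by apply: (continuous_comp (f := fst)); [exact: cvg_fst|exact: smooth1_continuous].
  by apply: (continuous_comp (f := snd)); [exact: cvg_snd|exact: smooth1_continuous].
move=> i p; rewrite /axis; case: ifPn => _.
  by have [] := derive_fst_tensor (derive1n n g) p sm.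
by have [] := derive_snd_tensor (derive1n m f) p sn.
Qed.

End test_functions.

(** * The du Bois-Reymond lemma on a segment and on a rectangle *)

Section du_bois_reymond.
Context (R : realType).
Implicit Types (a b : R) (D : rectangle R).
Local Notation leb := (@lebesgue_measure R).
Local Notation line := (measurableTypeR R).

Lemma segment_measure_lty a b : (segment_measure a b setT < +oo)%E.
Proof.
rewrite /segment_measure /= /mrestr setTI.
by rewrite lebesgue_measure_itv/=; case: ifP => _; rewrite ?ltry// -EFinB ltry.
Qed.

Lemma area_lty D : (area D setT < +oo)%E.
Proof.
have itv_lty a b : (leb [set` `]a, b[] < +oo)%E.
  by rewrite lebesgue_measure_itv/=; case: ifP => _; rewrite ?ltry// -EFinB ltry.
rewrite /area /= /mrestr setTI /open_rect.
rewrite product_measure1E; [|exact: measurable_itv|exact: measurable_itv].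
apply: lte_mul_pinfty; [exact: measure_ge0| |exact: itv_lty].
by rewrite ge0_fin_numE; [exact: itv_lty|exact: measure_ge0].
Qed.

Lemma L2_integrable d (T : measurableType d) (mu : {measure set T -> \bar R}) (f : T -> R) :
  (mu setT < +oo)%E -> L2 mu f -> mu.-integrable setT (EFin \o f).
Proof.
move=> fin Lf; apply/Lfun1_integrable; apply: Lfun_subset12 => //.
by rewrite ge0_fin_numE.
Qed.

Lemma segment_integralI a b (f : R -> \bar R) (E : set line) : measurable E ->
  (segment_measure a b).-integrable E f ->
  (\int[segment_measure a b]_(x in E) f x =
   \int[segment_measure a b]_(x in E `&` [set` `]a, b[]) f x)%E.
Proof. exact: mrestr_integral. Qed.

Lemma area_integralI D (f : R * R -> \bar R) (E : set (line * line)) : measurable E ->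
  (area D).-integrable E f ->
  (\int[area D]_(x in E) f x = \int[area D]_(x in E `&` open_rect D) f x)%E.
Proof. exact: mrestr_integral. Qed.

(** The full line makes the total integral, which Dynkin's lemma asks for, an instance of the same
    computation: intersected with []a, b[], every member becomes an open interval. *)
Definition oitv_or_full : set (set line) :=
  [set A | A = setT \/ exists x y, A = `]x, y[%classic].

Lemma measurable_oitv_or_full : @measurable _ line = <<s oitv_or_full >>.
Proof.
rewrite eqEsubset; split; last first.
  apply: smallest_sub; first exact: sigma_algebra_measurable.
  by move=> A [->|[x [y ->]]]; [exact: measurableT|exact: measurable_itv].
have -> : @measurable _ line = <<s @RGenOpens.G R >> := @RGenOpens.measurableE R.
apply: smallest_sub; first exact: smallest_sigma_algebra.
by move=> A [x [y ->]]; apply: sub_sigma_algebra; right; exists x, y.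
Qed.

Lemma oitv_or_full_oitv A a b : oitv_or_full A ->
  exists p q, [/\ A `&` [set` `]a, b[] = [set` `]p, q[], a <= p & q <= b].
Proof.
move=> [->|[x [y ->]]]; first by exists a, b; rewrite setTI.
exists (Num.max x a), (Num.min y b); split.
- apply/seteqP; split => z /=; rewrite !in_itv/= gt_max lt_min.
    by move=> [/andP[-> ->] /andP[-> ->]].
  by move=> /andP[/andP[-> ->] /andP[-> ->]].
- by rewrite le_max lexx orbT.
- by rewrite ge_min lexx orbT.
Qed.

Lemma oitv_or_full_setI : setI_closed oitv_or_full.
Proof.
move=> A B [->|[x [y ->]]]; first by rewrite setTI.
move=> /oitv_or_full_oitv H; right; have [p [q [E _ _]]] := H x y.
by exists p, q; rewrite setIC.
Qed.

(** Bumps converge boundedly to the indicator of any open subinterval, so [g] integrates to 0 over a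
    generating family stable under intersection, hence over every Borel set. *)
Lemma segment_du_bois_reymond a b (g : R -> R) : L2 (segment_measure a b) g ->
  (forall phi, test1 a b phi -> \int[segment_measure a b]_x (g x * phi x) = 0) ->
  ae_eq (segment_measure a b) setT g (cst 0).
Proof.
move=> Lg g0; have ig := L2_integrable (segment_measure_lty a b) Lg.
have g0A A : oitv_or_full A -> (\int[segment_measure a b]_(x in A) (g x)%:E = 0)%E.
  move=> GA; have mA : measurable A.
    by rewrite measurable_oitv_or_full; exact: sub_sigma_algebra.
  rewrite segment_integralI//; last exact: integrableS ig.
  have [p [q [-> ap qb]]] := oitv_or_full_oitv a b GA.
  refine (@limit_integral_eq0 _ line R (segment_measure a b) g (shrunk_bump p q) _ _ _ _ _ _ _) => //.
  - move=> n; apply: continuous_measurable_fun.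
    by apply: smooth1_continuous; have [] := shrunk_bump_test1 n (lexx p) (lexx q).
  - by move=> n x; exact: shrunk_bump_norm.
  - by move=> x; exact: shrunk_bump_cvg.
  - by move=> n; apply: g0; exact: shrunk_bump_test1.
have g0M A : measurable A -> (\int[segment_measure a b]_(x in A) (g x)%:E = 0)%E.
  apply: (@pi_integral_eq0 _ _ _ _ _ _ id oitv_or_full) => //.
  - exact: measurable_oitv_or_full.
  - exact: oitv_or_full_setI.
  - by apply: g0A; left.
have := @integral_ae_eq _ _ _ (segment_measure a b) setT measurableT (cst 0%E) (EFin \o g) ig.
move=> /(_ (measurable_cst _)) H.
have : ae_eq (segment_measure a b) setT (EFin \o g) (cst 0%E).
  by apply: H => E _ mE; rewrite integral0 g0M.
by apply: filterS => x /(_ I) [].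
Qed.

Lemma tensor_test2 D f g :
  test1 (x_lo D) (x_hi D) f -> test1 (y_lo D) (y_hi D) g ->
  test2 D (fun p : R * R => f p.1 * g p.2).
Proof.
move=> [sf cf fD] [sg cg gD].
have clfg : closure [set p : R * R | f p.1 * g p.2 != 0] `<=`
    closure [set x | f x != 0] `*` closure [set y | g y != 0].
  have cl : closed (closure [set x | f x != 0] `*` closure [set y | g y != 0]).
    by apply: compact_closed; [exact: norm_hausdorff|exact: compact_setX].
  rewrite [X in _ `<=` X](closure_id _).1//; apply: closureS => p /=.
  by rewrite mulf_eq0 negb_or => /andP[? ?]; split; exact: subset_closure.
split; first exact: tensor_smooth2.
  apply: subclosed_compact clfg; first exact: closed_closure.
  exact: compact_setX.
by apply: subset_trans clfg _ => p [p1 p2]; split; [exact: fD|exact: gD].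
Qed.

(** Products of bumps reach the rectangles with open interval sides. Dynkin's lemma is then used
    three times: in the first factor, in the second, and on measurable rectangles. *)
Lemma area_du_bois_reymond D (g : R * R -> R) : L2 (area D) g ->
  (forall phi, test2 D phi -> \int[area D]_p (g p * phi p) = 0) ->
  ae_eq (area D) setT g (cst 0).
Proof.
move=> Lg g0; have ig := L2_integrable (area_lty D) Lg.
have mX (A : set line) (B : set line) : measurable A -> measurable B ->
    measurable (A `*` B) by exact: measurableX.
have mG A : oitv_or_full A -> measurable A.
  by move=> GA; rewrite measurable_oitv_or_full; exact: sub_sigma_algebra.
have g0A A B : oitv_or_full A -> oitv_or_full B ->
    (\int[area D]_(x in A `*` B) (g x)%:E = 0)%E.
  move=> GA GB; have mA := mG _ GA; have mB := mG _ GB.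
  rewrite area_integralI//; [|exact: mX|by apply: integrableS ig => //; exact: mX].
  rewrite /open_rect -setXI.
  have [p [q [-> ap qb]]] := oitv_or_full_oitv (x_lo D) (x_hi D) GA.
  have [r [s [-> ar sb]]] := oitv_or_full_oitv (y_lo D) (y_hi D) GB.
  have mb a b n : measurable_fun setT (shrunk_bump a b n : line -> R).
    apply: continuous_measurable_fun.
    by apply: smooth1_continuous; have [] := shrunk_bump_test1 n (lexx a) (lexx b).
  refine (@limit_integral_eq0 _ (line * line)%type R (area D) g
      (fun n z => shrunk_bump p q n z.1 * shrunk_bump r s n z.2) _ _ _ _ _ _ _) => //.
  - by apply: mX; exact: measurable_itv.
  - by move=> n; apply: measurable_funM; apply: measurableT_comp.
  - by move=> n x; rewrite normrM mulr_ile1//; exact: shrunk_bump_norm.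
  - move=> z; have -> : \1_(`]p, q[ `*` `]r, s[) z = \1_(`]p, q[ : set R) z.1 * \1_(`]r, s[ : set R) z.2 :> R.
      by rewrite !indicE in_setX; case: (_ \in _); rewrite ?mul1r ?mul0r.
    by apply: cvgM; exact: shrunk_bump_cvg.
  - by move=> n; apply: g0; apply: tensor_test2; exact: shrunk_bump_test1.
(* Extending [g] by 0 outside a strip turns an integral over a rectangle into one over the preimage
   of one side by a projection, the form required by [pi_integral_eq0]. *)
have ipatch (A : set (line * line)) : measurable A ->
    (area D).-integrable setT (EFin \o (g \_ A)).
  move=> mA; rewrite -restrict_EFin; apply/integrable_restrict => //.
  by rewrite setTI; exact: integrableS ig.
have patchE (A B : set (line * line)) : measurable A -> measurable B ->
    (\int[area D]_(x in B) ((g \_ A) x)%:E = \int[area D]_(x in B `&` A) (g x)%:E)%E.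
  by move=> mA mB; rewrite integral_mkcondr restrict_EFin.
have g0M1 A B : measurable A -> oitv_or_full B ->
    (\int[area D]_(x in A `*` B) (g x)%:E = 0)%E.
  move=> mA GB; have mTB : measurable (setT `*` B : set (line * line)) by apply: mX => //; exact: mG.
  have -> : A `*` B = (fst @^-1` A) `&` (setT `*` B).
    by apply/seteqP; split => z /= [] // ? [_ ?].
  have mA1 (C : set line) : measurable C -> measurable (fst @^-1` C : set (line * line)).
    by move=> mC; rewrite -[_ @^-1` _]setTI; exact: measurable_fst.
  rewrite -patchE//; last exact: mA1.
  apply: (@pi_integral_eq0 _ _ _ _ _ _ fst oitv_or_full) => //.
  - exact: ipatch.
  - exact: measurable_oitv_or_full.
  - exact: oitv_or_full_setI.
  - by rewrite patchE// setTI; apply: g0A => //; left.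
  - move=> C GC; have mC := mA1 _ (mG _ GC); rewrite patchE//.
    rewrite (_ : _ `&` _ = C `*` B); first exact: g0A.
    by apply/seteqP; split => z /= [] // ? [_ ?].
have g0M2 A B : measurable A -> measurable B ->
    (\int[area D]_(x in A `*` B) (g x)%:E = 0)%E.
  move=> mA mB; have mAT : measurable (A `*` setT : set (line * line)) by apply: mX.
  have -> : A `*` B = (snd @^-1` B) `&` (A `*` setT).
    by apply/seteqP; split => z /= [] // ? [].
  have mB1 (C : set line) : measurable C -> measurable (snd @^-1` C : set (line * line)).
    by move=> mC; rewrite -[_ @^-1` _]setTI; exact: measurable_snd.
  rewrite -patchE//; last exact: mB1.
  apply: (@pi_integral_eq0 _ _ _ _ _ _ snd oitv_or_full) => //.
  - exact: ipatch.
  - exact: measurable_oitv_or_full.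
  - exact: oitv_or_full_setI.
  - by rewrite patchE// setTI; apply: g0M1 => //; left.
  - move=> C GC; have mC := mB1 _ (mG _ GC); rewrite patchE//.
    rewrite (_ : _ `&` _ = A `*` C); first exact: g0M1.
    by apply/seteqP; split => z /= [] // ? [].
have g0M A : measurable A -> (\int[area D]_(x in A) (g x)%:E = 0)%E.
  apply: (@pi_integral_eq0 _ _ _ _ _ _ id
    [set A `*` B | A in measurable & B in measurable]) => //.
  - by rewrite measurable_prod_measurableType.
  - move=> _ _ [A1 mA1 [B1 mB1 <-]] [A2 mA2 [B2 mB2 <-]].
    exists (A1 `&` A2); first exact: measurableI.
    by exists (B1 `&` B2); [exact: measurableI|rewrite setXI].
  - by rewrite -setXTT; apply: g0M2.
  - by move=> _ [A1 mA1 [B1 mB1 <-]]; exact: g0M2.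
have := @integral_ae_eq _ _ _ (area D) setT measurableT (cst 0%E) (EFin \o g) ig.
move=> /(_ (measurable_cst _)) H.
have : ae_eq (area D) setT (EFin \o g) (cst 0%E).
  by apply: H => E _ mE; rewrite integral0 g0M.
by apply: filterS => x /(_ I) [].
Qed.

End du_bois_reymond.

(** * Weak derivatives with respect to an abstract class of test functions *)

Section weak_derivative.
Context d (T : measurableType d) (R : realType).
Variable mu : {measure set T -> \bar R}.
Variables (tst : set (T -> R)) (op : (T -> R) -> T -> R).
Implicit Types (u v g h phi : T -> R).

(* Used with [op := derive1] on a segment and [op := partial i] on a rectangle. *)
Definition weakd u g := L2 mu g /\ forall phi, tst phi ->
  \int[mu]_x (u x * op phi x) = - \int[mu]_x (g x * phi x).

Hypothesis tst_L2 : forall phi, tst phi -> L2 mu phi.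
Hypothesis op_L2 : forall phi, tst phi -> L2 mu (op phi).
Hypothesis du_bois : forall g, L2 mu g ->
  (forall phi, tst phi -> \int[mu]_x (g x * phi x) = 0) -> ae_eq mu setT g (cst 0).

Lemma ip_cvg (u : nat -> T -> R) v g : (forall n, L2 mu (u n)) -> L2 mu v ->
  L2 mu g -> ip mu (u n \- v) (u n \- v) @[n --> \oo] --> 0 ->
  ip mu (u n) g @[n --> \oo] --> ip mu v g.
Proof.
move=> Lu Lv Lg uv; apply/subr_cvg0; apply/cvg0_squares.
apply: (@cvg0_le _ _ (fun n => ip mu g g * ip mu (u n \- v) (u n \- v))).
  by move=> n; rewrite sqr_ge0/= -ipB// mulrC cauchy_schwarz//; exact: L2_B.
by rewrite -[0](mulr0 (ip mu g g)); exact: cvgMr.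
Qed.

Lemma weakd_uniq u g h : weakd u g -> weakd u h -> ae_eq mu setT g h.
Proof.
move=> [Lg ug] [Lh uh].
have : ae_eq mu setT (g \- h) (cst 0).
  apply: du_bois; first exact: L2_B.
  move=> phi tphi; have Lphi := tst_L2 tphi.
  have := ipB Lg Lh Lphi; rewrite /ip => ->.
  by apply/eqP; rewrite subr_eq0 -eqr_opp -ug// -uh.
by apply: filterS => x /(_ I) /eqP + _; rewrite subr_eq0 => /eqP.
Qed.

Lemma weakd_lin t u v g h : L2 mu u -> L2 mu v -> weakd u g -> weakd v h ->
  weakd (fun x => t * u x + v x) (fun x => t * g x + h x).
Proof.
move=> Lu Lv [Lg ug] [Lh vh]; split; first exact: L2_lin.
move=> phi tphi; have Lphi := tst_L2 tphi; have Lop := op_L2 tphi.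
have := ip_lin t Lu Lv Lop; have := ip_lin t Lg Lh Lphi; rewrite /ip => -> ->.
by rewrite ug// vh//; ring.
Qed.

(** Both sides of the defining identity are [L^2] pairings with a fixed function, so they pass to
    the limit. The completeness of the Sobolev spaces rests on this. *)
Lemma weakd_closed (u g : nat -> T -> R) v h :
  (forall n, L2 mu (u n)) -> L2 mu v -> L2 mu h ->
  (forall n, weakd (u n) (g n)) ->
  ip mu (u n \- v) (u n \- v) @[n --> \oo] --> 0 ->
  ip mu (g n \- h) (g n \- h) @[n --> \oo] --> 0 -> weakd v h.
Proof.
move=> Lu Lv Lh ug uv gh; split => // phi tphi.
have H1 := ip_cvg Lu Lv (op_L2 tphi) uv.
have H2 : - ip mu (g n) phi @[n --> \oo] --> - ip mu h phi.
  by apply: cvgN; exact: (ip_cvg (fun n => (ug n).1) Lh (tst_L2 tphi) gh).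
have E : (fun n => ip mu (u n) (op phi)) = (fun n => - ip mu (g n) phi).
  by apply/funext => n; exact: (ug n).2.
by rewrite E in H1; exact: (cvg_unique (@Rhausdorff R) H1 H2).
Qed.

End weak_derivative.

(** * Measurability and square integrability on the plane *)

Section plane_measure.
Context (R : realType).
Local Notation line := (measurableTypeR R).
Local Notation plane := (line * line)%type.

(** Links the topology of the plane with the product sigma-algebra: an open set is the countable
    union of the rational open rectangles that it contains. *)
Lemma open_plane_measurable (U : set (R * R)) : open U ->
  measurable (U : set plane).
Proof.
move=> oU.
pose rect (q : (rat * rat) * (rat * rat)) : set plane :=
  `]ratr q.1.1, ratr q.1.2[%classic `*` `]ratr q.2.1, ratr q.2.2[%classic.
pose F q := if `[< rect q `<=` U >] then rect q else set0.
have -> : U = \bigcup_q F q.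
  apply/seteqP; split => [[x y] Uxy|p [q _]]; last first.
    by rewrite /F; case: asboolP => // qU; exact: qU.
  have /nbhs_ballP[e /= e0 eU] : nbhs (x, y) U by exact: open_nbhs_nbhs.
  have H (z : R) : exists q : rat * rat, [/\ z - e < ratr q.1, ratr q.1 < z,
      z < ratr q.2 & ratr q.2 < z + e].
    have [q1] := @rat_in_itvoo R (z - e) z ltac:(by rewrite gtrBl).
    have [q2] := @rat_in_itvoo R z (z + e) ltac:(by rewrite ltrDl).
    by rewrite !in_itv/= => /andP[? ?] /andP[? ?]; exists (q1, q2).
  have [qx [x1 x2 x3 x4]] := H x; have [qy [y1 y2 y3 y4]] := H y.
  exists (qx, qy) => //; rewrite /F; case: asboolP => [_|[]].
    by split; rewrite /= in_itv/= ?x2 ?x3 ?y2 ?y3.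
  move=> [u v] [/=]; rewrite !in_itv/= => /andP[u1 u2] /andP[v1 v2].
  apply: eU; split; rewrite /ball/= ltr_distl.
    by apply/andP; split; lra.
  by apply/andP; split; lra.
apply: countable_bigcupT_measurable => // q.
rewrite /F; case: asboolP => // _.
by apply: measurableX; exact: measurable_itv.
Qed.

Lemma continuous_plane_measurable (f : R * R -> R) : continuous f ->
  measurable_fun setT (f : plane -> R).
Proof.
move=> /continuousP cf; apply: (@measurability _ _ plane line setT f (@RGenOpens.G R)).
  exact: RGenOpens.measurableE.
move=> _ [_ [x [y ->]] <-]; rewrite setTI.
by apply: open_plane_measurable; apply: cf; exact: interval_open.
Qed.

Lemma L2_mrestr_bounded d (T : measurableType d) (mu : {measure set T -> \bar R})
    (D : set T) (mD : measurable D) (f : T -> R) (M : R) :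
  (mu D < +oo)%E -> measurable_fun setT f -> (forall x, D x -> `|f x| <= M) ->
  L2 (mrestr mu mD) f.
Proof.
move=> fD mf fM; apply/L2P; split => //.
have mff : measurable_fun setT (fun x => (f x * f x)%:E).
  by apply/measurable_EFinP; exact: measurable_funM.
rewrite (@ge0_negligible_integral _ _ _ _ _ (~` D))//; last 3 first.
- exact: measurableC.
- by move=> x _; rewrite lee_fin -expr2 sqr_ge0.
- by rewrite /= /mrestr setICl.
rewrite setTD setCK.
apply: (@le_lt_trans _ _ (\int[mrestr mu mD]_(x in D) cst (M * M)%:E x)%E).
  apply: ge0_le_integral => //.
  - by move=> x _; rewrite lee_fin -expr2 sqr_ge0.
  - exact: measurable_funTS.
  - move=> x Dx /=; rewrite lee_fin; have := fM _ Dx; rewrite ler_norml => /andP[].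
    by nra.
rewrite integral_cst//= /mrestr setIid.
by rewrite lte_mul_pinfty// ?lee_fin -?expr2 ?sqr_ge0.
Qed.

End plane_measure.

(** * Inequalities for smooth functions *)

Section tonelli.
Context (R : realType).
Implicit Types (a b : R) (D : rectangle R).
Local Notation leb := (@lebesgue_measure R).
Local Notation line := (measurableTypeR R).
Local Notation plane := (line * line)%type.
Local Notation segx D := (segment_measure (x_lo D) (x_hi D)).
Local Notation segy D := (segment_measure (y_lo D) (y_hi D)).

Lemma oitv_lty a b : (leb [set` `]a, b[] < +oo)%E.
Proof.
by rewrite lebesgue_measure_itv/=; case: ifP => _; rewrite ?ltry// -EFinB ltry.
Qed.

(** The same measure as [segment_measure], packaged as a finite one so that product measures and the
    Fubini theorems apply. *)
Local Notation seg a b := (@mfrestr _ line R _ leb (measurable_itv `]a, b[) (oitv_lty a b)).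

Let area_prod D (X : set plane) : measurable X ->
  area D X = (seg (x_lo D) (x_hi D) \x seg (y_lo D) (y_hi D))%E X.
Proof.
move=> mX; apply/esym.
apply: (@product_measure_unique _ _ line line R (seg (x_lo D) (x_hi D)) (seg (y_lo D) (y_hi D)) (area D)) => // A B mA mB.
rewrite /area /= /mrestr /open_rect -setXI product_measure1E//;
  by apply: measurableI => //; exact: measurable_itv.
Qed.

Lemma area_tonelli1 D (f : R * R -> \bar R) : measurable_fun setT (f : plane -> \bar R) ->
  (forall p, 0 <= f p)%E ->
  (\int[area D]_p f p = \int[segx D]_x \int[segy D]_y f (x, y))%E.
Proof.
move=> mf f0; rewrite (eq_measure_integral (seg (x_lo D) (x_hi D) \x seg (y_lo D) (y_hi D))%E).
  by rewrite fubini_tonelli1.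
by move=> A mA _; exact: area_prod.
Qed.

Lemma area_tonelli2 D (f : R * R -> \bar R) : measurable_fun setT (f : plane -> \bar R) ->
  (forall p, 0 <= f p)%E ->
  (\int[area D]_p f p = \int[segy D]_y \int[segx D]_x f (x, y))%E.
Proof.
move=> mf f0; rewrite (eq_measure_integral (seg (x_lo D) (x_hi D) \x seg (y_lo D) (y_hi D))%E).
  by rewrite fubini_tonelli2.
by move=> A mA _; exact: area_prod.
Qed.

Lemma area_fubini1 D (f : R * R -> \bar R) : (area D).-integrable setT f ->
  (\int[area D]_p f p = \int[segx D]_x \int[segy D]_y f (x, y))%E.
Proof.
move=> /integrableP[mf fi].
have E g : (\int[area D]_p g p = \int[seg (x_lo D) (x_hi D) \x seg (y_lo D) (y_hi D)]_p g p)%E.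
  by apply: eq_measure_integral => A mA _; exact: area_prod.
rewrite E -integral12_prod_meas1//.
apply/integrableP; split; first exact: mf.
by rewrite -(E (fun p => `|f p|%E)); exact: fi.
Qed.

Lemma area_fubini2 D (f : R * R -> \bar R) : (area D).-integrable setT f ->
  (\int[area D]_p f p = \int[segy D]_y \int[segx D]_x f (x, y))%E.
Proof.
move=> /integrableP[mf fi].
have E g : (\int[area D]_p g p = \int[seg (x_lo D) (x_hi D) \x seg (y_lo D) (y_hi D)]_p g p)%E.
  by apply: eq_measure_integral => A mA _; exact: area_prod.
rewrite E -integral21_prod_meas1//.
apply/integrableP; split; first exact: mf.
by rewrite -(E (fun p => `|f p|%E)); exact: fi.
Qed.

Lemma ge0_mrestr_integral d (T : measurableType d) (mu : {measure set T -> \bar R})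
    (D : set T) (mD : measurable D) (f : T -> \bar R) :
  measurable_fun setT f -> (forall x, 0 <= f x)%E ->
  (\int[mrestr mu mD]_x f x = \int[mu]_(x in D) f x)%E.
Proof.
move=> mf f0.
have D0 : mrestr mu mD (~` D) = 0%E by rewrite /mrestr setICl.
rewrite (ge0_negligible_integral (measurableC mD) measurableT mf _ D0)//.
rewrite setTD setCK; apply: eq_measure_integral => A mA AD.
by rewrite /= /mrestr setIidl.
Qed.

Lemma segment_integral a b (f : R -> \bar R) : measurable_fun setT (f : line -> \bar R) ->
  (forall x, 0 <= f x)%E ->
  (\int[segment_measure a b]_x f x = \int[leb]_(x in [set` `]a, b[]) f x)%E.
Proof. exact: ge0_mrestr_integral. Qed.

Lemma measurable_line1 d (S : measurableType d) (f : R * R -> S) (y : R) :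
  measurable_fun setT (f : plane -> S) -> measurable_fun setT (fun x : line => f (x, y)).
Proof. by move=> mf; apply: measurableT_comp => //; exact: pair2_measurable. Qed.

Lemma measurable_line2 d (S : measurableType d) (f : R * R -> S) (x : R) :
  measurable_fun setT (f : plane -> S) -> measurable_fun setT (fun y : line => f (x, y)).
Proof. by move=> mf; apply: measurableT_comp => //; exact: pair1_measurable. Qed.

Lemma arclen_integral D (f : R * R -> \bar R) : measurable_fun setT (f : plane -> \bar R) ->
  (forall p, 0 <= f p)%E -> x_lo D < x_hi D -> y_lo D < y_hi D ->
  (\int[arclen D]_p f p =
   (\int[segx D]_x f (x, y_lo D) + \int[segx D]_x f (x, y_hi D)) +
   (\int[segy D]_y f (x_lo D, y) + \int[segy D]_y f (x_hi D, y)))%E.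
Proof.
move=> mf f0 xD yD.
have mC := measurable_closed_rect D.
have mfC : measurable_fun setT ((f \_ (closed_rect D)) : plane -> \bar R).
  by apply/(measurable_restrict _ _ _).1 => //; exact: measurable_funTS.
have fC0 p : (0 <= (f \_ (closed_rect D)) p)%E by rewrite patchE; case: ifP.
have Hx c : y_lo D <= c <= y_hi D ->
    (\int[(leb \x dirac (c : line))%E]_(p in closed_rect D) f p = \int[segx D]_x f (x, c))%E.
  move=> cD; rewrite integral_mkcond fubini_tonelli1//.
  rewrite segment_integral; [|exact: measurable_line1|by []].
  (* [arclen] charges closed sides and the segment measures open ones; the end points are
     Lebesgue-null. *)
  rewrite -(@integral_itv_bndoo R (x_lo D) (x_hi D) _ true false); last first.
    by apply: measurable_funTS; exact: measurable_line1.
  rewrite [RHS]integral_mkcond; apply: eq_integral => x _.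
  rewrite /fubini_F integral_dirac//; last exact: measurable_line2.
  rewrite diracT mul1e !patchE; congr (if _ then _ else _).
  by rewrite /closed_rect in_setX [X in _ && X]mem_set ?andbT//= in_itv.
have Hy c : x_lo D <= c <= x_hi D ->
    (\int[(dirac (c : line) \x leb)%E]_(p in closed_rect D) f p = \int[segy D]_y f (c, y))%E.
  move=> cD; rewrite integral_mkcond fubini_tonelli2//.
  rewrite segment_integral; [|exact: measurable_line2|by []].
  rewrite -(@integral_itv_bndoo R (y_lo D) (y_hi D) _ true false); last first.
    by apply: measurable_funTS; exact: measurable_line2.
  rewrite [RHS]integral_mkcond; apply: eq_integral => y _.
  rewrite /fubini_G integral_dirac//; last exact: measurable_line1.
  rewrite diracT mul1e !patchE; congr (if _ then _ else _).
  by rewrite /closed_rect in_setX [X in X && _]mem_set//= in_itv.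
have mfD : measurable_fun (closed_rect D : set plane) f by exact: measurable_funTS.
rewrite /arclen ge0_mrestr_integral// !ge0_integral_measure_add//.
by rewrite !Hx ?Hy// ?lexx ?(ltW xD) ?(ltW yD).
Qed.

End tonelli.

(** * One-dimensional inequalities for functions of class C^1 *)

Section segment_calculus.
Context (R : realType).
Implicit Types (a b c p q : R) (f g : R -> R).
Local Notation leb := (@lebesgue_measure R).
Local Notation line := (measurableTypeR R).

Lemma continuous_itv_bounded f a b : continuous f ->
  exists M, forall x, x \in `[a, b] -> `|f x| <= M.
Proof.
move=> cf; have : compact (f @` [set` `[a, b]]).
  apply: continuous_compact; first exact: continuous_subspaceT.
  exact: segment_compact.
move=> /compact_bounded[M [_ HM]]; exists (M + 1) => x xab.
have := HM (M + 1); rewrite ltrDl ltr01 => /(_ isT); apply.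
by exists x.
Qed.

Lemma L2_segment a b f : continuous f -> L2 (segment_measure a b) f.
Proof.
move=> cf; have [M HM] := @continuous_itv_bounded f a b cf.
apply: (@L2_mrestr_bounded _ _ line _ _ _ f M); first exact: oitv_lty.
  exact: continuous_measurable_fun.
by move=> x xab; apply: HM; exact: subset_itv_oo_cc.
Qed.

Lemma segment_integrable a b f : continuous f ->
  (segment_measure a b).-integrable setT (EFin \o f).
Proof.
by move=> cf; apply: L2_integrable; [exact: segment_measure_lty|exact: L2_segment].
Qed.

Lemma segment_measureT a b : a <= b -> segment_measure a b setT = (b - a)%:E.
Proof.
move=> ab; rewrite /segment_measure /= /mrestr setTI lebesgue_measure_itv/= lte_fin.
by move: ab; rewrite le_eqVlt => /predU1P[->|->]; rewrite ?ltxx ?subrr ?EFinB.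
Qed.

Lemma segment_le a b f g : continuous f -> continuous g ->
  (forall x, x \in `]a, b[ -> f x <= g x) ->
  \int[segment_measure a b]_x f x <= \int[segment_measure a b]_x g x.
Proof.
move=> cf cg fg; have mI : measurable ([set` `]a, b[] : set line) by exact: measurable_itv.
have E h : continuous h -> \int[segment_measure a b]_x h x =
    \int[segment_measure a b]_(x in [set` `]a, b[]) h x.
  move=> ch; congr fine.
  by have := segment_integralI measurableT (segment_integrable a b ch); rewrite setTI.
rewrite !E//; apply: le_Rintegral => //;
  by apply: integrableS (segment_integrable a b _).
Qed.

Lemma segment_affine a b f k c : a <= b -> continuous f ->
  \int[segment_measure a b]_x (k * f x + c) =
  k * \int[segment_measure a b]_x f x + c * (b - a).
Proof.
move=> ab cf; have mu_f := segment_integrable a b cf.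
rewrite RintegralD//; last 2 first.
- exact: integrable_EFinZ.
- by apply: (segment_integrable a b); exact: cst_continuous.
by rewrite RintegralZl// Rintegral_cst// segment_measureT.
Qed.

Section C1.
Variables (f f' : R -> R).
Hypothesis df : forall x : R, is_derive x 1 f (f' x).
Hypothesis cf' : continuous f'.

Lemma is_derive_continuous : continuous f.
Proof.
move=> x; apply: differentiable_continuous; apply/derivable1_diffP.
by have [] := df x.
Qed.

Lemma segment_ftc p q : p < q ->
  (\int[leb]_(x in [set` `[p, q]]) (f' x)%:E = (f q)%:E - (f p)%:E)%E.
Proof.
move=> pq; apply: continuous_FTC2 => //.
- exact: continuous_subspaceT.
- split.
  + by move=> x _; have [] := df x.
  + by apply: cvg_at_right_filter; exact: is_derive_continuous.
  + by apply: cvg_at_left_filter; exact: is_derive_continuous.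
- by move=> x _; rewrite derive1E; have [_] := df x.
Qed.

Lemma segment_integral_deriv_eq0 a b : a < b -> f a = 0 -> f b = 0 ->
  \int[segment_measure a b]_x f' x = 0.
Proof.
move=> ab fa fb; rewrite /Rintegral.
rewrite (_ : integral _ _ _ = 0%E)//.
have ci := segment_integrable a b cf'.
rewrite segment_integralI// setTI.
have mI : measurable ([set` `]a, b[] : set line) by exact: measurable_itv.
rewrite (eq_measure_integral leb); last first.
  by move=> A mA AI; rewrite /= /mrestr setIidl.
rewrite -(@integral_itv_bndoo R a b _ true false).
  by rewrite segment_ftc// fa fb subee.
by apply: measurable_funTS; apply/measurable_EFinP; exact: continuous_measurable_fun.
Qed.

Lemma C1_diff_le a b p q : p \in `[a, b] -> q \in `[a, b] ->
  `|f q - f p| <= \int[segment_measure a b]_x `|f' x|.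
Proof.
wlog pq : p q / p <= q => [H pab qab|].
  have [pq|/ltW qp] := leP p q; first exact: H.
  by rewrite distrC; exact: H.
move: pq; rewrite le_eqVlt => /predU1P[-> _ _|pq pab qab].
  by rewrite subrr normr0; apply: Rintegral_ge0.
have cn : continuous (fun x => `|f' x|).
  by move=> x; apply: cvg_norm; exact: cf'.
have mf' : measurable_fun setT (EFin \o f' : line -> \bar R).
  by apply/measurable_EFinP; exact: continuous_measurable_fun.
have mn : measurable_fun setT ((fun x => `|f' x|%:E) : line -> \bar R).
  by apply/measurable_EFinP; exact: continuous_measurable_fun.
rewrite -lee_fin /Rintegral fineK; last first.
  exact: (integrable_fin_num _ (segment_integrable a b cn)).
rewrite segment_integral//.
have -> : `|f q - f p|%:E = `|\int[leb]_(x in [set` `[p, q]]) (f' x)%:E|%E.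
  by rewrite segment_ftc.
apply: (@le_trans _ _ (\int[leb]_(x in [set` `[p, q]]) `|f' x|%:E)%E).
  by apply: (le_abse_integral leb) => //; exact: measurable_funTS.
rewrite (@integral_itv_bndoo R p q _ true false); last exact: measurable_funTS.
apply: ge0_subset_integral => //; first exact: measurable_funTS.
move=> x /=; rewrite !in_itv/=.
move: pab qab; rewrite !in_itv/= => /andP[ap _] /andP[_ qb] /andP[px xq].
by rewrite (le_lt_trans ap px) (lt_le_trans xq qb).
Qed.

(** The fundamental theorem and Cauchy-Schwarz bound [(f p - f q) ^+ 2] by [b - a] times the
    integral of [f' ^+ 2]. The three estimates that follow integrate this over [q], over [p], or
    over both. *)
Lemma C1_sqr_le a b p q : a < b -> p \in `[a, b] -> q \in `[a, b] ->
  f p ^+ 2 <= 2 * f q ^+ 2 + 2 * (b - a) * ip (segment_measure a b) f' f'.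
Proof.
move=> ab pab qab; have := C1_diff_le qab pab.
have cn : continuous (fun x => `|f' x|).
  by move=> x; apply: cvg_norm; exact: cf'.
have c1 : continuous (cst 1 : R -> R) by exact: cst_continuous.
have := cauchy_schwarz (L2_segment a b c1) (L2_segment a b cn).
rewrite /ip.
under eq_Rintegral do rewrite /cst mul1r.
under [X in _ <= X * _]eq_Rintegral do rewrite /cst mul1r.
under [X in _ <= _ * X]eq_Rintegral do rewrite -expr2 real_normK ?num_real// expr2.
rewrite Rintegral_cst// mul1r (segment_measureT (ltW ab))/=.
set N := (X in X ^+ 2); set S := (X in (b - a) * X) => NS fpq.
have N0 : 0 <= N by apply: Rintegral_ge0.
have : (f p - f q) ^+ 2 <= (b - a) * S.
  apply: le_trans NS; rewrite -[X in X <= _]real_normK ?num_real//.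
  by rewrite ler_pXn2r// nnegrE.
have := sqr_ge0 (f p - 2 * f q); rewrite -mulrA; move: ((b - a) * S) (f p) (f q) => h u v.
by move=> ? ?; lra.
Qed.

(** With []p, q[] the whole interval and [c] an end point, this is the one-dimensional trace
    inequality. *)
Lemma C1_point_le a b p q c : p < q -> a <= p -> q <= b -> c \in `[a, b] ->
  (q - p) * f c ^+ 2 <= 2 * ip (segment_measure p q) f f +
    2 * (b - a) * (q - p) * ip (segment_measure a b) f' f'.
Proof.
move=> pq ap qb cab; have ab : a < b by apply: le_lt_trans ap (lt_le_trans pq qb).
have cf := is_derive_continuous.
have cff : continuous (fun x => f x * f x) by move=> x; apply: cvgM; exact: cf.
have : \int[segment_measure p q]_x (f c ^+ 2) <=
   \int[segment_measure p q]_x (2 * (f x * f x) + 2 * (b - a) * ip (segment_measure a b) f' f').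
  apply: segment_le; first exact: cst_continuous.
    by move=> x; apply: cvgD; [apply: cvgMr; exact: cff|exact: cvg_cst].
  move=> x; rewrite in_itv/= => /andP[px xq]; rewrite -expr2; apply: C1_sqr_le => //.
  by rewrite in_itv/= (le_trans ap (ltW px)) (le_trans (ltW xq) qb).
rewrite segment_affine ?(ltW pq)// Rintegral_cst// (segment_measureT (ltW pq))/= /ip.
by lra.
Qed.

Lemma C1_poincare a b c : a < b -> c \in `[a, b] ->
  ip (segment_measure a b) f f <= 2 * (b - a) * f c ^+ 2 +
    2 * (b - a) ^+ 2 * ip (segment_measure a b) f' f'.
Proof.
move=> ab cab; have cf := is_derive_continuous.
have cff : continuous (fun x => f x * f x) by move=> x; apply: cvgM; exact: cf.
have : \int[segment_measure a b]_x (f x * f x) <=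
   \int[segment_measure a b]_x (2 * f c ^+ 2 + 2 * (b - a) * ip (segment_measure a b) f' f').
  apply: segment_le => //; first exact: cst_continuous.
  by move=> x xab; rewrite -expr2; apply: C1_sqr_le => //; exact: subset_itv_oo_cc.
rewrite Rintegral_cst// (segment_measureT (ltW ab))/= /ip => /le_trans; apply.
by rewrite le_eqVlt; apply/orP; left; apply/eqP; ring.
Qed.

(** The values on a subinterval control those on the whole interval: this will spread the bound on a
    strip vertically to the rectangle. *)
Lemma C1_average_le a b p q : p < q -> a <= p -> q <= b ->
  (q - p) * ip (segment_measure a b) f f <=
    2 * (b - a) * ip (segment_measure p q) f f +
    2 * (b - a) ^+ 2 * (q - p) * ip (segment_measure a b) f' f'.
Proof.
move=> pq ap qb; have ab : a < b by apply: le_lt_trans ap (lt_le_trans pq qb).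
have cf := is_derive_continuous.
have cff : continuous (fun x => f x * f x) by move=> x; apply: cvgM; exact: cf.
have : \int[segment_measure a b]_x ((q - p) * (f x * f x) + 0) <=
   \int[segment_measure a b]_x (2 * ip (segment_measure p q) f f +
    2 * (b - a) * (q - p) * ip (segment_measure a b) f' f').
  apply: segment_le; last 1 first.
  - move=> x xab; rewrite addr0 -expr2; apply: C1_point_le => //.
    exact: subset_itv_oo_cc.
  - by move=> x; apply: cvgD; [apply: cvgMr; exact: cff|exact: cvg_cst].
  - exact: cst_continuous.
rewrite segment_affine ?(ltW ab)// Rintegral_cst// (segment_measureT (ltW ab))/= mul0r addr0 /ip.
move=> /le_trans; apply.
by rewrite le_eqVlt; apply/orP; left; apply/eqP; ring.
Qed.

End C1.

End segment_calculus.

Lemma ord2_neq0 (i : 'I_2) : i != 0 -> i = 1.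
Proof. by case: i => -[|[]]//= lt2 _; apply/val_inj. Qed.

(** * Smooth functions on a rectangle and integration by parts *)

Section smooth_plane.
Context (R : realType).
Implicit Types (D : rectangle R) (phi psi : R * R -> R).
Local Notation leb := (@lebesgue_measure R).
Local Notation line := (measurableTypeR R).
Local Notation plane := (line * line)%type.

Definition proper_rect D := x_lo D < x_hi D /\ y_lo D < y_hi D.

Lemma smooth2_continuous phi : smooth2 phi -> continuous phi.
Proof. by move=> /(_ [::])[]. Qed.

Lemma smooth2_partial phi i : smooth2 phi -> smooth2 (partial i phi).
Proof.
move=> sphi s; have := sphi (rcons s i).
by rewrite foldr_rcons.
Qed.

Lemma partial_continuous phi i : smooth2 phi -> continuous (partial i phi).
Proof. by move=> /(smooth2_partial i)/smooth2_continuous. Qed.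

Lemma foldr_partial_lin t phi psi s : smooth2 phi -> smooth2 psi ->
  foldr (@partial R) (fun p => t * phi p + psi p) s =
  (fun p => t * foldr (@partial R) phi s p + foldr (@partial R) psi s p).
Proof.
move=> sphi spsi; elim: s => // i s /= ->; apply/funext => p.
have [_ /(_ i p) d1] := sphi s; have [_ /(_ i p) d2] := spsi s.
rewrite /partial; set f := foldr _ _ _ in d1 *; set g := foldr _ _ _ in d2 *.
have := @deriveD _ _ _ (t *: f) g p (axis R i) (derivableZ (k := t) d1) d2.
by rewrite deriveZ//= => <-.
Qed.

Lemma smooth2_lin t phi psi : smooth2 phi -> smooth2 psi ->
  smooth2 (fun p => t * phi p + psi p).
Proof.
move=> sphi spsi s /=; rewrite foldr_partial_lin//.
have [c1 d1] := sphi s; have [c2 d2] := spsi s; split.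
  by move=> p; apply: cvgD; [apply: cvgMr; exact: c1|exact: c2].
move=> i p; apply: derivableD; last exact: d2.
exact: (derivableZ (k := t) (d1 i p)).
Qed.

Lemma partial_lin t phi psi i : smooth2 phi -> smooth2 psi ->
  partial i (fun p => t * phi p + psi p) =
  (fun p => t * partial i phi p + partial i psi p).
Proof. by move=> sphi spsi; have := foldr_partial_lin t [:: i] sphi spsi. Qed.

Lemma smooth2_is_derive_fst phi (x y : R) : smooth2 phi ->
  is_derive x 1 (fun x => phi (x, y)) (partial 0 phi (x, y)).
Proof.
move=> /(_ [::])[_ /(_ 0 (x, y))] /=; rewrite /partial /axis eqxx.
rewrite /derivable => d.
have E : (fun h : R => h^-1 *: (((fun x => phi (x, y)) \o shift x) (h *: 1) - phi (x, y))) =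
    (fun h : R => h^-1 *: ((phi \o shift (x, y)) (h *: (1, 0)) - phi (x, y))).
  by apply/funext => h /=; congr (_ *: (phi _ - _)); rewrite -[RHS]/(h *: 1 + x, h *: 0 + y) scaler0 add0r.
by apply: DeriveDef; rewrite /derivable /derive E.
Qed.

Lemma smooth2_is_derive_snd phi (x y : R) : smooth2 phi ->
  is_derive y 1 (fun y => phi (x, y)) (partial 1 phi (x, y)).
Proof.
move=> /(_ [::])[_ /(_ 1 (x, y))] /=; rewrite /partial /axis.
rewrite /derivable => d.
have E : (fun h : R => h^-1 *: (((fun y => phi (x, y)) \o shift y) (h *: 1) - phi (x, y))) =
    (fun h : R => h^-1 *: ((phi \o shift (x, y)) (h *: (0, 1)) - phi (x, y))).
  by apply/funext => h /=; congr (_ *: (phi _ - _)); rewrite -[RHS]/(h *: 0 + x, h *: 1 + y) scaler0 add0r.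
by apply: DeriveDef; rewrite /derivable /derive E.
Qed.

Lemma continuous_line1 phi y : continuous phi -> continuous (fun x => phi (x, y)).
Proof.
move=> cphi x; apply: (@continuous_comp _ _ _ (fun x : R => (x, y)) phi x); last exact: cphi.
by apply: (@cvg_pair _ _ _ _ (nbhs x) (nbhs y)); [exact: cvg_id|exact: cvg_cst].
Qed.

Lemma continuous_line2 phi x : continuous phi -> continuous (fun y => phi (x, y)).
Proof.
move=> cphi y; apply: (@continuous_comp _ _ _ (fun y : R => (x, y)) phi y); last exact: cphi.
by apply: (@cvg_pair _ _ _ _ (nbhs x) (nbhs y)); [exact: cvg_cst|exact: cvg_id].
Qed.

Lemma continuous_rect_bounded D phi : continuous phi ->
  exists M, forall p, closed_rect D p -> `|phi p| <= M.
Proof.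
move=> cphi; have : compact (phi @` closed_rect D).
  apply: continuous_compact; first exact: continuous_subspaceT.
  by apply: compact_setX; exact: segment_compact.
move=> /compact_bounded[M [_ HM]]; exists (M + 1) => x xD.
have := HM (M + 1); rewrite ltrDl ltr01 => /(_ isT); apply.
by exists x.
Qed.

Lemma open_rect_lty D : ((leb \x leb)%E (open_rect D) < +oo)%E.
Proof. by have := area_lty D; rewrite /area /= /mrestr setTI. Qed.

Lemma L2_area D phi : continuous phi -> L2 (area D) phi.
Proof.
move=> cphi; have [M HM] := continuous_rect_bounded D cphi.
apply: (@L2_mrestr_bounded _ _ plane _ _ _ phi M); first exact: open_rect_lty.
  exact: continuous_plane_measurable.
by move=> p [p1 p2]; apply: HM; split; exact: subset_itv_oo_cc.
Qed.

Lemma arclen_lty D : proper_rect D -> (arclen D setT < +oo)%E.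
Proof.
move=> [xD yD]; have := @arclen_integral R D (cst 1%E) (measurable_cst _) (fun _ => lee01) xD yD.
rewrite /cst /= integral_cst// mul1e => ->.
rewrite !integral_cst// !mul1e !segment_measureT ?ltW//.
by rewrite -!EFinD ltry.
Qed.

Lemma L2_arclen D phi : proper_rect D -> continuous phi -> L2 (arclen D) phi.
Proof.
move=> pD cphi; have [M HM] := continuous_rect_bounded D cphi.
apply: (@L2_mrestr_bounded _ _ plane _ _ _ phi M).
- by have := arclen_lty pD; rewrite /arclen {1}/mrestr /= /mrestr setTI.
- exact: continuous_plane_measurable.
- exact: HM.
Qed.

Lemma test2_out D psi p : test2 D psi -> ~ open_rect D p -> psi p = 0.
Proof.
move=> [_ _ psiD] pD; apply/eqP; apply: contrapT => /negP pn0.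
by apply/pD/psiD/subset_closure.
Qed.

(** On each line of direction [i] the sum of the two integrands is the derivative of [phi * psi],
    which vanishes at both ends because [psi] does; Fubini's theorem concludes. *)
Lemma partial_ibp D i phi psi : proper_rect D -> smooth2 phi -> test2 D psi ->
  \int[area D]_p (phi p * partial i psi p) =
  - \int[area D]_p (partial i phi p * psi p).
Proof.
move=> [xD yD] sphi tpsi; have [spsi _ _] := tpsi.
have Lphi := L2_area D (smooth2_continuous sphi).
have Lpsi := L2_area D (smooth2_continuous spsi).
have Ldphi := L2_area D (partial_continuous (i := i) sphi).
have Ldpsi := L2_area D (partial_continuous (i := i) spsi).
apply/eqP; rewrite -addr_eq0 -RintegralD//; last 2 first.
- exact: L2_mul_integrable.
- exact: L2_mul_integrable.
apply/eqP; rewrite /Rintegral (_ : integral _ _ _ = 0%E)//.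
have int : (area D).-integrable setT
    (fun p => (phi p * partial i psi p + partial i phi p * psi p)%:E).
  exact: (integrableD measurableT (L2_mul_integrable Lphi Ldpsi) (L2_mul_integrable Ldphi Lpsi)).
have cont : continuous (fun p => phi p * partial i psi p + partial i phi p * psi p).
  have c1 := smooth2_continuous sphi; have c2 := smooth2_continuous spsi.
  have c3 := partial_continuous (i := i) sphi.
  have c4 := partial_continuous (i := i) spsi.
  move=> p; apply: cvgD; apply: cvgM; [exact: c1|exact: c4|exact: c3|exact: c2].
have [i0|i0] := eqVneq i 0.
  rewrite area_fubini2//; apply: integral0_eq => y _.
  have ci := segment_integrable (x_lo D) (x_hi D) (continuous_line1 (y := y) cont).
  rewrite -[LHS]fineK; last exact: (integrable_fin_num _ ci).
  congr EFin; apply: (@segment_integral_deriv_eq0 R (fun x => phi (x, y) * psi (x, y))) => //.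
  - move=> x; rewrite i0.
    apply: is_derive_eq (is_deriveM (smooth2_is_derive_fst x y sphi) (smooth2_is_derive_fst x y spsi)) _.
    by rewrite !scaleRE; ring.
  - exact: (continuous_line1 (y := y) cont).
  - by rewrite (test2_out tpsi) ?mulr0// => -[/=]; rewrite in_itv/= ltxx.
  - by rewrite (test2_out tpsi) ?mulr0// => -[/=]; rewrite in_itv/= ltxx andbF.
have i1 : i = 1 by exact: ord2_neq0.
rewrite area_fubini1//; apply: integral0_eq => x _.
have ci := segment_integrable (y_lo D) (y_hi D) (continuous_line2 (x := x) cont).
rewrite -[LHS]fineK; last exact: (integrable_fin_num _ ci).
congr EFin; apply: (@segment_integral_deriv_eq0 R (fun y => phi (x, y) * psi (x, y))) => //.
- move=> y; rewrite i1.
  apply: is_derive_eq (is_deriveM (smooth2_is_derive_snd x y sphi) (smooth2_is_derive_snd x y spsi)) _.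
  by rewrite !scaleRE; ring.
- exact: (continuous_line2 (x := x) cont).
- by rewrite (test2_out tpsi) ?mulr0// => -[/=] _; rewrite in_itv/= ltxx.
- by rewrite (test2_out tpsi) ?mulr0// => -[/=] _; rewrite in_itv/= ltxx andbF.
Qed.

Lemma smooth2_weak_partial D i phi : proper_rect D -> smooth2 phi ->
  is_weak_partial D i phi (partial i phi).
Proof.
move=> pD sphi; split; first exact/L2_area/partial_continuous.
by move=> psi tpsi; exact: partial_ibp.
Qed.

End smooth_plane.

(** The arithmetic of the Poincare inequality. [S] stands for the squared norm on the piece of side,
    [A] and [T] for those on the strip and on the rectangle, [GJ] and [G0] for the horizontal
    derivative on the strip and on the rectangle, [G1] for the vertical one. *)
Lemma poincare_arith (R : realType) (h w k S G0 G1 GJ A T : R) :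
  0 <= h -> 0 <= w -> 0 <= k ->
  1 * A <= 2 * w * S + 2 * w ^+ 2 * GJ -> GJ <= G0 ->
  k * T <= 2 * h * A + 2 * h ^+ 2 * k * G1 -> 0 <= S -> 0 <= G0 -> 0 <= G1 ->
  k * T <= (4 * h * w + 4 * h * w ^+ 2 + 2 * h ^+ 2 * k) * (S + (G0 + G1)).
Proof.
move=> h0 w0 k0 step1 mono step2 a0 a1 a2; apply: le_trans step2 _.
have k1 : 0 <= 4 * h * w by rewrite !mulr_ge0.
have k2 : 0 <= 4 * h * w ^+ 2 by rewrite !mulr_ge0 ?sqr_ge0.
have k3 : 0 <= 2 * h ^+ 2 * k by rewrite !mulr_ge0 ?sqr_ge0.
have h2 : 0 <= 2 * h by rewrite mulr_ge0.
have s1 : 2 * h * A <= 4 * h * w * S + 4 * h * w ^+ 2 * GJ.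
  rewrite mul1r in step1; apply: le_trans (ler_wpM2l h2 step1) _.
  by rewrite le_eqVlt; apply/orP; left; apply/eqP; ring.
have s2 := ler_wpM2l k2 mono; move: s1 s2 k1 k2 k3.
move: (4 * h * w) (4 * h * w ^+ 2) (2 * h ^+ 2 * k) (2 * h * A).
move=> c1 c2 c3 Z s1 s2 k1 k2 k3.
have e1 := mulr_ge0 k1 (addr_ge0 a1 a2); have e2 := mulr_ge0 k2 (addr_ge0 a0 a2).
have e3 := mulr_ge0 k3 (addr_ge0 a0 a1).
clear - s1 s2 e1 e2 e3; lra.
Qed.

Lemma lee3_congr (R : realType) (x y z a b c a' b' c' : \bar R) :
  a = a' -> b = b' -> c = c' -> (x * a' <= y * b' + z * c')%E ->
  (x * a <= y * b + z * c)%E.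
Proof. by move=> -> -> ->. Qed.

(** Integrates a one-dimensional inequality over the other variable; with extended values no
    integrability of the partial integrals has to be shown. *)
Lemma ge0_integral_le3 d (T : measurableType d) (R : realType)
    (mu : {measure set T -> \bar R}) (f g h : T -> \bar R) (a b c : R) :
  0 <= a -> 0 <= b -> 0 <= c ->
  measurable_fun setT f -> measurable_fun setT g -> measurable_fun setT h ->
  (forall x, 0 <= f x)%E -> (forall x, 0 <= g x)%E -> (forall x, 0 <= h x)%E ->
  (forall x, a%:E * f x <= b%:E * g x + c%:E * h x)%E ->
  (a%:E * \int[mu]_x f x <= b%:E * \int[mu]_x g x + c%:E * \int[mu]_x h x)%E.
Proof.
move=> a0 b0 c0 mf mg mh f0 g0 h0 H.
have mZ (k : R) (u : T -> \bar R) : measurable_fun setT u -> measurable_fun setT (fun x => k%:E * u x)%E.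
  by move=> mu'; exact: measurable_funeM.
have Z0 (k : R) (u : T -> \bar R) : 0 <= k -> (forall x, 0 <= u x)%E ->
    forall x, setT x -> (0 <= k%:E * u x)%E.
  by move=> k0 u0 x _; apply: mule_ge0; rewrite ?lee_fin.
have EZ (k : R) (u : T -> \bar R) : 0 <= k -> (forall x, 0 <= u x)%E ->
    measurable_fun setT u -> (k%:E * \int[mu]_x u x = \int[mu]_x (k%:E * u x))%E.
  by move=> k0 u0 mu'; rewrite ge0_integralZl.
rewrite !EZ// -ge0_integralD//; [|exact: Z0|exact: mZ|exact: Z0|exact: mZ].
apply: ge0_le_integral => //; [exact: Z0|exact: mZ|].
by apply: emeasurable_funD; exact: mZ.
Qed.

(** * Trace and Poincare inequalities for smooth functions on a rectangle *)

Section plane_inequalities.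
Context (R : realType).
Implicit Types (D : rectangle R) (phi : R * R -> R).
Local Notation leb := (@lebesgue_measure R).
Local Notation line := (measurableTypeR R).
Local Notation plane := (line * line)%type.
Local Notation segx D := (segment_measure (x_lo D) (x_hi D)).
Local Notation segy D := (segment_measure (y_lo D) (y_hi D)).
Local Notation sq mu f := (ip mu f f).
Local Notation seg a b := (@mfrestr _ line R _ leb (measurable_itv `]a, b[) (oitv_lty a b)).

Let msq phi : continuous phi -> measurable_fun setT ((fun p => (phi p * phi p)%:E) : plane -> \bar R).
Proof.
move=> cphi; apply/measurable_EFinP; apply: measurable_funM;
  exact: continuous_plane_measurable.
Qed.

Let sq0 phi p : (0 <= (phi p * phi p)%:E)%E.
Proof. by rewrite lee_fin -expr2 sqr_ge0. Qed.

Lemma sq_area1 D phi : continuous phi ->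
  ((sq (area D) phi)%:E = \int[segx D]_x (sq (segy D) (fun y => phi (x, y)))%:E)%E.
Proof.
move=> cphi; rewrite (ip_EFin (L2_area D cphi)) area_tonelli1//; last exact: msq.
apply: eq_integral => x _; rewrite (ip_EFin (L2_segment _ _ (continuous_line2 (x := x) cphi)))//.
Qed.

Lemma sq_area2 D phi : continuous phi ->
  ((sq (area D) phi)%:E = \int[segy D]_y (sq (segx D) (fun x => phi (x, y)))%:E)%E.
Proof.
move=> cphi; rewrite (ip_EFin (L2_area D cphi)) area_tonelli2//; last exact: msq.
apply: eq_integral => y _; rewrite (ip_EFin (L2_segment _ _ (continuous_line1 (y := y) cphi)))//.
Qed.

Lemma sq_line2_measurable a b phi : continuous phi ->
  measurable_fun setT (fun x : line => (sq (segment_measure a b) (fun y => phi (x, y)))%:E).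
Proof.
move=> cphi; apply: (eq_measurable_fun (fubini_F (seg a b) (fun p => (phi p * phi p)%:E))).
  by move=> x _; rewrite (ip_EFin (L2_segment _ _ (continuous_line2 (x := x) cphi))).
by apply: measurable_fun_fubini_tonelli_F => //; exact: msq.
Qed.

Lemma sq_line1_measurable a b phi : continuous phi ->
  measurable_fun setT (fun y : line => (sq (segment_measure a b) (fun x => phi (x, y)))%:E).
Proof.
move=> cphi; apply: (eq_measurable_fun (fubini_G (seg a b) (fun p => (phi p * phi p)%:E))).
  by move=> y _; rewrite (ip_EFin (L2_segment _ _ (continuous_line1 (y := y) cphi))).
by apply: measurable_fun_fubini_tonelli_G => //; exact: msq.
Qed.

Let sqE0 d (T : measurableType d) (mu : {measure set T -> \bar R}) (f : T -> R) :
  (0 <= (sq mu f)%:E)%E.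
Proof. by rewrite lee_fin ip_ge0. Qed.

Let msqc (f : R -> R) : continuous f -> measurable_fun setT ((fun x => (f x * f x)%:E) : line -> \bar R).
Proof.
move=> cf; apply/measurable_EFinP; apply: measurable_funM; exact: continuous_measurable_fun.
Qed.

Lemma side_y_le D phi c : proper_rect D -> smooth2 phi -> c \in `[y_lo D, y_hi D] ->
  (y_hi D - y_lo D) * sq (segx D) (fun x => phi (x, c)) <=
  2 * sq (area D) phi + 2 * (y_hi D - y_lo D) ^+ 2 * sq (area D) (partial 1 phi).
Proof.
move=> [xD yD] sphi cD; set h := _ - _.
have h0 : 0 <= h by rewrite subr_ge0 ltW.
have c0 := smooth2_continuous sphi; have c1 := partial_continuous (i := 1) sphi.
rewrite -lee_fin EFinD 3!EFinM.
rewrite (ip_EFin (L2_segment _ _ (continuous_line1 (y := c) c0))) !sq_area1//.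
apply: ge0_integral_le3 => //.
- by rewrite mulr_ge0// sqr_ge0.
- by apply: msqc; exact: continuous_line1.
- exact: sq_line2_measurable.
- exact: sq_line2_measurable.
move=> x; rewrite -!EFinM -EFinD lee_fin -expr2.
have := C1_point_le (fun y => smooth2_is_derive_snd x y sphi) (continuous_line2 (x := x) c1) yD (lexx _) (lexx _) cD.
by move=> /le_trans; apply; rewrite le_eqVlt; apply/orP; left; apply/eqP; rewrite /h; ring.
Qed.

Lemma side_x_le D phi c : proper_rect D -> smooth2 phi -> c \in `[x_lo D, x_hi D] ->
  (x_hi D - x_lo D) * sq (segy D) (fun y => phi (c, y)) <=
  2 * sq (area D) phi + 2 * (x_hi D - x_lo D) ^+ 2 * sq (area D) (partial 0 phi).
Proof.
move=> [xD yD] sphi cD; set w := _ - _.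
have w0 : 0 <= w by rewrite subr_ge0 ltW.
have c0 := smooth2_continuous sphi; have c1 := partial_continuous (i := 0) sphi.
rewrite -lee_fin EFinD 3!EFinM.
rewrite (ip_EFin (L2_segment _ _ (continuous_line2 (x := c) c0))) !sq_area2//.
apply: ge0_integral_le3 => //.
- by rewrite mulr_ge0// sqr_ge0.
- by apply: msqc; exact: continuous_line2.
- exact: sq_line1_measurable.
- exact: sq_line1_measurable.
move=> y; rewrite -!EFinM -EFinD lee_fin -expr2.
have := C1_point_le (fun x => smooth2_is_derive_fst x y sphi) (continuous_line1 (y := y) c1) xD (lexx _) (lexx _) cD.
by move=> /le_trans; apply; rewrite le_eqVlt; apply/orP; left; apply/eqP; rewrite /w; ring.
Qed.

Definition gradsq D (G : 'I_2 -> R * R -> R) := \sum_(i < 2) sq (area D) (G i).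

Lemma gradsqE D G : gradsq D G = sq (area D) (G 0) + sq (area D) (G 1).
Proof.
rewrite /gradsq !big_ord_recl big_ord0 addr0.
by have -> : lift ord0 ord0 = 1 :> 'I_2 by exact: val_inj.
Qed.

Lemma gradsq_ge0 D G : 0 <= gradsq D G.
Proof. by apply: sumr_ge0 => i _; exact: ip_ge0. Qed.

Lemma sq_arclen D phi : proper_rect D -> L2 (arclen D) phi ->
  ((sq (arclen D) phi)%:E =
    (\int[segx D]_x (phi (x, y_lo D) * phi (x, y_lo D))%:E +
     \int[segx D]_x (phi (x, y_hi D) * phi (x, y_hi D))%:E) +
    (\int[segy D]_y (phi (x_lo D, y) * phi (x_lo D, y))%:E +
     \int[segy D]_y (phi (x_hi D, y) * phi (x_hi D, y))%:E))%E.
Proof.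
move=> [xD yD] Lphi; rewrite ip_EFin// arclen_integral//.
by apply/measurable_EFinP; apply: measurable_funM; exact: L2_measurable Lphi.
Qed.

Lemma smooth2_trace_le D : proper_rect D -> exists2 K, 0 <= K &
  forall phi, smooth2 phi ->
    sq (arclen D) phi <= K * (sq (area D) phi + gradsq D (fun i => partial i phi)).
Proof.
move=> pD; have [xD yD] := pD.
pose w := x_hi D - x_lo D; pose h := y_hi D - y_lo D.
have w0 : 0 < w by rewrite subr_gt0.
have h0 : 0 < h by rewrite subr_gt0.
(* [side_y_le] divided by [h] bounds each of the two horizontal sides, [side_x_le] divided by [w]
   each of the two vertical ones. *)
exists (2 * (2 * h^-1 + 2 * h) + 2 * (2 * w^-1 + 2 * w)).
  by rewrite addr_ge0// mulr_ge0// addr_ge0// mulr_ge0// ?invr_ge0 ltW.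
move=> phi sphi; have c0 := smooth2_continuous sphi.
rewrite -lee_fin sq_arclen//; last exact: L2_arclen.
have Ex y : (\int[segx D]_x (phi (x, y) * phi (x, y))%:E)%E = (sq (segx D) (fun x => phi (x, y)))%:E.
  by rewrite (ip_EFin (L2_segment _ _ (continuous_line1 (y := y) c0))).
have Ey x : (\int[segy D]_y (phi (x, y) * phi (x, y))%:E)%E = (sq (segy D) (fun y => phi (x, y)))%:E.
  by rewrite (ip_EFin (L2_segment _ _ (continuous_line2 (x := x) c0))).
rewrite !Ex !Ey -!EFinD lee_fin gradsqE.
have side (k N u v z : R) : 0 < k -> 0 <= u -> 0 <= v -> 0 <= z ->
    k * N <= 2 * u + 2 * k ^+ 2 * v -> N <= (2 * k^-1 + 2 * k) * (u + (v + z)).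
  move=> k0 u0 v0 z0 H; rewrite -(ler_pM2l k0); apply: le_trans H _.
  have -> : k * ((2 * k^-1 + 2 * k) * (u + (v + z))) = (2 + 2 * k ^+ 2) * (u + (v + z)).
    by field; rewrite gt_eqF.
  have := sqr_ge0 k; nra.
have a0 := ip_ge0 (area D) phi.
have a1 := ip_ge0 (area D) (partial 0 phi).
have a2 := ip_ge0 (area D) (partial 1 phi).
have s1 := side _ _ _ _ _ h0 a0 a2 a1 (side_y_le pD sphi (c := y_lo D) ltac:(by rewrite in_itv/= lexx ltW)).
have s2 := side _ _ _ _ _ h0 a0 a2 a1 (side_y_le pD sphi (c := y_hi D) ltac:(by rewrite in_itv/= lexx ltW)).
have s3 := side _ _ _ _ _ w0 a0 a1 a2 (side_x_le pD sphi (c := x_lo D) ltac:(by rewrite in_itv/= lexx ltW)).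
have s4 := side _ _ _ _ _ w0 a0 a1 a2 (side_x_le pD sphi (c := x_hi D) ltac:(by rewrite in_itv/= lexx ltW)).
rewrite [sq (area D) (partial 1 phi) + _]addrC in s1 s2.
set kx := 2 * h^-1 + 2 * h in s1 s2 *; set ky := 2 * w^-1 + 2 * w in s3 s4 *.
rewrite mulrDl -(mulrA 2 kx) -(mulrA 2 ky) !(mulr_natl (_ * _)) !mulr2n.
by apply: lerD; exact: lerD.
Qed.

Lemma sq_area_mono D D' phi : continuous phi -> open_rect D' `<=` open_rect D ->
  sq (area D') phi <= sq (area D) phi.
Proof.
move=> cphi DD'; have E D0 : ((sq (area D0) phi)%:E =
    \int[(leb \x leb)%E]_(p in open_rect D0) (phi p * phi p)%:E)%E.
  rewrite (ip_EFin (L2_area D0 cphi)).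
  exact: (@ge0_mrestr_integral R _ plane (leb \x leb)%E (open_rect D0) (measurable_open_rect D0) _ (msq cphi) (sq0 phi)).
rewrite -lee_fin [X in (X <= _)%E](E D') [X in (_ <= X)%E](E D).
apply: ge0_subset_integral.
- exact: measurable_open_rect.
- exact: measurable_open_rect.
- by apply: measurable_funTS; exact: msq.
- by move=> p _; exact: sq0.
- exact: DD'.
Qed.

(* Integrate horizontally from the segment on the left side to the strip it
   spans, then vertically from this strip to the whole rectangle. *)
Lemma smooth2_poincare D p q : proper_rect D -> p < q -> y_lo D <= p -> q <= y_hi D ->
  exists2 K, 0 <= K & forall phi, smooth2 phi ->
    sq (area D) phi <= K * (sq (segment_measure p q) (fun y => phi (x_lo D, y)) +
      gradsq D (fun i => partial i phi)).
Proof.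
move=> pD pq yp qy; have [xD yD] := pD.
pose w := x_hi D - x_lo D; pose h := y_hi D - y_lo D.
have w0 : 0 < w by rewrite subr_gt0.
have h0 : 0 < h by rewrite subr_gt0.
have pq0 : 0 < q - p by rewrite subr_gt0.
(* The constant of [poincare_arith], with [k] the height [q - p] of the strip. *)
pose K := 4 * h * w + 4 * h * w ^+ 2 + 2 * h ^+ 2 * (q - p).
have k1 : 0 <= 4 * h * w by rewrite !mulr_ge0// ltW.
have k2 : 0 <= 4 * h * w ^+ 2 by rewrite !mulr_ge0 ?sqr_ge0// ltW.
have k3 : 0 <= 2 * h ^+ 2 * (q - p) by rewrite !mulr_ge0 ?sqr_ge0// ltW.
exists ((q - p)^-1 * K); first by rewrite mulr_ge0 ?invr_ge0 ?(ltW pq0)//; rewrite /K; lra.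
move=> phi sphi; pose J := Rectangle (x_lo D) (x_hi D) p q.
have c0 := smooth2_continuous sphi; have c1 := partial_continuous (i := 1) sphi.
have cx := partial_continuous (i := 0) sphi.
have step1 : 1 * sq (area J) phi <= 2 * w * sq (segment_measure p q) (fun y => phi (x_lo D, y)) +
    2 * w ^+ 2 * sq (area J) (partial 0 phi).
  rewrite -lee_fin EFinD (EFinM 1) (EFinM (2 * w)) (EFinM (2 * w ^+ 2)).
  rewrite (ip_EFin (L2_segment _ _ (continuous_line2 (x := x_lo D) c0))) !sq_area2//.
  apply: ge0_integral_le3 => //.
  - by rewrite mulr_ge0// ltW.
  - by rewrite mulr_ge0// sqr_ge0.
  - exact: sq_line1_measurable.
  - by apply: msqc; exact: continuous_line2.
  - exact: sq_line1_measurable.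
  move=> y; rewrite -!EFinM -EFinD lee_fin mul1r -expr2.
  apply: (C1_poincare (fun x => smooth2_is_derive_fst x y sphi) (continuous_line1 (y := y) cx) xD).
  by rewrite in_itv/= lexx ltW.
have step2 : (q - p) * sq (area D) phi <= 2 * h * sq (area J) phi +
    2 * h ^+ 2 * (q - p) * sq (area D) (partial 1 phi).
  suff : ((q - p)%:E * (sq (area D) phi)%:E <= (2 * h)%:E * (sq (area J) phi)%:E +
      (2 * h ^+ 2 * (q - p))%:E * (sq (area D) (partial 1 phi))%:E)%E.
    by rewrite -!EFinM -EFinD lee_fin.
  apply: (lee3_congr (sq_area1 D c0) (sq_area1 J c0) (sq_area1 D c1)).
  apply: (@ge0_integral_le3 _ _ _ _ _ _ _ (q - p) (2 * h) (2 * h ^+ 2 * (q - p))) => //.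
  - exact: ltW.
  - by rewrite mulr_ge0// ltW.
  - exact: sq_line2_measurable.
  - exact: sq_line2_measurable.
  - exact: sq_line2_measurable.
  move=> x; rewrite -!EFinM -EFinD lee_fin.
  exact: (C1_average_le (fun y => smooth2_is_derive_snd x y sphi) (continuous_line2 (x := x) c1) pq yp qy).
have mono : sq (area J) (partial 0 phi) <= sq (area D) (partial 0 phi).
  apply: sq_area_mono => // z [z1 z2]; split => //.
  move: z2; rewrite /= !in_itv/= => /andP[pz zq].
  by rewrite (le_lt_trans yp pz) (lt_le_trans zq qy).
rewrite gradsqE -mulrA -(ler_pM2l pq0) [X in _ <= X]mulrA divff ?gt_eqF// mul1r.
exact: (poincare_arith (ltW h0) (ltW w0) (ltW pq0) step1 mono step2
  (ip_ge0 _ _) (ip_ge0 _ _) (ip_ge0 _ _)).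
Qed.

End plane_inequalities.

(** * Sobolev spaces on a rectangle *)

(** The passage from smooth functions to their limits: [a] collects the approximation errors. *)
Lemma cvg0_const_le (R : realType) (a : nat -> R) (x y : R) :
  a n @[n --> \oo] --> 0 -> (forall n, x <= a n + y) -> x <= y.
Proof.
move=> a0 H; have : a n + y @[n --> \oo] --> 0 + y by apply: cvgD => //; exact: cvg_cst.
by rewrite add0r => /cvgr_to_ge; apply; exact: nearW.
Qed.

Lemma sq_sym d (T : measurableType d) (R : realType) (mu : {measure set T -> \bar R})
  (f g : T -> R) : ip mu (f \- g) (f \- g) = ip mu (g \- f) (g \- f).
Proof. by apply: eq_Rintegral => x _ /=; ring. Qed.

Section sobolev_rectangle.
Context (R : realType).
Variable D : rectangle R.
Hypothesis pD : proper_rect D.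
Implicit Types (u v g : R * R -> R) (G H : 'I_2 -> R * R -> R).
Local Notation sq mu f := (ip mu f f).

Lemma test2_L2 phi : test2 D phi -> L2 (area D) phi.
Proof. by move=> [sphi _ _]; exact/L2_area/smooth2_continuous. Qed.

Lemma test2_partial_L2 (i : 'I_2) phi : test2 D phi -> L2 (area D) (partial i phi).
Proof. by move=> [sphi _ _]; exact/L2_area/partial_continuous. Qed.

(** The gradient is explicit data, so that it can be combined linearly; the representatives chosen
    by [weak_partial] can be only almost everywhere. *)
Definition is_grad u G := L2 (area D) u /\ forall i, is_weak_partial D i u (G i).

Lemma is_grad_L2 u G i : is_grad u G -> L2 (area D) (G i).
Proof. by move=> [_ /(_ i)[]]. Qed.

Lemma is_grad_lin t u v G H : is_grad u G -> is_grad v H ->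
  is_grad (fun p => t * u p + v p) (fun i p => t * G i p + H i p).
Proof.
move=> [Lu uG] [Lv vH]; split; first exact: L2_lin.
move=> i; exact: (@weakd_lin _ _ _ (area D) (test2 D) (partial i) test2_L2
  (test2_partial_L2 i) t u v (G i) (H i) Lu Lv (uG i) (vH i)).
Qed.

Lemma is_gradB u v G H : is_grad u G -> is_grad v H ->
  is_grad (u \- v) (fun i => G i \- H i).
Proof.
move=> uG vH; have := is_grad_lin (-1) vH uG; congr is_grad.
  by apply/funext => p /=; ring.
by apply/funext => i; apply/funext => p /=; ring.
Qed.

Lemma is_grad_uniq u G H i : is_grad u G -> is_grad u H ->
  ae_eq (area D) setT (G i) (H i).
Proof.
move=> [Lu uG] [_ uH]; exact: (@weakd_uniq _ _ _ (area D) (test2 D) (partial i) test2_L2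
  (@area_du_bois_reymond R D) u (G i) (H i) (uG i) (uH i)).
Qed.

Lemma H1_is_grad u : H1 D u -> is_grad u (fun i => weak_partial D i u).
Proof. by move=> [Lu uG]; split => // i; exact: xgetPex (uG i). Qed.

Lemma is_grad_H1 u G : is_grad u G -> H1 D u.
Proof. by move=> [Lu uG]; split => // i; exists (G i). Qed.

Lemma is_grad_weak_partial u G i : is_grad u G ->
  ae_eq (area D) setT (weak_partial D i u) (G i).
Proof.
by move=> uG; apply: (is_grad_uniq i (H1_is_grad (is_grad_H1 uG)) uG).
Qed.

Lemma smooth2_is_grad phi : smooth2 phi -> is_grad phi (fun i => partial i phi).
Proof.
move=> sphi; split; first exact/L2_area/smooth2_continuous.
by move=> i; exact: smooth2_weak_partial.
Qed.

Definition h1sq u G := sq (area D) u + gradsq D G.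

Lemma h1sq_ge0 u G : 0 <= h1sq u G.
Proof. by rewrite addr_ge0 ?ip_ge0 ?gradsq_ge0. Qed.

Lemma H1norm_ge0 u : 0 <= H1norm D u.
Proof. exact: sqrtr_ge0. Qed.

Lemma H1norm_sqr u G : is_grad u G -> H1norm D u ^+ 2 = h1sq u G.
Proof.
move=> uG; rewrite /H1norm sqr_sqrtr; last first.
  by rewrite addr_ge0 ?sqr_ge0//; apply: sumr_ge0 => i _; exact: sqr_ge0.
rewrite L2norm_sqr; congr (_ + _); apply: eq_bigr => i _; rewrite L2norm_sqr.
have LG := is_grad_L2 i uG; have LW := is_grad_L2 i (H1_is_grad (is_grad_H1 uG)).
by apply: ae_eq_ip => //; exact: is_grad_weak_partial.
Qed.

Lemma gradsq_le2 u v G H : is_grad u G -> is_grad v H ->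
  gradsq D G <= 2 * gradsq D (fun i => G i \- H i) + 2 * gradsq D H.
Proof.
move=> uG vH; rewrite /gradsq !mulr_sumr -big_split; apply: ler_sum => i _.
by apply: ip_le2; [exact: is_grad_L2 uG|exact: is_grad_L2 vH].
Qed.

Lemma h1sq_le2 u v G H : is_grad u G -> is_grad v H ->
  h1sq u G <= 2 * h1sq (u \- v) (fun i => G i \- H i) + 2 * h1sq v H.
Proof.
move=> uG vH; have := gradsq_le2 uG vH; have := ip_le2 uG.1 vH.1.
by rewrite /h1sq; lra.
Qed.

Lemma h1sq_triangle u v w G H W : is_grad u G -> is_grad v H -> is_grad w W ->
  h1sq (u \- w) (fun i => G i \- W i) <=
  2 * h1sq (u \- v) (fun i => G i \- H i) + 2 * h1sq (w \- v) (fun i => W i \- H i).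
Proof.
move=> uG vH wW; rewrite /h1sq /gradsq !mulrDr !mulr_sumr addrACA -big_split/=.
apply: lerD; first by apply: ip_triangle; [exact: uG.1|exact: vH.1|exact: wW.1].
apply: ler_sum => i _.
by apply: ip_triangle; [exact: is_grad_L2 uG|exact: is_grad_L2 vH|exact: is_grad_L2 wW].
Qed.

(** Replaces norms built on chosen derivatives by squared norms in any gradient of [u], which can be
    expanded algebraically. *)
Lemma is_traceP u G g : is_grad u G ->
  is_trace D u g <-> L2 (arclen D) g /\ exists phi : nat -> R * R -> R,
    [/\ forall n, smooth2 (phi n),
        h1sq (phi n \- u) (fun i => partial i (phi n) \- G i) @[n --> \oo] --> 0 &
        sq (arclen D) (phi n \- g) @[n --> \oo] --> 0].
Proof.
move=> uG.
have E phi : smooth2 phi -> H1norm D (phi \- u) ^+ 2 =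
    h1sq (phi \- u) (fun i => partial i phi \- G i).
  by move=> sphi; exact: H1norm_sqr (is_gradB (smooth2_is_grad sphi) uG).
split=> -[Lg [phi [sphi phiu phig]]]; split=> //; exists phi; split=> //.
- by move/cvg0_squares : phiu; under eq_fun do rewrite E//.
- by move/cvg0_squares : phig; under eq_fun do rewrite L2norm_sqr.
- by apply/cvg0_squares; under eq_fun do rewrite E//.
- by apply/cvg0_squares; under eq_fun do rewrite L2norm_sqr.
Qed.

Lemma is_trace_lin t u v G H g h : is_grad u G -> is_grad v H ->
  is_trace D u g -> is_trace D v h ->
  is_trace D (fun p => t * u p + v p) (fun p => t * g p + h p).
Proof.
move=> uG vH /(is_traceP _ uG)[Lg [phi [sphi phiu phig]]].
move=> /(is_traceP _ vH)[Lh [psi [spsi psiv psih]]].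
apply/(is_traceP _ (is_grad_lin t uG vH)); split; first exact: L2_lin.
exists (fun n p => t * phi n p + psi n p); split.
- by move=> n; exact: smooth2_lin.
- pose b n := 2 * t ^+ 2 * h1sq (phi n \- u) (fun i => partial i (phi n) \- G i) +
    2 * h1sq (psi n \- v) (fun i => partial i (psi n) \- H i).
  have b0 : b n @[n --> \oo] --> 0.
    rewrite -[0](addr0 (0 : R)) -{1}(mulr0 (2 * t ^+ 2)) -{2}(mulr0 2).
    by apply: cvgD; apply: cvgMr.
  apply: cvg0_le b0 => n; rewrite h1sq_ge0/= /b.
  have A := is_gradB (smooth2_is_grad (sphi n)) uG.
  have B := is_gradB (smooth2_is_grad (spsi n)) vH.
  have key (d : measure_display) (T : measurableType d) (mu : {measure set T -> \bar R})
      (f f' k : T -> R) : L2 mu f -> L2 mu f' -> (forall x, k x = t * f x + f' x) ->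
      sq mu k <= 2 * t ^+ 2 * sq mu f + 2 * sq mu f'.
    move=> Lf Lf' Ek; rewrite (_ : k = fun x => t * f x + f' x); last exact/funext.
    have := ip_ge0 mu (fun x => - t * f x + f' x).
    by rewrite !ip_expand//; lra.
  have E0 := key _ _ (area D) _ _
    ((fun p => t * phi n p + psi n p) \- (fun p => t * u p + v p)) A.1 B.1
    ltac:(by move=> p /=; ring).
  have E1 : gradsq D (fun i => partial i (fun p => t * phi n p + psi n p) \-
        (fun p => t * G i p + H i p)) <=
      2 * t ^+ 2 * gradsq D (fun i => partial i (phi n) \- G i) +
      2 * gradsq D (fun i => partial i (psi n) \- H i).
    rewrite /gradsq !mulr_sumr -big_split; apply: ler_sum => i _.
    apply: key; [exact: is_grad_L2 A|exact: is_grad_L2 B|].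
    by move=> p /=; rewrite partial_lin//; ring.
  by rewrite /h1sq; lra.
- pose b n := 2 * t ^+ 2 * sq (arclen D) (phi n \- g) + 2 * sq (arclen D) (psi n \- h).
  have b0 : b n @[n --> \oo] --> 0.
    rewrite -[0](addr0 (0 : R)) -{1}(mulr0 (2 * t ^+ 2)) -{2}(mulr0 2).
    by apply: cvgD; apply: cvgMr.
  apply: cvg0_le b0 => n; rewrite ip_ge0/= /b.
  have L1 := L2_B (L2_arclen pD (smooth2_continuous (sphi n))) Lg.
  have L2' := L2_B (L2_arclen pD (smooth2_continuous (spsi n))) Lh.
  rewrite (_ : _ \- _ = fun x => t * (phi n \- g) x + (psi n \- h) x); last first.
    by apply/funext => p /=; ring.
  have := ip_ge0 (arclen D) (fun x => - t * (phi n \- g) x + (psi n \- h) x).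
  by rewrite !ip_expand//; lra.
Qed.

Lemma trace_le : exists2 K, 0 <= K & forall u G g, is_grad u G -> is_trace D u g ->
  sq (arclen D) g <= K * h1sq u G.
Proof.
have [K K0 HK] := smooth2_trace_le pD.
(* The inequality for the smooth [phi n], with one factor 2 for replacing the trace by that of
   [phi n] and another for returning to the norm of [u]. *)
exists (4 * K); first by rewrite mulr_ge0.
move=> u G g uG /(is_traceP _ uG)[Lg [phi [sphi phiu phig]]].
pose b n := 2 * sq (arclen D) (phi n \- g) +
  4 * K * h1sq (phi n \- u) (fun i => partial i (phi n) \- G i).
have b0 : b n @[n --> \oo] --> 0.
  rewrite -[0](addr0 (0 : R)) -{1}(mulr0 2) -{2}(mulr0 (4 * K)).
  by apply: cvgD; apply: cvgMr.
apply: (cvg0_const_le b0) => n; rewrite /b.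
have L1 := L2_arclen pD (smooth2_continuous (sphi n)).
have e1 := ip_le2 Lg L1; rewrite sq_sym in e1.
have e2 := HK _ (sphi n); rewrite -/(h1sq _ _) in e2.
have e3 := ler_wpM2l K0 (h1sq_le2 (smooth2_is_grad (sphi n)) uG).
apply: le_trans e1 _.
apply: le_trans (lerD (lexx _) (ler_wpM2l (ler0n R 2) (le_trans e2 e3))) _.
by rewrite le_eqVlt; apply/orP; left; apply/eqP; ring.
Qed.

End sobolev_rectangle.

Lemma ae_imp d (T : measurableType d) (R : realType) (mu : {measure set T -> \bar R})
    (P Q : T -> Prop) : (forall x, P x -> Q x) ->
  {ae mu, forall x, P x} -> {ae mu, forall x, Q x}.
Proof. by move=> PQ; apply: filterS. Qed.

Lemma ae_imp2 d (T : measurableType d) (R : realType) (mu : {measure set T -> \bar R})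
    (P Q S : T -> Prop) : (forall x, P x -> Q x -> S x) ->
  {ae mu, forall x, P x} -> {ae mu, forall x, Q x} -> {ae mu, forall x, S x}.
Proof. by move=> PQS; apply: filterS2. Qed.

(** * Uniqueness of traces and functions vanishing on part of the boundary *)

Section trace_space.
Context (R : realType).
Variable D : rectangle R.
Hypothesis pD : proper_rect D.
Implicit Types (u v g h : R * R -> R) (G H : 'I_2 -> R * R -> R) (Gam : set (R * R)).
Local Notation line := (measurableTypeR R).
Local Notation plane := (line * line)%type.
Local Notation segx := (segment_measure (x_lo D) (x_hi D)).
Local Notation segy := (segment_measure (y_lo D) (y_hi D)).
Local Notation sq mu f := (ip mu f f).

Lemma is_traceB u v G H g h : is_grad D u G -> is_grad D v H ->
  is_trace D u g -> is_trace D v h -> is_trace D (u \- v) (g \- h).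
Proof.
move=> uG vH ug vh; have := is_trace_lin pD (-1) vH uG vh ug.
rewrite (_ : u \- v = fun p => -1 * v p + u p); last by apply/funext => p /=; ring.
by rewrite (_ : g \- h = fun p => -1 * h p + g p)//; apply/funext => p /=; ring.
Qed.

Lemma sq_cst0 d (T : measurableType d) (mu : {measure set T -> \bar R}) (f : T -> R) :
  (forall x, f x = 0) -> sq mu f = 0.
Proof. by move=> f0; rewrite (_ : f = cst 0) ?ip0l//; exact/funext. Qed.

(** [g - h] is a trace of [u - u], whose norm is 0, so the trace inequality makes it vanish. *)
Lemma trace_uniq u G g h : is_grad D u G -> is_trace D u g -> is_trace D u h ->
  ae_eq (arclen D) setT g h.
Proof.
move=> uG ug uh; have [K K0 HK] := trace_le pD.
have := HK _ _ _ (is_gradB uG uG) (is_traceB uG uG ug uh).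
have -> : h1sq D (u \- u) (fun i => G i \- G i) = 0.
  rewrite /h1sq sq_cst0; last by move=> x /=; rewrite subrr.
  rewrite add0r /gradsq big1// => i _; apply: sq_cst0 => x /=; exact: subrr.
rewrite mulr0 => gh0.
have Lgh : L2 (arclen D) (g \- h) by apply: L2_B; [exact: ug.1|exact: uh.1].
have /(ip_eq0 Lgh) : sq (arclen D) (g \- h) = 0.
  by apply/eqP; rewrite eq_le gh0 ip_ge0.
by apply: filterS => x /(_ I) /= /eqP + _; rewrite subr_eq0 => /eqP.
Qed.

Lemma is_trace_trace u g : is_trace D u g -> is_trace D u (trace D u).
Proof. by move=> ug; exact: xgetPex (ex_intro _ g ug). Qed.

Lemma traceE u G g : is_grad D u G -> is_trace D u g ->
  ae_eq (arclen D) setT (trace D u) g.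
Proof. by move=> uG ug; exact: (trace_uniq uG (is_trace_trace ug) ug). Qed.

(** A horizontal side is one of four nonnegative contributions to [arclen]. The interface will be
    such a side of each subdomain. *)
Lemma line_trace g c : c = y_lo D \/ c = y_hi D -> L2 (arclen D) g ->
  L2 segx (fun x => g (x, c)) /\
  sq segx (fun x => g (x, c)) <= sq (arclen D) g.
Proof.
move=> cD Lg; have mg : measurable_fun setT (fun x : line => g (x, c)).
  by apply: (measurable_line1 (f := g)); exact: L2_measurable Lg.
have I0 f a b (F : R -> R * R) : (0 <= \int[segment_measure a b]_x (f (F x) * f (F x) : R)%:E)%E.
  by apply: integral_ge0 => x _; rewrite lee_fin -expr2 sqr_ge0.
have le : (\int[segx]_x (g (x, c) * g (x, c))%:E <= (sq (arclen D) g)%:E)%E.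
  rewrite sq_arclen//; have X0 := fun y => I0 g (x_lo D) (x_hi D) (fun x => (x, y)).
  have Y0 := fun x => I0 g (y_lo D) (y_hi D) (fun y => (x, y)).
  apply: (@le_trans _ _ (\int[segx]_x (g (x, y_lo D) * g (x, y_lo D))%:E +
     \int[segx]_x (g (x, y_hi D) * g (x, y_hi D))%:E)%E).
    by case: cD => ->; [apply: leeDl|apply: leeDr]; exact: X0.
  by apply: leeDl; apply: adde_ge0; exact: Y0.
have Lgc : L2 segx (fun x => g (x, c)).
  by apply/L2P; split => //; apply: le_lt_trans le _; exact: ltry.
by split => //; rewrite -lee_fin (ip_EFin Lgc).
Qed.

(* [H10] with a given gradient and trace in place of the representatives chosen
   by [xget], which do not depend linearly on [u]. *)
Definition h10 Gam u G g := [/\ is_grad D u G, is_trace D u g &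
  {ae arclen D, forall p, Gam p -> g p = 0}].

Lemma H10P Gam u : H10 D Gam u ->
  h10 Gam u (fun i => weak_partial D i u) (trace D u).
Proof.
move=> [/H1_is_grad uG [g [ug g0]]]; split => //; first exact: is_trace_trace ug.
have tE := traceE uG ug.
by apply: (ae_imp2 (mu := arclen D) _ g0 tE) => p gp -> //; exact: gp.
Qed.

Lemma h10_H10 Gam u G g : h10 Gam u G g -> H10 D Gam u.
Proof. by move=> [uG ug g0]; split; [exact: is_grad_H1 uG|exists g]. Qed.

Lemma h10_lin Gam t u v G H g h : h10 Gam u G g -> h10 Gam v H h ->
  h10 Gam (fun p => t * u p + v p) (fun i p => t * G i p + H i p)
    (fun p => t * g p + h p).
Proof.
move=> [uG ug g0] [vH vh h0]; split; first exact: (is_grad_lin t uG vH).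
  exact: (is_trace_lin pD t uG vH ug vh).
by apply: (ae_imp2 (mu := arclen D) _ g0 h0) => p gp hp Gp; rewrite gp// hp// mulr0 addr0.
Qed.

Lemma h10_sub Gam Gam' u G g : Gam' `<=` Gam -> h10 Gam u G g -> h10 Gam' u G g.
Proof.
move=> GG' [uG ug g0]; split => //.
by apply: (ae_imp (mu := arclen D) _ g0) => p gp /GG' /gp.
Qed.

Lemma h10_0 Gam : h10 Gam (cst 0) (fun=> cst 0) (cst 0).
Proof.
have s0 : smooth2 (cst 0 : R * R -> R).
  have E s : foldr (@partial R) (cst 0) s = cst 0.
    elim: s => //= i s ->; apply/funext => p.
    by rewrite /partial derive_cst.
  by move=> s; rewrite E; split; [exact: cst_continuous|move=> i p; exact: derivable_cst].
have g0 : is_grad D (cst 0) (fun=> cst 0).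
  split; first exact: L2_0.
  move=> i; split; first exact: L2_0.
  by move=> phi _; rewrite -![\int[_]_p _]/(ip _ _ _) !ip0l oppr0.
split => //; last by apply: nearW.
apply/(is_traceP pD _ g0); split; first exact: L2_0.
exists (fun=> cst 0); split => //.
- rewrite (_ : (fun n => _) = cst 0); first exact: cvg_cst.
  apply/funext => n; rewrite /h1sq sq_cst0; last by move=> x /=; rewrite subrr.
  rewrite add0r /gradsq big1// => i _; apply: sq_cst0 => x /=.
  by rewrite /partial derive_cst subrr.
- rewrite (_ : (fun n => _) = cst 0); first exact: cvg_cst.
  by apply/funext => n; apply: sq_cst0 => x /=; rewrite subrr.
Qed.

(** An approximant [phi] need not vanish where the trace [g] does, but there it coincides with
    [phi - g], which tends to 0 along the approximation. *)
Lemma left_side_le phi g p q : continuous phi -> L2 (arclen D) g ->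
  y_lo D <= p -> q <= y_hi D ->
  {ae arclen D, forall z, ([set x_lo D] `*` [set` `]p, q[]) z -> g z = 0} ->
  sq (segment_measure p q) (fun y => phi (x_lo D, y)) <= sq (arclen D) (phi \- g).
Proof.
move=> cphi Lg yp qy g0; set E := _ `*` _ in g0.
have mE : measurable (E : set plane).
  by apply: measurableX; [exact: measurable_set1|exact: measurable_itv].
have mphi := continuous_plane_measurable cphi.
have mg : measurable_fun setT (g : plane -> R) by exact: L2_measurable Lg.
have Lphi := L2_arclen pD cphi.
have m1E : measurable_fun setT (\1_E : plane -> R) by exact: measurable_indic.
(* Cutting off by [\1_E] writes the integral over the piece of side as one contribution to an
   [arclen] integral, where [phi] may be replaced by [phi - g]. *)
pose m z := (\1_E z * (phi z * phi z))%:E : \bar R.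
have mm : measurable_fun setT (m : plane -> \bar R).
  by apply/measurable_EFinP; apply: measurable_funM => //; exact: measurable_funM.
have m0 z : (0 <= m z)%E by rewrite lee_fin mulr_ge0// -expr2 sqr_ge0.
rewrite -lee_fin (ip_EFin (L2_segment _ _ (continuous_line2 (x := x_lo D) cphi))).
have -> : (\int[segment_measure p q]_y (phi (x_lo D, y) * phi (x_lo D, y))%:E =
    \int[segy]_y m (x_lo D, y))%E.
  have mc : measurable_fun setT (fun y : line => (phi (x_lo D, y) * phi (x_lo D, y))%:E).
    apply/measurable_EFinP; apply: measurable_funM; apply: continuous_measurable_fun;
    exact: continuous_line2.
  rewrite segment_integral//; last by move=> y; rewrite lee_fin -expr2 sqr_ge0.
  rewrite segment_integral//; last exact: measurable_line2.
  have -> : [set` `]p, q[] = [set` `]y_lo D, y_hi D[] `&` [set` `]p, q[].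
    apply/esym/setIidr => y /=; rewrite !in_itv/= => /andP[py yq].
    by rewrite (le_lt_trans yp py) (lt_le_trans yq qy).
  rewrite integral_mkcondr; apply: eq_integral => y _.
  rewrite patchE /m indicE /E in_setX [X in X && _]mem_set//=.
  by case: (y \in _); rewrite ?mul1r ?mul0r.
apply: (@le_trans _ _ (\int[arclen D]_z m z)%E).
  have I0 a b (F : R -> R * R) : (0 <= \int[segment_measure a b]_x m (F x))%E.
    by apply: integral_ge0 => x _; exact: m0.
  have [xD yD] := pD; rewrite arclen_integral//.
  apply: (le_trans _ (leeDr _ (adde_ge0 (I0 _ _ _) (I0 _ _ _)))).
  by apply: leeDl; exact: I0.
have -> : (\int[arclen D]_z m z =
    \int[arclen D]_z (\1_E z * ((phi \- g) z * (phi \- g) z))%:E)%E.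
  apply: ae_eq_integral => //.
    apply/measurable_EFinP; apply: measurable_funM => //.
    by apply: measurable_funM; exact: measurable_funB.
  apply: (ae_imp (mu := arclen D) _ g0) => z gz _; rewrite /m indicE; congr EFin.
  case: (boolP (z \in E)) => [/set_mem/gz /= ->|_]; last by rewrite !mul0r.
  by rewrite subr0.
rewrite (ip_EFin (L2_B Lphi Lg)); apply: ge0_le_integral => //.
- by move=> z _; rewrite lee_fin mulr_ge0// -expr2 sqr_ge0.
- apply/measurable_EFinP; apply: measurable_funM => //.
  by apply: measurable_funM; exact: measurable_funB.
- by apply/measurable_EFinP; apply: measurable_funM; exact: measurable_funB.
- move=> z _; rewrite lee_fin indicE; case: (_ \in _); rewrite ?mul1r// mul0r.
  by rewrite -expr2 sqr_ge0.
Qed.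

(** The boundary term of the smooth inequality is at most the trace error of the approximant and
    disappears in the limit. The factor 4 again comes from comparing both values and gradients with
    those of the approximant. *)
Lemma h10_poincare Gam p q : p < q -> y_lo D <= p -> q <= y_hi D ->
  [set x_lo D] `*` [set` `]p, q[] `<=` Gam ->
  exists2 K, 0 <= K & forall u G g, h10 Gam u G g ->
    sq (area D) u <= K * gradsq D G.
Proof.
move=> pq yp qy GamE; have [K K0 HK] := smooth2_poincare pD pq yp qy.
exists (4 * K); first by rewrite mulr_ge0.
move=> u G g [uG /(is_traceP pD _ uG)[Lg [phi [sphi phiu phig]]] g0].
pose b n := (2 + 4 * K) * h1sq D (phi n \- u) (fun i => partial i (phi n) \- G i) +
  2 * K * sq (arclen D) (phi n \- g).
have b0 : b n @[n --> \oo] --> 0.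
  rewrite -[0](addr0 (0 : R)) -{1}(mulr0 (2 + 4 * K)) -{2}(mulr0 (2 * K)).
  by apply: cvgD; apply: cvgMr.
apply: (cvg0_const_le b0) => n; rewrite /b.
have gn := smooth2_is_grad pD (sphi n).
have e1 := ip_le2 uG.1 gn.1; rewrite sq_sym in e1.
have e2 := HK _ (sphi n).
have e3 : sq (segment_measure p q) (fun y => phi n (x_lo D, y)) <= sq (arclen D) (phi n \- g).
  apply: left_side_le => //; first exact: smooth2_continuous.
  by apply: (ae_imp (mu := arclen D) _ g0) => z gz /GamE/gz.
have e4 := gradsq_le2 gn uG.
have e5 := gradsq_ge0 D (fun i => partial i (phi n) \- G i).
have e6 := ip_ge0 (area D) (phi n \- u).
have e7 := ler_wpM2l K0 (lerD e3 e4).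
have e8 := mulr_ge0 K0 e6.
apply: le_trans e1 _.
apply: le_trans (lerD (lexx _) (ler_wpM2l (ler0n R 2) (le_trans e2 e7))) _.
rewrite /h1sq; clear e2 e3 e4 e7; move: e5 e6 e8.
move: (gradsq D _) (gradsq D G) (sq _ _) (sq (arclen D) _) => a c x y a0 x0 Kx.
by have := K0; nra.
Qed.

End trace_space.

(** * Completeness of the Sobolev space on a rectangle *)

Section h10_complete.
Context (R : realType).
Variable D : rectangle R.
Hypothesis pD : proper_rect D.
Local Notation sq mu f := (ip mu f f).

Lemma h10_complete Gam (u : nat -> R * R -> R) (G : nat -> 'I_2 -> R * R -> R)
    (g : nat -> R * R -> R) : (forall n, h10 D Gam (u n) (G n) (g n)) ->
  (forall e : R, 0 < e -> exists N, forall n k, (N <= n)%N -> (N <= k)%N ->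
    h1sq D (u n \- u k) (fun i => G n i \- G k i) < e) ->
  exists v H h, h10 D Gam v H h /\
    h1sq D (u n \- v) (fun i => G n i \- H i) @[n --> \oo] --> 0.
Proof.
move=> hu cu.
have gu n : is_grad D (u n) (G n) by have [] := hu n.
have tu n : is_trace D (u n) (g n) by have [] := hu n.
have g0 n : {ae arclen D, forall p, Gam p -> g n p = 0} by have [] := hu n.
have Lu n : L2 (area D) (u n) by have [] := gu n.
have LG n i : L2 (area D) (G n i) by exact: is_grad_L2 (gu n).
have Lg n : L2 (arclen D) (g n) by have [] := tu n.
have [K K0 HK] := trace_le pD.
have [v Lv uv] : exists2 v, L2 (area D) v & sq (area D) (u n \- v) @[n --> \oo] --> 0.
  apply: L2_complete => // e /cu[N HN]; exists N => n k Nn Nk.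
  by apply: le_lt_trans (HN n k Nn Nk); rewrite /h1sq lerDl gradsq_ge0.
have /choice[H HH] (i : 'I_2) : exists H : R * R -> R, L2 (area D) H /\
    sq (area D) (G n i \- H) @[n --> \oo] --> 0.
  have [||H LH GH] := @L2_complete _ _ _ (area D) (fun n => G n i); last by exists H.
    by move=> n; exact: LG.
  move=> e /cu[N HN]; exists N => n k Nn Nk; apply: le_lt_trans (HN n k Nn Nk).
  rewrite /h1sq /gradsq (bigD1 i)//= addrCA lerDl addr_ge0 ?ip_ge0//.
  by apply: sumr_ge0 => j _; exact: ip_ge0.
have LH i : L2 (area D) (H i) by have [] := HH i.
have GH i : sq (area D) (G n i \- H i) @[n --> \oo] --> 0 by have [] := HH i.
(* The trace inequality makes the traces Cauchy. *)
have [h Lh gh] : exists2 h, L2 (arclen D) h & sq (arclen D) (g n \- h) @[n --> \oo] --> 0.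
  apply: L2_complete => // e e0.
  have K1 : 0 < K + 1 by rewrite ltr_wpDl.
  have [N HN] := cu (e / (K + 1)) (divr_gt0 e0 K1).
  exists N => n k Nn Nk; have := HN n k Nn Nk; rewrite ltr_pdivlMr// => lt.
  apply: le_lt_trans lt.
  apply: (le_trans (HK _ _ _ (is_gradB (gu n) (gu k)) (is_traceB pD (gu n) (gu k) (tu n) (tu k)))).
  by rewrite mulrC ler_wpM2l ?h1sq_ge0// lerDl.
have gv : is_grad D v H.
  split => // i; apply: (@weakd_closed _ _ _ (area D) (test2 D) (partial i)
    (@test2_L2 R D) (test2_partial_L2 i) u (fun n => G n i) v (H i)) => // n.
  exact: (gu n).2.
have h1v : h1sq D (u n \- v) (fun i => G n i \- H i) @[n --> \oo] --> 0.
  rewrite /h1sq -[0](addr0 (0 : R)); apply: cvgD => //.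
  under eq_fun do rewrite gradsqE.
  by rewrite -[0](addr0 (0 : R)); apply: cvgD; exact: GH.
exists v, H, h; split => //; split => //; last first.
  (* A subsequence of the traces converges almost everywhere, and all its terms vanish on [Gam]
     outside one common null set. *)
  have [s gs] := L2_cvg_ae Lg Lh gh.
  have g0s : {ae arclen D, forall p, forall n, Gam p -> g n p = 0}.
    by apply: ae_foralln => n; exact: g0.
  apply: (ae_imp2 (mu := arclen D) _ gs g0s) => p gp gp0 Gp.
  have : (fun k => g (s k) p) @ \oo --> (0 : R).
    by rewrite (_ : (fun k => _) = cst 0); [exact: cvg_cst|apply/funext => k; exact: gp0].
  by move=> g00; exact: (cvg_unique (@Rhausdorff R) gp g00).
apply/(is_traceP pD _ gv); split => //.
(* Diagonal choice: a single smooth function within [1 / n.+1] of [u n] and of its trace at once. *)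
have /choice[phi Hphi] n : exists phi, [/\ smooth2 phi,
    h1sq D (phi \- u n) (fun i => partial i phi \- G n i) < n.+1%:R^-1 &
    sq (arclen D) (phi \- g n) < n.+1%:R^-1].
  have /(is_traceP pD _ (gu n))[_ [phi [sphi phiu phig]]] := tu n.
  have e0 : 0 < n.+1%:R^-1 :> R by rewrite invr_gt0.
  have [N1 H1] := cvg0_eventually phiu e0.
  have [N2 H2] := cvg0_eventually phig e0.
  exists (phi (maxn N1 N2)); split => //; first by apply: H1; exact: leq_maxl.
  by apply: H2; exact: leq_maxr.
exists phi; split.
- by move=> n; have [] := Hphi n.
- pose b n := 2 * n.+1%:R^-1 + 2 * h1sq D (u n \- v) (fun i => G n i \- H i).
  have b0 : b n @[n --> \oo] --> 0.
    rewrite -[0](addr0 (0 : R)); apply: cvgD; first exact: harmonic_cvg0.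
    by rewrite -[0](mulr0 2); exact: cvgMr.
  apply: cvg0_le b0 => n; rewrite h1sq_ge0/= /b.
  have [sphi /ltW e1 _] := Hphi n.
  have := h1sq_triangle (smooth2_is_grad pD sphi) (gu n) gv.
  have -> : h1sq D (v \- u n) (fun i => H i \- G n i) = h1sq D (u n \- v) (fun i => G n i \- H i).
    by rewrite /h1sq /gradsq sq_sym; congr (_ + _); apply: eq_bigr => i _; exact: sq_sym.
  by move=> /le_trans; apply; rewrite lerD2r ler_wpM2l.
- pose b n := 2 * n.+1%:R^-1 + 2 * sq (arclen D) (g n \- h).
  have b0 : b n @[n --> \oo] --> 0.
    rewrite -[0](addr0 (0 : R)); apply: cvgD; first exact: harmonic_cvg0.
    by rewrite -[0](mulr0 2); exact: cvgMr.
  apply: cvg0_le b0 => n; rewrite ip_ge0/= /b.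
  have [sphi _ /ltW e1] := Hphi n.
  have := ip_triangle (L2_arclen pD (smooth2_continuous sphi)) (Lg n) Lh.
  rewrite [X in _ + 2 * X]sq_sym.
  by move=> /le_trans; apply; rewrite lerD2r ler_wpM2l.
Qed.

End h10_complete.

(** * Sobolev spaces on a segment *)

Section sobolev_segment.
Context (R : realType).
Variables a b : R.
Hypothesis ab : a < b.
Implicit Types (u v g h phi psi : R -> R).
Local Notation seg := (segment_measure a b).
Local Notation sq f := (ip seg f f).

Lemma test1_L2 phi : test1 a b phi -> L2 seg phi.
Proof. by move=> [sphi _ _]; exact/L2_segment/smooth1_continuous. Qed.

Lemma test1_derive1_L2 phi : test1 a b phi -> L2 seg (derive1 phi).
Proof.
by move=> [sphi _ _]; apply/L2_segment/smooth1_continuous; exact: (smooth1_derive1n (n := 1%N) sphi).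
Qed.

Lemma test1_out phi x : test1 a b phi -> x \notin `]a, b[ -> phi x = 0.
Proof.
move=> [_ _ phiD] xD; apply/eqP; apply: contraNT xD => pn0.
by apply: phiD; exact: subset_closure.
Qed.

Lemma smooth1_is_derive phi (x : R) : smooth1 phi -> is_derive x 1 phi (derive1 phi x).
Proof. by move=> sphi; apply: DeriveDef; [exact: (sphi 0 x)|rewrite derive1E]. Qed.

Lemma smooth1_lin t phi psi : smooth1 phi -> smooth1 psi ->
  smooth1 (fun x => t * phi x + psi x).
Proof.
move=> sphi spsi.
apply: (@smooth1_coind R [set f | exists phi psi, [/\ smooth1 phi, smooth1 psi &
   f = (fun x => t * phi x + psi x)]]); last by exists phi, psi.
move=> _ [f [g [sf sg ->]]].
exists (fun x => t * derive1 f x + derive1 g x).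
  exists (derive1 f), (derive1 g); split; last by [].
    exact: (smooth1_derive1n (n := 1%N) sf).
  exact: (smooth1_derive1n (n := 1%N) sg).
move=> x; have H1 := smooth1_is_derive x sf; have H2 := smooth1_is_derive x sg.
exact: (is_deriveD (is_deriveZ t H1) H2).
Qed.

Lemma derive1_lin t phi psi : smooth1 phi -> smooth1 psi ->
  derive1 (fun x => t * phi x + psi x) = (fun x => t * derive1 phi x + derive1 psi x).
Proof.
move=> sf sg; apply/funext => x; rewrite derive1E.
have H1 := smooth1_is_derive x sf; have H2 := smooth1_is_derive x sg.
by have [_ ->] := is_deriveD (is_deriveZ t H1) H2.
Qed.

Lemma test1_lin t phi psi : test1 a b phi -> test1 a b psi ->
  test1 a b (fun x => t * phi x + psi x).
Proof.
move=> [sf cf fD] [sg cg gD].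
have sub : closure [set x | t * phi x + psi x != 0] `<=`
    closure [set x | phi x != 0] `|` closure [set x | psi x != 0].
  rewrite -closureU; apply: closureS => x /=; apply: contraNP => /not_orP[].
  by move=> /negP/negbNE/eqP -> /negP/negbNE/eqP ->; rewrite mulr0 addr0.
split; first exact: smooth1_lin.
  apply: subclosed_compact sub; first exact: closed_closure.
  exact: compactU.
by apply: subset_trans sub _ => x [/fD|/gD].
Qed.

Lemma test1_0 : test1 a b (cst 0).
Proof.
have E : [set x : R | (cst 0 x : R) != 0] = set0.
  by apply/seteqP; split => x //=; rewrite eqxx.
split; rewrite ?E ?closure0//; last exact: compact0.
apply: (@smooth1_coind R [set cst 0]) => // _ ->; exists (cst 0) => //.
by move=> x; exact: is_derive_cst.
Qed.

Lemma test1_weak_deriv phi : test1 a b phi -> is_weak_deriv a b phi (derive1 phi).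
Proof.
move=> tphi; have [sphi _ _] := tphi; split; first exact: test1_derive1_L2.
move=> psi tpsi; have [spsi _ _] := tpsi.
apply/eqP; rewrite -addr_eq0 -RintegralD//; last 2 first.
- by apply: L2_mul_integrable; [exact: test1_L2|exact: test1_derive1_L2].
- by apply: L2_mul_integrable; [exact: test1_derive1_L2|exact: test1_L2].
apply/eqP; apply: (@segment_integral_deriv_eq0 R (fun x => phi x * psi x)) => //.
- move=> x; apply: is_derive_eq (is_deriveM (smooth1_is_derive x sphi) (smooth1_is_derive x spsi)) _.
  by rewrite !scaleRE; ring.
- have c1 := smooth1_continuous sphi; have c2 := smooth1_continuous spsi.
  have c3 := smooth1_continuous (smooth1_derive1n (n := 1%N) sphi).
  have c4 := smooth1_continuous (smooth1_derive1n (n := 1%N) spsi).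
  by move=> x; apply: cvgD; apply: cvgM; [exact: c1|exact: c4|exact: c3|exact: c2].
- by rewrite (test1_out tphi) ?mul0r// in_itv/= ltxx.
- by rewrite (test1_out tphi) ?mul0r// in_itv/= ltxx andbF.
Qed.

Definition is_deriv1 u g := L2 seg u /\ is_weak_deriv a b u g.

Lemma is_deriv1_L2 u g : is_deriv1 u g -> L2 seg g.
Proof. by move=> [_ []]. Qed.

Lemma is_deriv1_lin t u v g h : is_deriv1 u g -> is_deriv1 v h ->
  is_deriv1 (fun x => t * u x + v x) (fun x => t * g x + h x).
Proof.
move=> [Lu ug] [Lv vh]; split; first exact: L2_lin.
exact: (@weakd_lin _ _ _ seg (test1 a b) (@derive1 R R) test1_L2
  test1_derive1_L2 t u v g h Lu Lv ug vh).
Qed.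

Lemma is_deriv1B u v g h : is_deriv1 u g -> is_deriv1 v h ->
  is_deriv1 (u \- v) (g \- h).
Proof.
move=> ug vh; have := is_deriv1_lin (-1) vh ug; congr is_deriv1.
  by apply/funext => p /=; ring.
by apply/funext => p /=; ring.
Qed.

Lemma is_deriv1_uniq u g h : is_deriv1 u g -> is_deriv1 u h -> ae_eq seg setT g h.
Proof.
move=> [Lu ug] [_ uh]; exact: (@weakd_uniq _ _ _ seg (test1 a b) (@derive1 R R)
  test1_L2 (@segment_du_bois_reymond R a b) u g h ug uh).
Qed.

Lemma H1_seg_is_deriv1 u : H1_seg a b u -> is_deriv1 u (weak_deriv a b u).
Proof. by move=> [Lu uG]; split => //; exact: xgetPex uG. Qed.

Lemma is_deriv1_H1_seg u g : is_deriv1 u g -> H1_seg a b u.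
Proof. by move=> [Lu ug]; split => //; exists g. Qed.

Lemma is_deriv1_weak_deriv u g : is_deriv1 u g -> ae_eq seg setT (weak_deriv a b u) g.
Proof. by move=> ug; exact: (is_deriv1_uniq (H1_seg_is_deriv1 (is_deriv1_H1_seg ug)) ug). Qed.

Lemma test1_is_deriv1 phi : test1 a b phi -> is_deriv1 phi (derive1 phi).
Proof. by move=> tphi; split; [exact: test1_L2|exact: test1_weak_deriv]. Qed.

Definition d1sq u g := sq u + sq g.

Lemma d1sq_ge0 u g : 0 <= d1sq u g.
Proof. by rewrite addr_ge0 ?ip_ge0. Qed.

Lemma H1norm_seg_sqr u g : is_deriv1 u g -> H1norm_seg a b u ^+ 2 = d1sq u g.
Proof.
move=> ug; rewrite /H1norm_seg sqr_sqrtr ?addr_ge0 ?sqr_ge0// !L2norm_sqr.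
have Lg := is_deriv1_L2 ug; have Lw := is_deriv1_L2 (H1_seg_is_deriv1 (is_deriv1_H1_seg ug)).
by congr (_ + _); apply: ae_eq_ip => //; exact: is_deriv1_weak_deriv.
Qed.

Lemma d1sq_triangle u v w g h k : is_deriv1 u g -> is_deriv1 v h -> is_deriv1 w k ->
  d1sq (u \- w) (g \- k) <= 2 * d1sq (u \- v) (g \- h) + 2 * d1sq (w \- v) (k \- h).
Proof.
move=> ug vh wk; rewrite /d1sq !mulrDr addrACA; apply: lerD; apply: ip_triangle;
  by [exact: ug.1|exact: vh.1|exact: wk.1|exact: is_deriv1_L2 ug|
      exact: is_deriv1_L2 vh|exact: is_deriv1_L2 wk].
Qed.

Definition h10_seg u g := is_deriv1 u g /\ exists phi : nat -> R -> R,
  (forall n, test1 a b (phi n)) /\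
  d1sq (phi n \- u) (derive1 (phi n) \- g) @[n --> \oo] --> 0.

Lemma h10_segP u : H10_seg a b u -> h10_seg u (weak_deriv a b u).
Proof.
move=> [/H1_seg_is_deriv1 ug [phi [tphi phiu]]]; split => //; exists phi; split => //.
have E n : H1norm_seg a b (phi n \- u) ^+ 2 =
    d1sq (phi n \- u) (derive1 (phi n) \- weak_deriv a b u).
  by apply: H1norm_seg_sqr; apply: is_deriv1B => //; exact: test1_is_deriv1.
by move/cvg0_squares : phiu; under eq_fun do rewrite E.
Qed.

Lemma h10_seg_H10_seg u g : h10_seg u g -> H10_seg a b u.
Proof.
move=> [ug [phi [tphi phiu]]]; split; first exact: is_deriv1_H1_seg ug.
exists phi; split => //; apply/cvg0_squares.
have E n : H1norm_seg a b (phi n \- u) ^+ 2 = d1sq (phi n \- u) (derive1 (phi n) \- g).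
  by apply: H1norm_seg_sqr; apply: is_deriv1B => //; exact: test1_is_deriv1.
by under eq_fun do rewrite E.
Qed.

Lemma h10_seg_0 : h10_seg (cst 0) (cst 0).
Proof.
have E : derive1 (cst 0 : R -> R) = cst 0 by apply/funext => x; exact: derive1_cst.
have d0 : is_deriv1 (cst 0) (cst 0) by rewrite -[X in is_deriv1 _ X]E; exact: test1_is_deriv1 test1_0.
split => //; exists (fun=> cst 0); split => [n|]; first exact: test1_0.
rewrite (_ : (fun n => _) = cst 0); first exact: cvg_cst.
by apply/funext => n; rewrite E /d1sq !sq_cst0 ?addr0// => x /=; rewrite subrr.
Qed.

Lemma h10_seg_lin t u v g h : h10_seg u g -> h10_seg v h ->
  h10_seg (fun x => t * u x + v x) (fun x => t * g x + h x).
Proof.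
move=> [ug [phi [tphi phiu]]] [vh [psi [tpsi psiv]]].
split; first exact: is_deriv1_lin.
exists (fun n x => t * phi n x + psi n x); split; first by move=> n; exact: test1_lin.
pose c n := 2 * t ^+ 2 * d1sq (phi n \- u) (derive1 (phi n) \- g) +
  2 * d1sq (psi n \- v) (derive1 (psi n) \- h).
have c0 : c n @[n --> \oo] --> 0.
  rewrite -[0](addr0 (0 : R)) -{1}(mulr0 (2 * t ^+ 2)) -{2}(mulr0 2).
  by apply: cvgD; apply: cvgMr.
apply: cvg0_le c0 => n; rewrite d1sq_ge0/= /c.
have A := is_deriv1B (test1_is_deriv1 (tphi n)) ug.
have B := is_deriv1B (test1_is_deriv1 (tpsi n)) vh.
have key (f f' k : R -> R) : L2 seg f -> L2 seg f' -> (forall x, k x = t * f x + f' x) ->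
    sq k <= 2 * t ^+ 2 * sq f + 2 * sq f'.
  move=> Lf Lf' Ek; rewrite (_ : k = fun x => t * f x + f' x); last exact/funext.
  have := ip_ge0 seg (fun x => - t * f x + f' x).
  by rewrite !ip_expand//; lra.
have [sf _ _] := tphi n; have [sg _ _] := tpsi n.
have E0 := key _ _ ((fun x => t * phi n x + psi n x) \- (fun x => t * u x + v x)) A.1 B.1
  ltac:(by move=> x /=; ring).
have E1 := key _ _ (derive1 (fun x => t * phi n x + psi n x) \- (fun x => t * g x + h x))
  (is_deriv1_L2 A) (is_deriv1_L2 B) ltac:(by move=> x /=; rewrite derive1_lin//; ring).
by rewrite /d1sq; lra.
Qed.

Lemma h10_seg_poincare u g : h10_seg u g -> sq u <= 8 * (b - a) ^+ 2 * sq g.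
Proof.
move=> [ug [phi [tphi phiu]]].
(* [phi n] vanishes at [a], so [C1_poincare] holds with [2 * (b - a) ^+ 2]; comparing values and
   then derivatives with those of [u] doubles it twice, and [c] collects the errors. *)
pose c n := (2 + 8 * (b - a) ^+ 2) * d1sq (phi n \- u) (derive1 (phi n) \- g).
have c0 : c n @[n --> \oo] --> 0.
  by rewrite -[0](mulr0 (2 + 8 * (b - a) ^+ 2)); exact: cvgMr.
apply: (cvg0_const_le c0) => n; rewrite /c.
have [sphi _ _] := tphi n; have gn := test1_is_deriv1 (tphi n).
have e1 := ip_le2 ug.1 gn.1; rewrite sq_sym in e1.
have e2 := C1_poincare (fun x => smooth1_is_derive x sphi)
  (smooth1_continuous (smooth1_derive1n (n := 1%N) sphi)) ab
  (ltac:(by rewrite in_itv/= lexx ltW) : a \in `[a, b]).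
rewrite (test1_out (tphi n)) ?expr0n/= ?mulr0 ?add0r in e2; last by rewrite in_itv/= ltxx.
have e3 := ip_le2 (is_deriv1_L2 gn) (is_deriv1_L2 ug).
rewrite /d1sq; have := sqr_ge0 (b - a); move: e1 e2 e3 (ip_ge0 seg (phi n \- u)) (ip_ge0 seg (derive1 (phi n) \- g)).
move: (sq u) (sq g) (sq (phi n \- u)) (sq (derive1 (phi n) \- g)) ((b - a) ^+ 2).
move: (sq (phi n)) (sq (derive1 (phi n))) => x y U G p q k e1 e2 e3 p0 q0 k0.
by nra.
Qed.

Lemma h10_seg_complete (u g : nat -> R -> R) : (forall n, h10_seg (u n) (g n)) ->
  (forall e : R, 0 < e -> exists N, forall n k, (N <= n)%N -> (N <= k)%N ->
    d1sq (u n \- u k) (g n \- g k) < e) ->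
  exists v h, h10_seg v h /\ d1sq (u n \- v) (g n \- h) @[n --> \oo] --> 0.
Proof.
move=> hu cu.
have gu n : is_deriv1 (u n) (g n) by have [] := hu n.
have Lu n : L2 seg (u n) by have [] := gu n.
have Lg n : L2 seg (g n) by exact: is_deriv1_L2 (gu n).
have [v Lv uv] : exists2 v, L2 seg v & sq (u n \- v) @[n --> \oo] --> 0.
  apply: L2_complete => // e /cu[N HN]; exists N => n k Nn Nk.
  by apply: le_lt_trans (HN n k Nn Nk); rewrite /d1sq lerDl ip_ge0.
have [h Lh gh] : exists2 h, L2 seg h & sq (g n \- h) @[n --> \oo] --> 0.
  apply: L2_complete => // e /cu[N HN]; exists N => n k Nn Nk.
  by apply: le_lt_trans (HN n k Nn Nk); rewrite /d1sq lerDr ip_ge0.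
have vh : is_deriv1 v h.
  split => //; apply: (@weakd_closed _ _ _ seg (test1 a b) (@derive1 R R)
    test1_L2 test1_derive1_L2 u g v h) => // n.
  exact: (gu n).2.
have d1v : d1sq (u n \- v) (g n \- h) @[n --> \oo] --> 0.
  by rewrite /d1sq -[0](addr0 (0 : R)); exact: cvgD.
exists v, h; split => //; split => //.
have /choice[phi Hphi] n : exists phi, test1 a b phi /\
    d1sq (phi \- u n) (derive1 phi \- g n) < n.+1%:R^-1.
  have [_ [phi [tphi phiu]]] := hu n.
  have e0 : 0 < n.+1%:R^-1 :> R by rewrite invr_gt0.
  have [N1 H1] := cvg0_eventually phiu e0.
  by exists (phi N1); split => //; exact: H1.
exists phi; split; first by move=> n; have [] := Hphi n.
pose c n := 2 * n.+1%:R^-1 + 2 * d1sq (u n \- v) (g n \- h).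
have c0 : c n @[n --> \oo] --> 0.
  rewrite -[0](addr0 (0 : R)); apply: cvgD; first exact: harmonic_cvg0.
  by rewrite -[0](mulr0 2); exact: cvgMr.
apply: cvg0_le c0 => n; rewrite d1sq_ge0/= /c.
have [tphi /ltW e1] := Hphi n.
have := d1sq_triangle (test1_is_deriv1 tphi) (gu n) vh.
rewrite [d1sq (v \- u n) _]/d1sq sq_sym [ip seg (h \- _) _]sq_sym.
by move=> /le_trans; apply; rewrite lerD2r ler_wpM2l.
Qed.

End sobolev_segment.

(** * The transmission problem *)

Section ae_linear_components.
Context (R : realType) (V : lmodType R) (S : set V).
Context d (T : measurableType d) (mu : {measure set T -> \bar R}).

(** The linearity that survives the choice of representatives. It suffices for bilinearity of the
    forms, which see these components only through integrals. *)
Definition ae_linear (c : V -> T -> R) :=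
  (forall u, S u -> L2 mu (c u)) /\
  forall t u v, S u -> S v ->
    ae_eq mu setT (c (t *: u + v)) (fun x => t * c u x + c v x).

Hypothesis SZD : forall (t : R) u v, S u -> S v -> S (t *: u + v).

Lemma ip_ae_linear c t u v w : ae_linear c -> S u -> S v -> S w ->
  ip mu (c (t *: u + v)) (c w) = t * ip mu (c u) (c w) + ip mu (c v) (c w).
Proof.
move=> [cL clin] Su Sv Sw; rewrite -ip_lin; [|exact: cL|exact: cL|exact: cL].
apply: ae_eq_ip; [exact/cL/SZD|apply: L2_lin; exact: cL|exact: cL|exact: cL| |].
  exact: clin.
exact: ae_eq_refl.
Qed.

Lemma ip_ae_linearr c f t u v : ae_linear c -> S u -> S v -> L2 mu f ->
  ip mu f (c (t *: u + v)) = t * ip mu f (c u) + ip mu f (c v).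
Proof.
move=> [cL clin] Su Sv Lf; rewrite ipC -[ip mu f (c u)]ipC -[ip mu f (c v)]ipC.
rewrite -ip_lin; [|exact: cL|exact: cL|exact: Lf].
apply: ae_eq_ip; [exact/cL/SZD|apply: L2_lin; exact: cL|exact: Lf|exact: Lf| |].
  exact: clin.
exact: ae_eq_refl.
Qed.

End ae_linear_components.

(** * Geometry of the subdomains and of the boundary pieces *)

Section geometry.
Context (R : realType) (L l : R) (GammaD GammaN : set (R * R)).
Hypotheses (L_gt0 : 0 < L) (l_gt0 : 0 < l).
Hypothesis GammaU : GammaD `|` GammaN = boundary (Omega L l).
Hypothesis GammaN_gamma : forall i : 'I_2,
  closure (boundary (Omega_ L l i) `&` GammaN) `&` closure (gamma2 L) = set0.

Local Notation rect i := (sub_rect L l i).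
Local Notation Gam i := (boundary (Omega_ L l i) `&` GammaD).
Implicit Type i : 'I_2.

Lemma sub_rect_proper i : proper_rect (rect i).
Proof.
have l2 : 0 < l / 2 by rewrite divr_gt0.
by rewrite /sub_rect; case: ifP => _; split => //=; rewrite ltrNl oppr0.
Qed.

Lemma sub_rect_lo i : x_lo (rect i) = 0.
Proof. by rewrite /sub_rect; case: ifP. Qed.

Lemma sub_rect_hi i : x_hi (rect i) = L.
Proof. by rewrite /sub_rect; case: ifP. Qed.

Lemma sub_rect_gamma i : 0 = y_lo (rect i) \/ 0 = y_hi (rect i).
Proof. by rewrite /sub_rect; case: ifP => _ /=; [left|right]. Qed.

Lemma closure_left_side (D : rectangle R) y : x_lo D < x_hi D ->
  y_lo D < y < y_hi D -> closure (open_rect D) (x_lo D, y).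
Proof.
move=> xD yD B /nbhs_ballP[e /= e0 eB].
pose t := Num.min (e / 2) ((x_hi D - x_lo D) / 2).
have t0 : 0 < t by rewrite lt_min !divr_gt0// subr_gt0.
have te : t < e.
  apply: (@le_lt_trans _ _ (e / 2)); first by rewrite ge_min lexx.
  by rewrite ltr_pdivrMr// mulr_natr mulr2n ltrDl.
have tx : t < x_hi D - x_lo D.
  apply: (@le_lt_trans _ _ ((x_hi D - x_lo D) / 2)); first by rewrite ge_min lexx orbT.
  by rewrite ltr_pdivrMr// mulr_natr mulr2n ltrDl subr_gt0.
exists (x_lo D + t, y); split.
  split; rewrite /= in_itv/=; last exact: yD.
  by rewrite ltrDl t0/= addrC -ltrBrDr.
apply: eB; split; last exact: ballxx.
by rewrite /ball/= opprD addrA subrr sub0r normrN gtr0_norm.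
Qed.

Lemma boundary_left_side (D : rectangle R) y : x_lo D < x_hi D ->
  y_lo D < y < y_hi D -> boundary (open_rect D) (x_lo D, y).
Proof.
move=> xD yD; split; first exact: closure_left_side.
move=> /interior_subset [/=]; by rewrite in_itv/= ltxx.
Qed.

Lemma closure_gamma2_origin : closure (gamma2 L) (0, 0).
Proof.
move=> B /nbhs_ballP[e /= e0 eB].
pose t := Num.min (e / 2) (L / 2).
have t0 : 0 < t by rewrite lt_min !divr_gt0.
have te : t < e.
  apply: (@le_lt_trans _ _ (e / 2)); first by rewrite ge_min lexx.
  by rewrite ltr_pdivrMr// mulr_natr mulr2n ltrDl.
have tL : t < L.
  apply: (@le_lt_trans _ _ (L / 2)); first by rewrite ge_min lexx orbT.
  by rewrite ltr_pdivrMr// mulr_natr mulr2n ltrDl.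
exists (t, 0); split; first by split; rewrite /= ?in_itv/= ?t0.
apply: eB; split; last exact: ballxx.
by rewrite /ball/= sub0r normrN gtr0_norm.
Qed.

Lemma open_open_rect (D : rectangle R) : open (open_rect D).
Proof.
rewrite openE => -[x y] [xI yI].
exists ([set` `]x_lo D, x_hi D[], [set` `]y_lo D, y_hi D[]) => //.
by split; apply: open_nbhs_nbhs; split => //; exact: interval_open.
Qed.

Lemma gamma2_not_boundary p : gamma2 L p -> ~ boundary (Omega L l) p.
Proof.
case: p => x y [/= x1 y0] [_]; apply.
apply: (@open_nbhs_nbhs _ (x, y) (Omega L l)); split; first exact: open_open_rect.
by split; [exact: x1|rewrite /= y0 in_itv/= ltrNl oppr0 !divr_gt0].
Qed.

(** The interface lies in the open set [Omega], so [GammaD], part of its boundary, misses it. Hence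
    the functions entering the dual norm satisfy the Dirichlet condition and may be used as test
    functions. *)
Lemma GammaD_sub_gamma2 i :
  Gam i `<=` boundary (Omega_ L l i) `\` gamma2 L.
Proof.
move=> p [bp Dp]; split => // /gamma2_not_boundary; apply.
by rewrite -GammaU; left.
Qed.

(* [GammaN] stays away from the end point [(0, 0)] of the interface, so [GammaD]
   contains a piece of the left side of each subdomain. *)
Lemma GammaD_left_side i : exists p q,
  [/\ p < q, y_lo (rect i) <= p, q <= y_hi (rect i) &
      [set x_lo (rect i)] `*` [set` `]p, q[] `<=` Gam i].
Proof.
have l2 : 0 < l / 2 by rewrite divr_gt0.
have nc : ~ closure (boundary (Omega_ L l i) `&` GammaN) (0, 0).
  move=> c; have : (closure (boundary (Omega_ L l i) `&` GammaN) `&` closure (gamma2 L)) (0, 0).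
    by split => //; exact: closure_gamma2_origin.
  by rewrite GammaN_gamma.
(* Otherwise points of [GammaN] on the left side would accumulate at the origin, against [nc]. *)
have [e e0 He] : exists2 e, 0 < e & forall y : R, `|y| < e ->
    boundary (Omega_ L l i) (0, y) -> ~ GammaN (0, y).
  apply: contrapT => H; apply: nc => B /nbhs_ballP[e /= e0 eB].
  apply: contrapT => B0; apply: H; exists e => // y ye by' Ny.
  apply: B0; exists (0, y); split => //; apply: eB; split; first exact: ballxx.
  by rewrite /ball/= sub0r normrN.
pose m := Num.min e (l / 2).
have m0 : 0 < m by rewrite lt_min e0.
have me : m <= e by rewrite ge_min lexx.
have ml : m <= l / 2 by rewrite ge_min lexx orbT.
have key y : `|y| < e -> y_lo (rect i) < y < y_hi (rect i) -> Gam i (x_lo (rect i), y).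
  move=> ye yi; have [xD yD] := sub_rect_proper i.
  have b1 : boundary (Omega_ L l i) (x_lo (rect i), y) by exact: boundary_left_side.
  split => //; have b2 : boundary (Omega L l) (x_lo (rect i), y).
    rewrite sub_rect_lo; apply: (@boundary_left_side (Rectangle 0 L (- (l / 2)) (l / 2))) => //=.
    move: yi; rewrite /sub_rect; case: ifP => _ /= /andP[y1 y2]; apply/andP; split => //.
      by apply: lt_trans y1; rewrite ltrNl oppr0.
    exact: lt_trans y2 _.
  rewrite -GammaU in b2; case: b2 => // Ny; exfalso.
  by move: b1 Ny; rewrite sub_rect_lo => b1; exact: He.
have [i0|i0] := boolP (i == 0).
  exists 0, m; rewrite /sub_rect i0/=; split => // -[x y] /= [-> ].
  rewrite in_itv/= => /andP[y0 ym].
  have := key y; rewrite /sub_rect i0/=; apply.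
    by rewrite gtr0_norm// (lt_le_trans ym me).
  by rewrite y0 (lt_le_trans ym ml).
exists (- m), 0; rewrite /sub_rect (negbTE i0)/=; split => //.
- by rewrite ltrNl oppr0.
- by rewrite lerN2.
move=> -[x y] /= [-> ]; rewrite in_itv/= => /andP[ym y0].
have := key y; rewrite /sub_rect (negbTE i0)/=; apply.
  by rewrite ltr0_norm// ltrNl (le_lt_trans _ ym)// lerN2.
by rewrite y0 andbT (le_lt_trans _ ym)// lerN2.
Qed.

End geometry.

Lemma ipE d (T : measurableType d) (R : realType) (mu : {measure set T -> \bar R})
  (f g : T -> R) : \int[mu]_x (f x * g x) = ip mu f g.
Proof. by []. Qed.

(* Unfolding these during unification is prohibitively slow. *)
Opaque ip weak_partial weak_deriv trace area arclen segment_measure.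

Lemma lin_congr (R : realType) (t a b c a' b' c' : R) :
  a = a' -> b = b' -> c = c' -> a' = t * b' + c' -> a = t * b + c.
Proof. by move=> -> -> ->. Qed.

Lemma add_congr (R : realType) (k a a' b b' : R) :
  a = a' -> b = b' -> a + k * b = a' + k * b'.
Proof. by move=> -> ->. Qed.

Lemma lin_add (R : realType) (t k x a b y a' b' : R) :
  x = t * a + b -> y = t * a' + b' ->
  x + k * y = t * (a + k * a') + (b + k * b').
Proof. by move=> -> ->; ring. Qed.

Lemma sum_ord2 (R : realType) (F : 'I_2 -> R) : \sum_(i < 2) F i = F 0 + F 1.
Proof.
rewrite !big_ord_recl big_ord0 addr0.
by have -> : lift ord0 ord0 = 1 :> 'I_2 by exact: val_inj.
Qed.

Lemma ler_sqrtM (R : rcfType) (x n k c w : R) : 0 <= c -> 0 <= k -> 0 <= n ->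
  x ^+ 2 <= c * w -> w <= k * n ^+ 2 -> x <= Num.sqrt (k * c) * n.
Proof.
move=> c0 k0 n0 xcw wkn; apply: le_trans (ler_norm _) _.
rewrite -(@ler_pXn2r _ 2)// ?nnegrE ?mulr_ge0 ?sqrtr_ge0//.
rewrite real_normK ?num_real// exprMn sqr_sqrtr ?mulr_ge0//.
by apply: le_trans xcw _; rewrite [k * c]mulrC -mulrA ler_wpM2l.
Qed.

Lemma sqre_le_fin (R : realType) (x : \bar R) (c : R) :
  (0 <= x)%E -> (x <= c%:E)%E -> (x ^+ 2 <= (c ^+ 2)%:E)%E.
Proof.
case: x => [r||]//; move=> r0 rc.
rewrite -[X in (X <= _)%E]/((r ^+ 2)%:E).
move: r0 rc; rewrite !lee_fin => r0 rc.
by rewrite ler_pXn2r ?nnegrE// (le_trans r0).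
Qed.

(** * Coercivity, existence, uniqueness and the uniform bound *)

Section transmission.
Context (R : realType) (L l : R) (GammaD : set (R * R)) (d eps_ox eps_par : R).
Hypotheses (L_gt0 : 0 < L) (l_gt0 : 0 < l) (d_gt0 : 0 < d).
Hypotheses (eps_ox_gt0 : 0 < eps_ox) (eps_par_gt0 : 0 < eps_par).
Hypothesis GammaD_left : forall i, exists p q,
  [/\ p < q, y_lo (sub_rect L l i) <= p, q <= y_hi (sub_rect L l i) &
      [set x_lo (sub_rect L l i)] `*` [set` `]p, q[] `<=`
        boundary (Omega_ L l i) `&` GammaD].
Hypothesis GammaD_gamma : forall i, boundary (Omega_ L l i) `&` GammaD `<=`
  boundary (Omega_ L l i) `\` gamma2 L.

Local Notation rect i := (sub_rect L l i).
Local Notation seg := (segment_measure 0 L).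
Local Notation sq mu f := (ip mu f f).
Local Notation Gam i := (boundary (Omega_ L l i) `&` GammaD).
Local Notation V := (space_V L l GammaD).
Local Notation wp i j u := (weak_partial (rect i) j (u.1 i)).
Local Notation wd u := (weak_deriv 0 L u.2).
Local Notation tr i u := (trace (rect i) (u.1 i)).
Local Notation form_a := (form_a L l d eps_ox eps_par).
Implicit Types (i j : 'I_2) (u v w : triple R).

Let pD i : proper_rect (rect i). Proof. exact: sub_rect_proper. Qed.

Lemma space_VP u : V u ->
  (forall i, h10 (rect i) (Gam i) (u.1 i) (fun j => wp i j u) (tr i u)) /\
  h10_seg 0 L u.2 (wd u).
Proof. by move=> [Vu Vg]; split => [i|]; [exact/H10P/Vu|exact: h10_segP]. Qed.

Lemma space_V_intro u : (forall i, exists G g, h10 (rect i) (Gam i) (u.1 i) G g) ->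
  (exists g, h10_seg 0 L u.2 g) -> V u.
Proof.
move=> H [g ug]; split => [i|]; last exact: h10_seg_H10_seg ug.
by have [G [gi h]] := H i; exact: h10_H10 h.
Qed.

Lemma space_V_ZD (t : R) u v : V u -> V v -> V (t *: u + v).
Proof.
move=> /space_VP[u1 u2] /space_VP[v1 v2]; apply: space_V_intro => [i|].
  by eexists; eexists; exact: (h10_lin (pD i) t (u1 i) (v1 i)).
by eexists; exact: (h10_seg_lin L_gt0 t u2 v2).
Qed.

Lemma space_V_0 : V 0.
Proof.
apply: space_V_intro => [i|].
  by eexists; eexists; exact: (h10_0 (pD i) (Gam i)).
by eexists; exact: (h10_seg_0 L_gt0).
Qed.

Lemma space_VB u v : V u -> V v -> V (u - v).
Proof. by move=> Vu Vv; rewrite addrC -scaleN1r; exact: space_V_ZD. Qed.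

Lemma V_is_grad i u : V u -> is_grad (rect i) (u.1 i) (fun j => wp i j u).
Proof. by move=> /space_VP[/(_ i)[]]. Qed.

Lemma V_is_trace i u : V u -> is_trace (rect i) (u.1 i) (tr i u).
Proof. by move=> /space_VP[/(_ i)[]]. Qed.

Lemma V_is_deriv1 u : V u -> is_deriv1 0 L u.2 (wd u).
Proof. by move=> /space_VP[_ []]. Qed.

(** Norms replace a comparison of null sets: the norm of [g - h] on the interface is at most its
    norm on the whole boundary, which is 0. *)
Lemma ae_eq_gamma i (g h : R * R -> R) : L2 (arclen (rect i)) g -> L2 (arclen (rect i)) h ->
  ae_eq (arclen (rect i)) setT g h ->
  ae_eq seg setT (fun x => g (x, 0)) (fun x => h (x, 0)).
Proof.
move=> Lg Lh gh; have Lgh := L2_B Lg Lh.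
have [] := line_trace (pD i) (sub_rect_gamma L l i) Lgh.
rewrite sub_rect_lo sub_rect_hi => Lx.
have -> : sq (arclen (rect i)) (g \- h) = 0.
  rewrite (@ae_eq_ip _ _ _ _ _ (cst 0) _ (cst 0))// ?ip0l//; try exact: L2_0.
    by apply: filterS gh => p ghp _ /=; rewrite ghp// subrr.
  by apply: filterS gh => p ghp _ /=; rewrite ghp// subrr.
move=> le0; have /(ip_eq0 Lx) : sq seg (fun x => (g \- h) (x, 0)) = 0.
  by apply/eqP; rewrite eq_le le0 ip_ge0.
by apply: filterS => x /(_ I) /= /eqP + _; rewrite subr_eq0 => /eqP.
Qed.

Lemma L2_gamma i (g : R * R -> R) : L2 (arclen (rect i)) g -> L2 seg (fun x => g (x, 0)).
Proof.
move=> Lg; have [] := line_trace (pD i) (sub_rect_gamma L l i) Lg.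
by rewrite sub_rect_lo sub_rect_hi.
Qed.

Definition jump i u : R -> R := trace_gamma L l i (u.1 i) \- u.2.

Lemma weak_partial_ae_linear i j : ae_linear V (area (rect i)) (fun u => wp i j u).
Proof.
split=> [u Vu|t u v Vu Vv]; first exact: is_grad_L2 (V_is_grad i Vu).
have H := is_grad_lin t (V_is_grad i Vu) (V_is_grad i Vv).
exact: (is_grad_weak_partial j H).
Qed.

Lemma weak_deriv_ae_linear : ae_linear V seg (fun u => wd u).
Proof.
split=> [u Vu|t u v Vu Vv]; first exact: is_deriv1_L2 (V_is_deriv1 Vu).
have H := is_deriv1_lin t (V_is_deriv1 Vu) (V_is_deriv1 Vv).
exact: (is_deriv1_weak_deriv H).
Qed.

Lemma jump_ae_linear i : ae_linear V seg (jump i).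
Proof.
have Lt u : V u -> L2 (arclen (rect i)) (tr i u) by move=> /(V_is_trace i)[].
split=> [u Vu|t u v Vu Vv].
  by apply: L2_B; [exact/L2_gamma/Lt|exact: (V_is_deriv1 Vu).1].
have H := traceE (pD i) (is_grad_lin t (V_is_grad i Vu) (V_is_grad i Vv))
  (is_trace_lin (pD i) t (V_is_grad i Vu) (V_is_grad i Vv) (V_is_trace i Vu) (V_is_trace i Vv)).
have := ae_eq_gamma (Lt _ (space_V_ZD t Vu Vv)) (L2_lin t (Lt _ Vu) (Lt _ Vv)) H.
apply: filterS => x E _.
transitivity (t * tr i u (x, 0) + tr i v (x, 0) - (t * u.2 x + v.2 x)).
  congr (_ - _); exact: (E I).
have R4 (a b c e : R) : t * a + c - (t * b + e) = t * (a - b) + (c - e) by ring.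
exact: R4.
Qed.

Lemma form_aE u v : V u -> V v -> form_a u v =
  \sum_(i < 2) eps_ox * (\sum_(j < 2) ip (area (rect i)) (wp i j u) (wp i j v)) +
  d * eps_par * ip seg (wd u) (wd v).
Proof.
move=> Vu Vv; rewrite /form_a; congr (_ + _); last first.
  rewrite -mulrA RintegralZl//; apply: L2_mul_integrable.
    exact: is_deriv1_L2 (V_is_deriv1 Vu).
  exact: is_deriv1_L2 (V_is_deriv1 Vv).
apply: eq_bigr => i _.
have I j : (area (rect i)).-integrable setT
    (EFin \o (fun p => wp i j u p * wp i j v p)).
  by apply: L2_mul_integrable; [exact: is_grad_L2 (V_is_grad i Vu)|
    exact: is_grad_L2 (V_is_grad i Vv)].
transitivity (\int[area (rect i)]_p (eps_ox *
    (wp i 0 u p * wp i 0 v p + wp i 1 u p * wp i 1 v p))).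
  by apply: eq_Rintegral => p _; congr (_ * _); exact: sum_ord2.
rewrite RintegralZl//; last exact: (integrableD measurableT (I 0) (I 1)).
congr (_ * _); apply: etrans (esym (sum_ord2 _)).
exact: (RintegralD measurableT (I 0) (I 1)).
Qed.

Lemma form_aC u v : V u -> V v -> form_a u v = form_a v u.
Proof.
move=> Vu Vv.
have H1 : \sum_(i < 2) eps_ox * (\sum_(j < 2) ip (area (rect i)) (wp i j u) (wp i j v)) =
    \sum_(i < 2) eps_ox * (\sum_(j < 2) ip (area (rect i)) (wp i j v) (wp i j u)).
  apply: eq_bigr => i _; apply: (congr1 (fun x => eps_ox * x)).
  by apply: eq_bigr => j _; apply: ipC.
exact: etrans (form_aE Vu Vv) (etrans (add_congr _ H1 (ipC _ _ _)) (esym (form_aE Vv Vu))).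
Qed.

Lemma form_aZD t u v w : V u -> V v -> V w ->
  form_a (t *: u + v) w = t * form_a u w + form_a v w.
Proof.
move=> Vu Vv Vw.
have E1 i : eps_ox * (\sum_(j < 2) ip (area (rect i)) (wp i j (t *: u + v)) (wp i j w)) =
   t * (eps_ox * (\sum_(j < 2) ip (area (rect i)) (wp i j u) (wp i j w))) +
   eps_ox * (\sum_(j < 2) ip (area (rect i)) (wp i j v) (wp i j w)).
  rewrite mulrCA -mulrDr; congr (_ * _); rewrite mulr_sumr -big_split.
  apply: eq_bigr => j _.
  exact: (ip_ae_linear space_V_ZD t (weak_partial_ae_linear i j) Vu Vv Vw).
have E2 := ip_ae_linear space_V_ZD t weak_deriv_ae_linear Vu Vv Vw.
apply: (lin_congr (form_aE (space_V_ZD t Vu Vv) Vw) (form_aE Vu Vw) (form_aE Vv Vw)).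
apply: lin_add E2; rewrite mulr_sumr -big_split.
by apply: eq_bigr => i _; exact: E1.
Qed.

Lemma form_aEsq u : V u -> form_a u u =
  eps_ox * (\sum_(i < 2) gradsq (rect i) (fun j => wp i j u)) +
  d * eps_par * sq seg (wd u).
Proof. by move=> Vu; rewrite form_aE// -mulr_sumr. Qed.

Lemma form_a_ge0 u : V u -> 0 <= form_a u u.
Proof.
move=> Vu; rewrite form_aEsq//; apply: addr_ge0; apply: mulr_ge0.
- exact: ltW.
- by apply: sumr_ge0 => i _; exact: gradsq_ge0.
- by rewrite mulr_ge0// ltW.
- exact: ip_ge0.
Qed.

Lemma norm_V_sqr u : norm_V L l u ^+ 2 =
  \sum_(i < 2) H1norm (rect i) (u.1 i) ^+ 2 + H1norm_seg 0 L u.2 ^+ 2.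
Proof.
rewrite /norm_V sqr_sqrtr//; apply: addr_ge0; last exact: sqr_ge0.
by apply: sumr_ge0 => i _; exact: sqr_ge0.
Qed.

Lemma form_a_coercive : exists2 K, 0 < K &
  forall u, V u -> norm_V L l u ^+ 2 <= K * form_a u u.
Proof.
have /choice[Kp HK] i : exists K, 0 <= K /\ forall u, V u ->
    sq (area (rect i)) (u.1 i) <= K * gradsq (rect i) (fun j => wp i j u).
  have [p [q [pq yp qy HG]]] := GammaD_left i.
  have [K K0 H] := h10_poincare (pD i) pq yp qy HG.
  by exists K; split => // u /space_VP[/(_ i) /H].
(* The added 1 accounts for the derivative part of the [H^1] norms, on top of the Poincare
   constants; the sum is a common bound for both subdomains. *)
pose K0 := \sum_(i < 2) (Kp i + 1); pose K1 := 8 * L ^+ 2 + 1.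
have Kp0 i : 0 <= Kp i by have [] := HK i.
have KpS i : Kp i + 1 <= K0.
  rewrite /K0 (bigD1 i)//= lerDl; apply: sumr_ge0 => k _.
  by rewrite addr_ge0.
have K00 : 0 < K0 by apply: lt_le_trans (KpS 0); rewrite ltr_wpDl.
have K10 : 0 < K1 by rewrite /K1 ltr_wpDl// mulr_ge0// sqr_ge0.
have dp0 : 0 < d * eps_par by rewrite mulr_gt0.
(* Each summand pays for one of the two terms of [form_a]; the cross terms of the product are
   nonnegative and are dropped. *)
exists (K0 / eps_ox + K1 / (d * eps_par)); first by rewrite addr_gt0// divr_gt0.
move=> u Vu; rewrite norm_V_sqr form_aEsq//.
rewrite (H1norm_seg_sqr (V_is_deriv1 Vu)).
have e2 : d1sq 0 L u.2 (wd u) <= K1 * sq seg (wd u).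
  have := h10_seg_poincare L_gt0 (space_VP Vu).2; rewrite subr0 /d1sq /K1.
  by rewrite [X in _ -> _ <= X]mulrDl mul1r => H; rewrite lerD2r.
have e1 : \sum_(i < 2) H1norm (rect i) (u.1 i) ^+ 2 <=
    K0 * \sum_(i < 2) gradsq (rect i) (fun j => wp i j u).
  rewrite mulr_sumr; apply: ler_sum => i _.
  rewrite (H1norm_sqr (V_is_grad i Vu)) /h1sq.
  apply: (@le_trans _ _ ((Kp i + 1) * gradsq (rect i) (fun j => wp i j u))).
    by rewrite mulrDl mul1r lerD2r; have [_] := HK i; exact.
  by apply: ler_wpM2r (KpS i); exact: gradsq_ge0.
have g0 : 0 <= \sum_(i < 2) gradsq (rect i) (fun j => wp i j u).
  by apply: sumr_ge0 => i _; exact: gradsq_ge0.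
have s0 := ip_ge0 seg (wd u).
apply: le_trans (lerD e1 e2) _.
move: (\sum_(i < 2) _) (sq seg _) g0 s0 => g s g0 s0.
have -> : (K0 / eps_ox + K1 / (d * eps_par)) * (eps_ox * g + d * eps_par * s) =
    K0 * g + K1 * s + (K0 / eps_ox * (d * eps_par * s) + K1 / (d * eps_par) * (eps_ox * g)).
  by field; rewrite !gt_eqF.
rewrite lerDl addr_ge0// !mulr_ge0// ?invr_ge0 ?mulr_ge0// ltW//.
Qed.

Lemma form_a_bounded : exists2 K, 0 <= K &
  forall u, V u -> form_a u u <= K * norm_V L l u ^+ 2.
Proof.
exists (eps_ox + d * eps_par); first by rewrite addr_ge0 ?mulr_ge0// ltW.
move=> u Vu; rewrite norm_V_sqr form_aEsq// (H1norm_seg_sqr (V_is_deriv1 Vu)).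
have dp0 : 0 <= d * eps_par by rewrite mulr_ge0// ltW.
have e0 : 0 <= eps_ox by rewrite ltW.
have e1 : \sum_(i < 2) gradsq (rect i) (fun j => wp i j u) <=
    \sum_(i < 2) H1norm (rect i) (u.1 i) ^+ 2.
  apply: ler_sum => i _; rewrite (H1norm_sqr (V_is_grad i Vu)) /h1sq.
  by rewrite lerDr ip_ge0.
have e2 : sq seg (wd u) <= d1sq 0 L u.2 (wd u) by rewrite /d1sq lerDr ip_ge0.
apply: le_trans (lerD (ler_wpM2l e0 e1) (ler_wpM2l dp0 e2)) _.
have g0 : 0 <= \sum_(i < 2) H1norm (rect i) (u.1 i) ^+ 2.
  by apply: sumr_ge0 => i _; exact: sqr_ge0.
have := mulr_ge0 dp0 g0; have := mulr_ge0 e0 (d1sq_ge0 0 L u.2 (wd u)).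
move: (\sum_(i < 2) _) (d1sq _ _ _ _) => s t; move: (d * eps_par) => k; lra.
Qed.

Lemma jump_bounded : exists2 K, 0 <= K &
  forall u, V u -> \sum_(i < 2) sq seg (jump i u) <= K * norm_V L l u ^+ 2.
Proof.
have /choice[Kt HK] i : exists K, 0 <= K /\ forall u, V u ->
    sq seg (trace_gamma L l i (u.1 i)) <= K * H1norm (rect i) (u.1 i) ^+ 2.
  have [K K0 H] := trace_le (pD i); exists K; split => // u Vu.
  have tu := V_is_trace i Vu; rewrite (H1norm_sqr (V_is_grad i Vu)).
  apply: le_trans (H _ _ _ (V_is_grad i Vu) tu).
  have [_] := line_trace (pD i) (sub_rect_gamma L l i) tu.1.
  by rewrite sub_rect_lo sub_rect_hi.
have Kt0 i : 0 <= Kt i by have [] := HK i.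
pose K0 := \sum_(i < 2) Kt i.
have KtS i : Kt i <= K0 by rewrite /K0 (bigD1 i)//= lerDl sumr_ge0.
have K00 : 0 <= K0 by apply: le_trans (KtS 0).
(* Each jump costs twice the squared norm of its trace plus twice that of [u.2], and [u.2] occurs in
   two jumps. *)
exists (2 * K0 + 4); first by rewrite addr_ge0// mulr_ge0.
move=> u Vu; rewrite norm_V_sqr (H1norm_seg_sqr (V_is_deriv1 Vu)).
have e0 : sq seg u.2 <= d1sq 0 L u.2 (wd u) by rewrite /d1sq lerDl ip_ge0.
have Lt i : L2 seg (trace_gamma L l i (u.1 i)) by exact: (L2_gamma (V_is_trace i Vu).1).
have Lu := (V_is_deriv1 Vu).1.
have e1 i : sq seg (jump i u) <= 2 * K0 * H1norm (rect i) (u.1 i) ^+ 2 + 2 * sq seg u.2.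
  have := ip_triangle (Lt i) (L2_0 _) Lu.
  have E f : f \- cst 0 = f :> (R -> R) by apply/funext => x /=; rewrite subr0.
  rewrite !E => /le_trans; apply; rewrite lerD2r -mulrA ler_wpM2l//.
  by have [_ /(_ u Vu)] := HK i => /le_trans; apply; rewrite ler_wpM2r// sqr_ge0.
apply: le_trans (ler_sum _ (fun i _ => e1 i)) _.
rewrite big_split/= -mulr_sumr sumr_const card_ord mulr2n.
have s0 : 0 <= \sum_(i < 2) H1norm (rect i) (u.1 i) ^+ 2.
  by apply: sumr_ge0 => i _; exact: sqr_ge0.
move: (\sum_(i < 2) _) s0 => s s0.
have := mulr_ge0 K00 (d1sq_ge0 0 L u.2 (wd u)).
move: e0; move: (sq seg u.2) (d1sq _ _ _ _) => a c ac K0c.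
by lra.
Qed.

Lemma triple_sub1 u v i : (u - v).1 i = u.1 i \- v.1 i.
Proof. by []. Qed.

Lemma triple_sub2 u v : (u - v).2 = u.2 \- v.2.
Proof. by []. Qed.

Lemma H1norm_le_norm_V u i : H1norm (rect i) (u.1 i) ^+ 2 <= norm_V L l u ^+ 2.
Proof.
rewrite norm_V_sqr (bigD1 i)//= -addrA lerDl addr_ge0 ?sqr_ge0//.
by apply: sumr_ge0 => j _; exact: sqr_ge0.
Qed.

Lemma H1norm_seg_le_norm_V u : H1norm_seg 0 L u.2 ^+ 2 <= norm_V L l u ^+ 2.
Proof.
by rewrite norm_V_sqr lerDr; apply: sumr_ge0 => j _; exact: sqr_ge0.
Qed.

Lemma space_V_complete (u : nat -> triple R) : (forall n, V (u n)) ->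
  (forall e : R, 0 < e -> exists N, forall n k, (N <= n)%N -> (N <= k)%N ->
    norm_V L l (u n - u k) ^+ 2 < e) ->
  exists2 v, V v & norm_V L l (u n - v) ^+ 2 @[n --> \oo] --> 0.
Proof.
move=> Vu cu.
have /choice[y Hv] i : exists y, exists H h, h10 (rect i) (Gam i) y H h /\
    h1sq (rect i) ((u n).1 i \- y) (fun j => wp i j (u n) \- H j) @[n --> \oo] --> 0.
  apply: (h10_complete (pD i) (fun n => (space_VP (Vu n)).1 i)) => e /cu[N HN].
  exists N => n k Nn Nk; apply: le_lt_trans (HN n k Nn Nk).
  have := H1norm_le_norm_V (u n - u k) i.
  by rewrite triple_sub1 (H1norm_sqr (is_gradB (V_is_grad i (Vu n)) (V_is_grad i (Vu k)))).
have [z [k [wk uw]]] := h10_seg_complete L_gt0 (fun n => (space_VP (Vu n)).2)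
  ltac:(move=> e /cu[N HN]; exists N => n m Nn Nm; apply: le_lt_trans (HN n m Nn Nm);
   have := H1norm_seg_le_norm_V (u n - u m);
   by rewrite triple_sub2 (H1norm_seg_sqr (is_deriv1B (V_is_deriv1 (Vu n)) (V_is_deriv1 (Vu m))))).
exists (y, z : R -> R).
  apply: space_V_intro => [i|]; last by exists k.
  by have [H [h [Hh _]]] := Hv i; exists H, h.
have cv i : H1norm (rect i) ((u n - (y, z : R -> R)).1 i) ^+ 2 @[n --> \oo] --> 0.
  have [H [h [[vH _ _] uv]]] := Hv i.
  have E n : H1norm (rect i) ((u n - (y, z : R -> R)).1 i) ^+ 2 =
      h1sq (rect i) ((u n).1 i \- y i) (fun j => wp i j (u n) \- H j).
    by rewrite triple_sub1 (H1norm_sqr (is_gradB (V_is_grad i (Vu n)) vH)).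
  by rewrite (funext E).
have cw : H1norm_seg 0 L (u n - (y, z : R -> R)).2 ^+ 2 @[n --> \oo] --> 0.
  have E n : H1norm_seg 0 L (u n - (y, z : R -> R)).2 ^+ 2 =
      d1sq 0 L ((u n).2 \- z) (wd (u n) \- k).
    by rewrite triple_sub2 (H1norm_seg_sqr (is_deriv1B (V_is_deriv1 (Vu n)) wk.1)).
  by rewrite (funext E).
have E n : norm_V L l (u n - (y, z : R -> R)) ^+ 2 =
    H1norm (rect 0) ((u n - (y, z : R -> R)).1 0) ^+ 2 +
    H1norm (rect 1) ((u n - (y, z : R -> R)).1 1) ^+ 2 +
    H1norm_seg 0 L (u n - (y, z : R -> R)).2 ^+ 2.
  by rewrite norm_V_sqr sum_ord2.
rewrite (funext E); have := cvgD (cvgD (cv 0) (cv 1)) cw.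
by rewrite !addr0 => H; exact: H.
Qed.

Lemma form_bE mu u : form_b L l mu u = \sum_(i < 2) ip seg (mu i) (jump i u).
Proof. by apply: eq_bigr => i _; exact: ipE. Qed.

Lemma form_cE lam mu : form_c L lam mu = \sum_(i < 2) ip seg (lam i) (mu i).
Proof. by apply: eq_bigr => i _; exact: ipE. Qed.

Definition jump_form u v := \sum_(i < 2) ip seg (jump i u) (jump i v).

Lemma jump_formC u v : jump_form u v = jump_form v u.
Proof. by apply: eq_bigr => i _; apply: ipC. Qed.

Lemma jump_form_ge0 u : 0 <= jump_form u u.
Proof. by apply: sumr_ge0 => i _; exact: ip_ge0. Qed.

Lemma jump_formZD t u v w : V u -> V v -> V w ->
  jump_form (t *: u + v) w = t * jump_form u w + jump_form v w.
Proof.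
move=> Vu Vv Vw; rewrite /jump_form mulr_sumr -big_split.
apply: eq_bigr => i _; exact: (ip_ae_linear space_V_ZD t (jump_ae_linear i) Vu Vv Vw).
Qed.

(* Eliminating [lam] from the second equation gives
   [lam i = - alpha^-1 * jump i u], and the first one becomes the
   variational problem for [schur alpha^-1]. *)
Definition schur k u v := form_a u v + k * jump_form u v.

(** On [V] the quadratic form of [schur k] is equivalent to the square of [norm_V], so completeness
    transfers to it and [semi_riesz] applies. *)
Lemma schur_solution k rho : 0 < k -> L2 seg rho ->
  exists2 u, V u & forall v, V v -> schur k u v = ip seg rho v.2.
Proof.
move=> k0 Lrho; have k0' := ltW k0.
have [Kc Kc0 Hc] := form_a_coercive.
have [Ka Ka0 Ha] := form_a_bounded; have [Kj Kj0 Hj] := jump_bounded.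
have le_schur u : V u -> norm_V L l u ^+ 2 <= Kc * schur k u u.
  move=> Vu; apply: le_trans (Hc u Vu) _; rewrite ler_wpM2l//; first exact: ltW.
  by rewrite lerDl mulr_ge0// jump_form_ge0.
(* This bound depends on [k], but it only transfers convergence and never enters the final
   estimate. *)
have ge_schur u : V u -> schur k u u <= (Ka + k * Kj) * norm_V L l u ^+ 2.
  move=> Vu; rewrite mulrDl -mulrA; apply: lerD; first exact: Ha.
  by rewrite ler_wpM2l//; exact: Hj.
have schur_ge0 u : V u -> 0 <= schur k u u.
  by move=> Vu; rewrite addr_ge0 ?form_a_ge0// mulr_ge0// jump_form_ge0.
(* The constant of the functional is [|rho|^2 * Kc]: Cauchy-Schwarz in [L^2], then coercivity for
   the norm of [v.2]. *)
apply: (@semi_riesz R (triple R) V (schur k) space_V_ZD space_V_0 _ _ schur_ge0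
  (fun v => ip seg rho v.2) (ip seg rho rho * Kc)).
- by move=> u v Vu Vv; rewrite /schur form_aC// jump_formC.
- move=> t u v w Vu Vv Vw; have e1 := form_aZD t Vu Vv Vw.
  exact: (lin_add k e1 (jump_formZD t Vu Vv Vw)).
- move=> t u v Vu Vv; have Lu := (V_is_deriv1 Vu).1; have Lv := (V_is_deriv1 Vv).1.
  rewrite ipC [ip seg rho u.2]ipC [ip seg rho v.2]ipC.
  exact: (ip_lin t Lu Lv Lrho).
- by rewrite mulr_ge0 ?ip_ge0// ltW.
- move=> u Vu; have Lu := (V_is_deriv1 Vu).1.
  apply: le_trans (cauchy_schwarz Lrho Lu) _; rewrite -mulrA ler_wpM2l ?ip_ge0//.
  apply: le_trans (le_schur u Vu); apply: le_trans (H1norm_seg_le_norm_V u).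
  by rewrite (H1norm_seg_sqr (V_is_deriv1 Vu)) /d1sq lerDl ip_ge0.
- move=> u Vu cu.
  have [e e0|v Vv uv] := space_V_complete Vu.
    have [N HN] := cu (e / Kc) (divr_gt0 e0 Kc0).
    exists N => n m Nn Nm; apply: le_lt_trans (le_schur _ (space_VB (Vu n) (Vu m))) _.
    by have := HN n m Nn Nm; rewrite ltr_pdivlMr// mulrC.
  exists v => //.
  apply: (cvg0_le (b := fun n => (Ka + k * Kj) * norm_V L l (u n - v) ^+ 2)).
    move=> n; have Vuv := space_VB (Vu n) Vv.
    by apply/andP; split; [exact: schur_ge0|exact: ge_schur].
  by rewrite -[0](mulr0 (Ka + k * Kj)); exact: cvgMr.
Qed.

Local Notation solution := (is_solution L l GammaD d eps_ox eps_par).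

Lemma solution_exists alpha rho : 0 < alpha -> L2 seg rho ->
  exists u lam, solution alpha rho u lam.
Proof.
move=> a0 Lrho; have k0 : 0 < alpha^-1 by rewrite invr_gt0.
have [u Vu Hu] := schur_solution k0 Lrho.
have Lj v i : V v -> L2 seg (jump i v) by exact: (jump_ae_linear i).1.
exists u, (fun i x => - alpha^-1 * jump i u x); split => //.
- by move=> i; apply: L2_Z; exact: Lj.
- move=> v Vv; rewrite [RHS]ipE -(Hu v Vv) form_bE /schur.
  congr (_ + _); rewrite /jump_form mulr_sumr -sumrN; apply: eq_bigr => i _.
  by rewrite (ipZ _ (Lj _ i Vu) (Lj _ i Vv)) mulNr opprK.
- move=> mu Lmu; rewrite form_bE form_cE mulr_sumr -big_split big1// => i _ /=.
  rewrite (ipZ _ (Lj _ i Vu) (Lmu i)) mulNr mulrN mulrA divff ?gt_eqF// mul1r.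
  by rewrite [ip seg (mu i) _]ipC subrr.
Qed.

(** Reduces uniqueness to the energy estimate with source [rho \- rho]. *)
Lemma solution_sub alpha rho rho' u u' lam lam' : L2 seg rho -> L2 seg rho' ->
  solution alpha rho u lam -> solution alpha rho' u' lam' ->
  solution alpha (rho \- rho') (u - u') (fun i => lam i \- lam' i).
Proof.
move=> Lr Lr' [Vu Ql Hu1 Hu2] [Vu' Ql' Hu1' Hu2'].
have Lj v i : V v -> L2 seg (jump i v) by exact: (jump_ae_linear i).1.
split; first exact: space_VB.
- by move=> i; apply: L2_B; [exact: Ql|exact: Ql'].
- move=> v Vv; have Lv := (V_is_deriv1 Vv).1.
  have -> : \int[seg]_x ((rho \- rho') x * v.2 x) = ip seg rho v.2 - ip seg rho' v.2.
    by rewrite ipE ipB.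
  have <- : form_a u v - form_b L l lam v = ip seg rho v.2 by rewrite -ipE; exact: Hu1.
  have <- : form_a u' v - form_b L l lam' v = ip seg rho' v.2 by rewrite -ipE; exact: Hu1'.
  have -> : form_a (u - u') v = form_a u v - form_a u' v.
    by rewrite [u - u']addrC -scaleN1r form_aZD// mulN1r addrC.
  have -> : form_b L l (fun i => lam i \- lam' i) v = form_b L l lam v - form_b L l lam' v.
    rewrite !form_bE -sumrB; apply: eq_bigr => i _.
    exact: (ipB (Ql i) (Ql' i) (Lj v i Vv)).
  have R4 (a b c e : R) : a - b - (c - e) = a - c - (b - e) by ring.
  exact: R4.
- move=> mu Lmu.
  have -> : form_b L l mu (u - u') = form_b L l mu u - form_b L l mu u'.
    rewrite !form_bE -sumrB; apply: eq_bigr => i _.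
    rewrite [u - u']addrC -scaleN1r.
    rewrite (ip_ae_linearr space_V_ZD (-1) (jump_ae_linear i) Vu' Vu (Lmu i)).
    by rewrite mulN1r addrC.
  have -> : form_c L (fun i => lam i \- lam' i) mu = form_c L lam mu - form_c L lam' mu.
    rewrite !form_cE -sumrB; apply: eq_bigr => i _.
    exact: (ipB (Ql i) (Ql' i) (Lmu i)).
  have R4 (a b c e : R) : a + alpha * c = 0 -> b + alpha * e = 0 ->
    a - b + alpha * (c - e) = 0 by lra.
  exact: (R4 _ _ _ _ (Hu2 mu Lmu) (Hu2' mu Lmu)).
Qed.

(** Let [X] be the left-hand side. It equals the pairing of [rho] with [u.2], so Cauchy-Schwarz and
    the coercivity of [form_a] give [X ^+ 2 <= K * |rho|^2 * form_a u u <= K * |rho|^2 * X], and one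
    factor [X] is divided out. [K] is the coercivity constant, chosen before [alpha]. *)
Lemma solution_energy : exists2 K, 0 < K & forall alpha rho u lam,
  0 < alpha -> L2 seg rho -> solution alpha rho u lam ->
  form_a u u + alpha * (\sum_(i < 2) sq seg (lam i)) <= K * sq seg rho.
Proof.
have [K K0 HK] := form_a_coercive; exists K => // alpha rho u lam a0 Lrho.
move=> [Vu Ql /(_ u Vu) H1 /(_ lam Ql) H2].
rewrite ipE in H1; rewrite form_cE in H2.
set y := \sum_(i < 2) _ in H2 *.
have y0 : 0 <= y by apply: sumr_ge0 => i _; exact: ip_ge0.
have x0 := form_a_ge0 Vu; have r0 := ip_ge0 seg rho.
have cs := cauchy_schwarz Lrho (V_is_deriv1 Vu).1.
have s1 : sq seg u.2 <= K * form_a u u.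
  apply: le_trans (HK u Vu); apply: le_trans (H1norm_seg_le_norm_V u).
  by rewrite (H1norm_seg_sqr (V_is_deriv1 Vu)) /d1sq lerDl ip_ge0.
have E : form_a u u + alpha * y = ip seg rho u.2.
  by rewrite -H1; congr (_ + _); apply/eqP; rewrite eq_sym eqr_oppLR -addr_eq0 H2.
have cs2 : ip seg rho u.2 ^+ 2 <= sq seg rho * (K * form_a u u).
  by apply: le_trans cs _; rewrite ler_wpM2l.
have ay0 : 0 <= alpha * y by rewrite mulr_ge0// ltW.
move: E cs2 ay0 x0 r0; move: (alpha * y) (form_a u u) (ip seg rho u.2) (sq seg rho).
move=> ay x F r E cs2 ay0 x0 r0; rewrite -E in cs2.
have [xy0|xy0] := eqVneq (x + ay) 0; first by rewrite xy0 mulr_ge0// ltW.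
have xy_gt0 : 0 < x + ay by rewrite lt_neqAle eq_sym xy0 addr_ge0.
rewrite -(ler_pM2l xy_gt0) -expr2; apply: le_trans cs2 _.
rewrite mulrCA [(x + ay) * _]mulrC -!mulrA ler_wpM2l ?(ltW K0)// ler_wpM2l//.
by rewrite lerDl.
Qed.

Lemma solution_unique alpha rho u lam u' lam' : 0 < alpha -> L2 seg rho ->
  solution alpha rho u lam -> solution alpha rho u' lam' ->
  eq_V L l u u' /\ eq_Q L lam lam'.
Proof.
move=> a0 Lrho s s'; have := solution_sub Lrho Lrho s s'.
set w := u - u' => sw; have [K K0 HK] := solution_energy.
have := HK _ _ _ _ a0 (L2_B Lrho Lrho) sw.
have [Vw Qw _ _] := sw; have [Kc Kc0 Hc] := form_a_coercive.
have -> : sq seg (rho \- rho) = 0 by apply: sq_cst0 => x /=; exact: subrr.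
rewrite mulr0 => le0; have x0 := form_a_ge0 Vw.
have y0 : 0 <= \sum_(i < 2) sq seg ((fun i => lam i \- lam' i) i).
  by apply: sumr_ge0 => i _; exact: ip_ge0.
have ay0 := mulr_ge0 (ltW a0) y0.
have a_eq0 : form_a w w = 0 by apply: le_anti; rewrite x0 andbT; apply: le_trans le0; rewrite lerDl.
have y_eq0 : \sum_(i < 2) sq seg ((fun i => lam i \- lam' i) i) = 0.
  apply: le_anti; rewrite y0 andbT -(ler_pM2l a0) mulr0; apply: le_trans le0.
  by rewrite lerDr.
have n_eq0 : norm_V L l w ^+ 2 <= 0 by apply: le_trans (Hc w Vw) _; rewrite a_eq0 mulr0.
have sub_ae d0 (T : measurableType d0) (mu : {measure set T -> \bar R}) (f g : T -> R) :
    L2 mu (f \- g) -> sq mu (f \- g) <= 0 -> ae_eq mu setT f g.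
  move=> Lfg fg0; have /(ip_eq0 Lfg) : sq mu (f \- g) = 0.
    by apply: le_anti; rewrite fg0 ip_ge0.
  by apply: filterS => x /(_ I) /= /eqP + _; rewrite subr_eq0 => /eqP.
split; first split.
- move=> i; have le : sq (area (rect i)) (u.1 i \- u'.1 i) <= 0.
    apply: le_trans n_eq0; apply: le_trans (H1norm_le_norm_V w i).
    by rewrite (H1norm_sqr (V_is_grad i Vw)) /h1sq lerDl gradsq_ge0.
  exact: (sub_ae _ _ (area (rect i)) (u.1 i) (u'.1 i) (V_is_grad i Vw).1 le).
- have le : sq seg (u.2 \- u'.2) <= 0.
    apply: le_trans n_eq0; apply: le_trans (H1norm_seg_le_norm_V w).
    by rewrite (H1norm_seg_sqr (V_is_deriv1 Vw)) /d1sq lerDl ip_ge0.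
  exact: (sub_ae _ _ seg u.2 u'.2 (V_is_deriv1 Vw).1 le).
- move=> i; have le : sq seg (lam i \- lam' i) <= 0.
    rewrite -[X in _ <= X]y_eq0 (bigD1 i)// lerDl.
    by apply: sumr_ge0 => j _; exact: ip_ge0.
  exact: (sub_ae _ _ seg (lam i) (lam' i) (Qw i) le).
Qed.

Definition single i (y : R * R -> R) : triple R :=
  (fun k => if k == i then y else cst 0, cst 0).

Lemma single_space_V i y :
  H10 (rect i) (boundary (Omega_ L l i) `\` gamma2 L) y -> V (single i y).
Proof.
move=> /(H10P (pD i)) Hy; apply: space_V_intro => [k|]; last first.
  by eexists; exact: (h10_seg_0 L_gt0).
rewrite /single /=; case: eqP => [->|_].
  by eexists; eexists; exact: (h10_sub (@GammaD_gamma i) Hy).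
by eexists; eexists; exact: (h10_0 (pD k) (Gam k)).
Qed.

Lemma H1norm_0 i : H1norm (rect i) (cst 0) = 0.
Proof.
apply/eqP; rewrite -sqrf_eq0; apply/eqP; have [g0 _ _] := h10_0 (pD i) set0.
rewrite (H1norm_sqr g0) /h1sq /gradsq ip0l add0r big1// => j _.
Qed.

Lemma norm_V_single i y : norm_V L l (single i y) ^+ 2 = H1norm (rect i) y ^+ 2.
Proof.
rewrite norm_V_sqr (H1norm_seg_sqr (h10_seg_0 L_gt0).1) /d1sq !ip0l !addr0.
rewrite (bigD1 i)//= eqxx big1 ?addr0// => k /negbTE ->.
by rewrite H1norm_0 expr0n.
Qed.

(** On the other subdomain the jump is the chosen trace of [cst 0], which is 0 only almost
    everywhere, hence the detour through [ae_eq_ip]. *)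
Lemma form_b_single i y lam : (forall k, L2 seg (lam k)) -> V (single i y) ->
  form_b L l lam (single i y) = duality L (lam i) (trace_gamma L l i y).
Proof.
move=> Ql VW; rewrite form_bE (bigD1 i)//= big1 ?addr0 => [|k ki].
  rewrite [RHS]ipE; congr ip; apply/funext => x.
  by rewrite /jump /single /= eqxx subr0.
have Lj : L2 seg (jump k (single i y)) by exact: (jump_ae_linear k).1.
have [g0 t0 _] := h10_0 (pD k) set0.
have H := ae_eq_gamma (is_trace_trace t0).1 t0.1 (traceE (pD k) g0 t0).
rewrite (@ae_eq_ip _ _ _ _ _ (lam k) _ (cst 0))//; first by rewrite ipC ip0l.
- exact: L2_0.
- exact: ae_eq_refl.
- apply: filterS H => x /(_ I) E _; rewrite /jump /single /= (negbTE ki) /trace_gamma.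
  by rewrite E /cst subr0.
Qed.

(* The first equation tested with [single i v] reads [form_a u (single i v) =
   <lam i, v>]. *)
Lemma dual_norm_le : exists2 K, 0 <= K & forall alpha rho u lam i,
  solution alpha rho u lam ->
  (0 <= dual_norm L l i (lam i) /\
   dual_norm L l i (lam i) ^+ 2 <= (K * form_a u u)%:E)%E.
Proof.
have [K K0 HK] := form_a_bounded; exists K => // alpha rho u lam i [Vu Ql Hu1 _].
have x0 := form_a_ge0 Vu; have Kx0 := mulr_ge0 K0 x0.
(* The zero function contributes the quotient [0 / 0 = 0] to the supremum. Nonnegativity allows the
   upper bound to be squared. *)
have ge0 : (0 <= dual_norm L l i (lam i))%E.
  apply: ereal_sup_ubound; exists (cst 0); first exact: (h10_H10 (h10_0 (pD i) _)).
  by rewrite H1norm_0 invr0 mulr0.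
have le : (dual_norm L l i (lam i) <= (Num.sqrt (K * form_a u u))%:E)%E.
  apply: ub_ereal_sup => _ [y Hy <-]; rewrite lee_fin.
  have VW := single_space_V Hy.
  have E : form_a u (single i y) = duality L (lam i) (trace_gamma L l i y).
    have := Hu1 _ VW; rewrite (form_b_single Ql VW) ipE ipC ip0l.
    by move/eqP; rewrite subr_eq0 => /eqP.
  (* Cauchy-Schwarz for [form_a] itself bounds the pairing by the energy of [u], so neither [alpha]
     nor [rho] appears. *)
  have cs := semi_cauchy_schwarz space_V_ZD form_aC form_aZD form_a_ge0 Vu VW.
  have := HK _ VW; rewrite norm_V_single => HW.
  have [N0|N0] := eqVneq (H1norm (rect i) y) 0.
    by rewrite N0 invr0 mulr0 sqrtr_ge0.
  have N_gt0 : 0 < H1norm (rect i) y by rewrite lt_neqAle eq_sym N0 H1norm_ge0.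
  rewrite ler_pdivrMr// -E.
  exact: (ler_sqrtM x0 K0 (ltW N_gt0) cs HW).
split => //; rewrite -(sqr_sqrtr Kx0); exact: sqre_le_fin.
Qed.

Lemma norm_Lambda_sqr lam : (forall i, (0 <= dual_norm L l i (lam i))%E) ->
  (norm_Lambda L l lam ^+ 2 = \sum_(i < 2) dual_norm L l i (lam i) ^+ 2)%E.
Proof.
move=> H; rewrite /norm_Lambda sqr_sqrte//.
by apply: sume_ge0 => i _; exact: expe_ge0.
Qed.

Lemma solution_bound : exists2 C, 0 < C & forall alpha rho u lam,
  0 < alpha -> L2 seg rho -> solution alpha rho u lam ->
  ((norm_V L l u ^+ 2)%:E + norm_Lambda L l lam ^+ 2 +
     (alpha * norm_Q L lam ^+ 2)%:E <= (C * L2norm seg rho ^+ 2)%:E)%E.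
Proof.
have [Kc Kc0 Hc] := form_a_coercive; have [Kd Kd0 Hd] := dual_norm_le.
have [Ke Ke0 He] := solution_energy.
(* [Kc] serves the norm of [u], [2 * Kd] the two dual norms and 1 the term
   [alpha * norm_Q L lam ^+ 2]; [Ke] bounds the energy. None of them depends on [alpha] or [rho]. *)
exists ((Kc + 2 * Kd + 1) * Ke).
  by rewrite mulr_gt0// ltr_wpDl// addr_ge0 ?(ltW Kc0)// mulr_ge0.
move=> alpha rho u lam a0 Lrho s; have [Vu Ql _ _] := s.
have D0 i := (Hd _ _ _ _ i s).1; have D1 i := (Hd _ _ _ _ i s).2.
rewrite norm_Lambda_sqr// L2norm_sqr.
have -> : norm_Q L lam ^+ 2 = \sum_(i < 2) sq seg (lam i).
  rewrite /norm_Q sqr_sqrtr; last by apply: sumr_ge0 => i _; exact: sqr_ge0.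
  by apply: eq_bigr => i _; exact: L2norm_sqr.
have Le : (\sum_(i < 2) dual_norm L l i (lam i) ^+ 2 <= (2 * (Kd * form_a u u))%:E)%E.
  apply: le_trans (lee_sum _ (fun i _ => D1 i)) _.
  by rewrite sumEFin lee_fin sumr_const card_ord mulr_natl.
apply: le_trans (leeD (leeD (lexx _) Le) (lexx _)) _.
rewrite -!EFinD lee_fin.
have := He _ _ _ _ a0 Lrho s; have := Hc u Vu; have x0 := form_a_ge0 Vu.
have y0 : 0 <= alpha * (\sum_(i < 2) sq seg (lam i)).
  by rewrite mulr_ge0 ?(ltW a0)//; apply: sumr_ge0 => i _; exact: ip_ge0.
move: (alpha * _) y0 x0 => y y0; move: (form_a u u) (norm_V _ _ _ ^+ 2) (sq seg rho).
move=> x n r x0 n1 e1.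
have k0 : 0 <= Kc + 2 * Kd by rewrite addr_ge0 ?(ltW Kc0)// mulr_ge0.
have := ler_wpM2l (addr_ge0 k0 ler01) e1.
have := mulr_ge0 k0 y0; lra.
Qed.

End transmission.

Theorem theorem5p1 (R : realType) (L l : R) (GammaD GammaN : set (R * R))
    (d eps_ox eps_par : R)
    (L_gt0 : 0 < L) (l_gt0 : 0 < l)
    (d_gt0 : 0 < d) (eps_ox_gt0 : 0 < eps_ox) (eps_par_gt0 : 0 < eps_par)
    (GammaU : GammaD `|` GammaN = boundary (Omega L l))
    (GammaI : GammaD `&` GammaN = set0)
    (GammaD_endpoints : GammaD (0, 0) /\ GammaD (L, 0))
    (GammaN_gamma : forall i : 'I_2,
       closure (boundary (Omega_ L l i) `&` GammaN) `&` closure (gamma2 L) = set0) :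
  let alpha (eps_perp : R) := d / (2 * eps_perp) in
  let sol (eps_perp : R) :=
    is_solution L l GammaD d eps_ox eps_par (alpha eps_perp) in
  (forall (eps_perp : R) (rho : R -> R),
     0 < eps_perp -> L2 (segment_measure 0 L) rho ->
     exists u lam, sol eps_perp rho u lam /\
       forall u' lam', sol eps_perp rho u' lam' ->
         eq_V L l u u' /\ eq_Q L lam lam') /\
  (exists2 C : R, 0 < C &
     forall (eps_perp : R) (rho : R -> R) u lam,
       0 < eps_perp -> L2 (segment_measure 0 L) rho ->
       sol eps_perp rho u lam ->
       ((norm_V L l u ^+ 2)%:E + norm_Lambda L l lam ^+ 2 +
          (alpha eps_perp * norm_Q L lam ^+ 2)%:E
        <= (C * L2norm (segment_measure 0 L) rho ^+ 2)%:E)%E).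
Proof.
move=> alpha sol.
have left_side := GammaD_left_side L_gt0 l_gt0 GammaU GammaN_gamma.
have sub_gamma2 := GammaD_sub_gamma2 l_gt0 GammaU.
have alpha_gt0 e : 0 < e -> 0 < alpha e by move=> e0; rewrite divr_gt0// mulr_gt0.
split=> [e rho /alpha_gt0 a0 Lrho|].
  have [u [lam s]] := solution_exists L_gt0 l_gt0 d_gt0 eps_ox_gt0 eps_par_gt0
    left_side a0 Lrho.
  exists u, lam; split => // u' lam'.
  exact: (solution_unique L_gt0 l_gt0 d_gt0 eps_ox_gt0 eps_par_gt0 left_side a0 Lrho s).
have [C C0 HC] := solution_bound L_gt0 l_gt0 d_gt0 eps_ox_gt0 eps_par_gt0
  left_side sub_gamma2.
by exists C => // e rho u lam /alpha_gt0; exact: HC.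
Qed.
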